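(* Let $-\infty<\alpha<0<\beta<+\infty$, $I=(\alpha,\beta)$, and let $V\in C^2(I)$ be a real-valued function such that $V(0)=V'(0)=0$, $xV'(x)>0$ for all $x\in I\setminus\{0\}$, $\lim_{x\to\alpha^+}V(x)=\lim_{x\to\beta^-}V(x)=\overline{V}<+\infty$, and $\lim_{x\to\alpha^+}V'(x)=-\infty$. Assume that all solutions of $\ddot x+V'(x)=0$ with initial condition in the period annulus $\mathscr{P}$ are $2\pi$-periodic. Let $p\in L^1(\mathbb{R}/2\pi\mathbb{Z})$ be real-valued and such that $$\inf_{(\theta,r)\in\mathcal{C}}|\Phi_p(\theta,r)|>0 .$$ Then for every compact subset $\mathcal{K}\subset\mathscr{P}$ with non-empty interior and every $d>0$ there exists $\varepsilon^*>0$ such that, if $0<|\varepsilon|<\varepsilon^*$, then every open ball $B\subset\mathcal{K}$ of diameter $d$ satisfies $\varphi_\varepsilon(t,B)\not\subset\mathcal{K}$ for some time $t>0$.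
   Context: Period annulus: $\mathscr{P}=\{(x,y)\in I\times\mathbb{R}: \tfrac12 y^2+V(x)<\overline{V}\}$, the bounded open region (including the equilibrium at the origin) filled by the periodic orbits of the planar system $\dot x=y$, $\dot y=-V'(x)$. Perturbed flow: for $\varepsilon\in\mathbb{R}$ and $\mathbf{x}\in\mathscr{P}$, $\varphi_\varepsilon(t,\mathbf{x})$ denotes the (Carathéodory) solution at time $t$ of the first order system $\dot x=y$, $\dot y=-V'(x)+\varepsilon p(t)$ with value $\mathbf{x}=(x,\dot x)$ at $t=0$, and $\varphi_\varepsilon(t,\mathcal{U})=\{\varphi_\varepsilon(t,\mathbf{x}):\mathbf{x}\in\mathcal{U}\}$ for $\mathcal{U}\subset\mathscr{P}$. The assertion $\varphi_\varepsilon(t,B)\not\subset\mathcal{K}$ for some $t>0$ means: there are $t>0$ and $\mathbf{x}\in B$ such that the solution starting at $\mathbf{x}$ is defined on $[0,t]$ and $\varphi_\varepsilon(t,\mathbf{x})\notin\mathcal{K}$. The function $\Phi_p$: let $\mathcal{C}=(\mathbb{R}/2\pi\mathbb{Z})\times[0,\beta)$ with coordinates $(\theta,r)$. For $r\in[0,\beta)$ let $\phi(t,r)$ be the solution of $\ddot x+V'(x)=0$ with $x(0)=r$, $\dot x(0)=0$, and let $\psi(t,r)$ be the complex-valued solution of the variational equation $\ddot y+V''(\phi(t,r))y=0$, $y(0)=1$, $\dot y(0)=i$. Then $$\Phi_p:\mathcal{C}\to\mathbb{C},\qquad \Phi_p(\theta,r)=\frac{1}{2\pi}\int_0^{2\pi}p(t-\theta)\psi(t,r)\,dt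 .$$ *)

(* Defs.v *)
From mathcomp Require Import all_boot all_order all_algebra.
From mathcomp Require Import complex.
From mathcomp Require Import all_classical all_reals all_analysis.

Set Implicit Arguments.
Unset Strict Implicit.
Unset Printing Implicit Defensive.
Import Order.TTheory GRing.Theory Num.Theory.
Import numFieldNormedType.Exports.

Local Open Scope ring_scope.
Local Open Scope complex_scope.
Local Open Scope classical_set_scope.

(* A function on the open interval (alpha, beta) is a total function R -> R of
   which only the values on that interval are ever used; its derivatives at
   interior points depend on those values only. *)
Definition C2_on (R : realType) (alpha beta : R) (V : R -> R) : Prop :=
  forall x, alpha < x < beta ->
    [/\ derivable V x 1, derivable (derive1 V) x 1
      & {for x, continuous (derive1n 2 V)}].

Definition period_annulus (R : realType) (alpha beta Vbar : R) (V : R -> R) :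
    set (R * R) :=
  [set z | alpha < z.1 < beta /\ z.2 ^+ 2 / 2 + V z.1 < Vbar].

(* Classical solutions, defined on the whole time axis, of x'' + V'(x) = 0. *)
Definition newton_solution (R : realType) (alpha beta : R) (V : R -> R)
    (x : R -> R) : Prop :=
  forall t, [/\ alpha < x t < beta, derivable x t 1, derivable (derive1 x) t 1
              & derive1n 2 x t + derive1 V (x t) = 0].

(* Functions of class L^1 on the circle R / 2 pi Z, as periodic functions on R. *)
Definition L1_circle (R : realType) (p : R -> R) : Prop :=
  periodic p (2 * pi) /\
  lebesgue_measure.-integrable `[0, 2 * pi] (EFin \o p).

(* Differentiation and integration of complex-valued functions of one real
   variable, componentwise. (The normed structure of R[i] in the library is
   over R[i] itself, so 'derivable' would mean complex differentiability.) *)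
Definition cderivable (R : realType) (w : R -> R[i]) (t : R) : Prop :=
  derivable (fun s => complex.Re (w s)) t 1 /\
  derivable (fun s => complex.Im (w s)) t 1.

Definition cderive1 (R : realType) (w : R -> R[i]) (t : R) : R[i] :=
  Complex (derive1 (fun s => complex.Re (w s)) t)
          (derive1 (fun s => complex.Im (w s)) t).

Definition cintegral (R : realType) (D : set R) (w : R -> R[i]) : R[i] :=
  Complex (\int[lebesgue_measure]_(t in D) complex.Re (w t))
          (\int[lebesgue_measure]_(t in D) complex.Im (w t)).

(* phi(., r): for V of class C^2 the solution is unique, so that the choice made
   by 'xget' is immaterial; likewise for psi. *)
Definition phi (R : realType) (alpha beta : R) (V : R -> R) (r : R) : R -> R :=
  xget (fun=> 0) [set x | [/\ newton_solution alpha beta V x, x 0 = r & derive1 x 0 = 0]].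

Definition variational_solution (R : realType) (V x : R -> R)
    (w : R -> R[i]) : Prop :=
  forall t, [/\ cderivable w t, cderivable (cderive1 w) t
              & cderive1 (cderive1 w) t + (derive1n 2 V (x t))%:C * w t = 0].

Definition psi (R : realType) (alpha beta : R) (V : R -> R) (r : R) : R -> R[i] :=
  xget (fun=> 0) [set w | [/\ variational_solution V (phi alpha beta V r) w,
                   w 0 = 1 & cderive1 w 0 = 'i]].

Definition Phi (R : realType) (alpha beta : R) (V p : R -> R)
    (theta r : R) : R[i] :=
  ((2 * pi)^-1)%:C *
  cintegral `[0, 2 * pi] (fun t => (p (t - theta))%:C * psi alpha beta V r t).

(* The values of |Phi| on the cylinder (R / 2 pi Z) x [0, beta). As p is
   2 pi-periodic, so is Phi in theta, which may hence range over R. *)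
Definition Phi_moduli (R : realType) (alpha beta : R) (V p : R -> R) : set R :=
  [set ComplexField.Normc.normc (Phi alpha beta V p z.1 z.2)
    | z in [set: R] `*` `[0, beta[].

Definition absolutely_continuous (R : realType) (a b : R) (f : R -> R) : Prop :=
  forall e : R, 0 < e -> exists2 d : R, 0 < d &
    forall (n : nat) (u v : 'I_n -> R),
      (forall i, [/\ a <= u i, u i <= v i & v i <= b]) ->
      trivIset setT (fun i => `]u i, v i[%classic) ->
      \sum_(i < n) (v i - u i) < d ->
      \sum_(i < n) `|f (v i) - f (u i)| < e.

(* Caratheodory solutions on [0, T] of x' = y, y' = - V'(x) + eps p(t). *)
Definition perturbed_solution (R : realType) (alpha beta : R) (V p : R -> R)
    (eps T : R) (x y : R -> R) : Prop :=
  [/\ absolutely_continuous 0 T x, absolutely_continuous 0 T y,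
      (forall t, 0 <= t <= T -> alpha < x t < beta)
    & {ae lebesgue_measure, forall t : R, 0 < t < T ->
        is_derive t (1 : R) x (y t) /\
        is_derive t (1 : R) y (- derive1 V (x t) + eps * p t)}].

(* varphi_eps(T, U) for T >= 0: the states at time T of the solutions that start
   in U at time 0 and are defined on [0, T]. *)
Definition flow_image (R : realType) (alpha beta : R) (V p : R -> R)
    (eps T : R) (U : set (R * R)) : set (R * R) :=
  [set w | exists x y : R -> R,
    [/\ perturbed_solution alpha beta V p eps T x y,
        U (x 0, y 0) & w = (x T, y T)]].

(* Euclidean, whereas 'ball' on R * R is the ball of the sup norm. *)
Definition open_disc (R : realType) (c : R * R) (rho : R) : set (R * R) :=
  [set z | Num.sqrt ((z.1 - c.1) ^+ 2 + (z.2 - c.2) ^+ 2) < rho].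

(* Main.v *)
Require Import Defs.
From mathcomp Require Import all_boot all_order all_algebra.
From mathcomp Require Import complex.
From mathcomp Require Import all_classical all_reals all_analysis.
From mathcomp Require Import measurable_realfun ring lra.

Set Implicit Arguments.
Unset Strict Implicit.
Unset Printing Implicit Defensive.
Import Order.TTheory GRing.Theory Num.Theory.
Import numFieldNormedType.Exports.

Local Open Scope ring_scope.
Local Open Scope classical_set_scope.

(** All free motions having the period [2 pi], the period map of the unperturbed
    system is the identity. By variation of constants, the period map of the
    perturbed system is therefore, up to [o(eps)], an Euler step of size [eps] for a
    fixed plane field [F]. The components of [F] at [z] are, up to order and sign,
    the integrals over a period of [p] times the two normalized solutions of the
    variational equation along the free motion through [z]. These solutions are
    combinations of the real and imaginary parts of [psi], shifted in time by the
    phase of [z]; so [F] vanishes only where [Phi] does, that is nowhere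
    ([moment_nondegenerate], [period_map_expansion]).

    The field [F] is also Hamiltonian: it is the symplectic gradient of
    [h z], the integral over a period of [p] times the position of the free motion
    from [z]. Let the ball be trapped in [K] for arbitrarily small [eps]. It is enough
    to follow its centre: the states at the multiples of the period are then an
    infinite sequence of small, nearly exact Euler steps inside a sublevel set [D] of
    the energy, which is compact and star-shaped. As [eps] tends to 0, such sequences
    have limits that are complete orbits of [F] in [D] ([euler_steps_limit]).

    But a Hamiltonian field without zeros has no complete orbit in [D]
    ([no_hamiltonian_orbit]). Near a limit point such an orbit consists of pieces of
    the level line of [h] through that point, hence it passes through the point
    repeatedly and is closed ([orbit_returns]). And there is no simple closed orbit
    ([no_simple_closed_orbit]): contracting the orbit inside [D] shows that [F] has
    winding number 0 along it, whereas the tangent of a simple closed curve makes a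
    full turn, by Hopf's argument with secants. Winding numbers enter only through
    their parity, as the sign by which a continuous square root of the field along
    the orbit differs from itself after one turn ([continuous_half_angle]).

    Two devices keep the regularity low. As [V] is only twice continuously
    differentiable, no derivative of the flow is taken: solutions of the variational
    equation are paired with differences of motions ([pairing_change]), which yields
    the expansions of [h] and of the period map, uniformly in [z]. As [p] is only
    integrable, motions are described by the position [x] and by [u = x' - eps P],
    where [P] is a primitive of [p]; these satisfy a system with continuous right
    hand side, and give back Caratheodory solutions because [P] is absolutely
    continuous with derivative [p] almost everywhere ([motion_perturbed]). *)

(** * Derivatives and primitives of functions of one real variable *)

Notation der f t l := (is_derive t 1 f l).

Section Calculus.
Context {R : realType}.
Implicit Types (f g : R -> R) (s t a b : R).

Lemma der_eq f t l l' : der f t l -> l = l' -> der f t l'.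
Proof. by move=> h <-. Qed.

Lemma der_unique f t l l' : der f t l -> der f t l' -> l = l'.
Proof. by move=> [_ <-] [_ <-]. Qed.

Lemma der_derivable f t l : der f t l -> derivable f t 1.
Proof. by case. Qed.

Lemma der_derive1 f t l : der f t l -> derive1 f t = l.
Proof. by move=> [_ h]; rewrite derive1E. Qed.

Lemma derivable_der f t : derivable f t 1 -> der f t (derive1 f t).
Proof. by move=> h; rewrite derive1E; apply: derivableP. Qed.

Lemma der_cont f t l : der f t l -> {for t, continuous f}.
Proof. by case=> /derivable1_diffP /differentiable_continuous. Qed.

Lemma derD f g t l m : der f t l -> der g t m -> der (fun s => f s + g s) t (l + m).
Proof. exact: is_deriveD. Qed.

Lemma derN f t l : der f t l -> der (fun s => - f s) t (- l).
Proof. exact: is_deriveN. Qed.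

Lemma derB f g t l m : der f t l -> der g t m -> der (fun s => f s - g s) t (l - m).
Proof. exact: is_deriveB. Qed.

Lemma derM f g t l m : der f t l -> der g t m ->
  der (fun s => f s * g s) t (l * g t + f t * m).
Proof.
move=> hf hg.
have h : der (fun s => f s * g s) t (f t *: m + g t *: l) by exact: is_deriveM.
by apply: der_eq h _; rewrite /GRing.scale /= addrC mulrC.
Qed.

Lemma der_cst (c : R) t : der (fun=> c) t 0.
Proof. exact: is_derive_cst. Qed.

Lemma der_id t : der (fun s => s) t 1.
Proof. exact: is_derive_id. Qed.

Lemma derZ (c : R) f t l : der f t l -> der (fun s => c * f s) t (c * l).
Proof.
move=> hf; have h := derM (der_cst c t) hf.
by apply: der_eq h _; rewrite mul0r add0r.
Qed.

Lemma der_comp f g t l m : der g t m -> der f (g t) l ->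
  der (fun s => f (g s)) t (l * m).
Proof. by move=> hg hf; apply: (is_derive1_comp hf hg). Qed.

Lemma der_shift f t c l : der f (t + c) l -> der (fun s => f (s + c)) t l.
Proof.
move=> h; have h1 : der (fun s => s + c) t 1.
  by have h1 := derD (der_id t) (der_cst c t); apply: der_eq h1 _; rewrite addr0.
have h2 := @der_comp f (fun s => s + c) t l 1 h1 h.
by apply: der_eq h2 _; rewrite mulr1.
Qed.

Lemma der_rev f t l : der f (- t) l -> der (fun s => f (- s)) t (- l).
Proof.
move=> h; have h2 := @der_comp f (fun s => - s) t l (- 1) (derN (der_id t)) h.
by apply: der_eq h2 _; rewrite mulrN1.
Qed.

Lemma der_near f g t l : (\forall s \near t, f s = g s) -> der f t l -> der g t l.
Proof.
by move=> hfg hf; apply: near_eq_is_derive hf.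
Qed.

(** The form of the derivative that passes to limits and to glued functions. *)
Lemma der_epsP f t l : der f t l <->
  forall e : R, 0 < e -> exists2 d : R, 0 < d &
    forall s, `|s| <= d -> `|f (t + s) - f t - l * s| <= e * `|s|.
Proof.
split=> [[df fl] e e0|H].
  have /cvgrPdist_le /(_ e e0) : (fun h => h^-1 *: ((f \o shift t) (h *: 1) - f t)) @
     0^' --> l by rewrite -fl; exact: df.
  move=> /nbhs_ballP[d /= d0 Hd]; exists (d / 2); first by rewrite divr_gt0.
  move=> s sd; have [->|s0] := eqVneq s 0.
    by rewrite addr0 subrr mulr0 subr0 normr0 mulr0.
  have := Hd s; rewrite /ball /= sub0r normrN => /(_ _ s0).
  have sd' : `|s| < d.
    by apply: (le_lt_trans sd); rewrite ltr_pdivrMr// ltr_pMr// ltr1n.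
  move=> /(_ sd'); rewrite /= [s *: 1]mulr1 addrC (addrC s t) => h.
  rewrite -[X in _ <= X]mulrC -ler_pdivrMl ?normr_gt0//.
  rewrite -normfV -normrM mulrBr [s^-1 * (l * s)]mulrCA mulVf// mulr1.
  by rewrite -normrN opprB addrC; move: h; rewrite /GRing.scale /= addrC.
have c : (fun h => h^-1 *: ((f \o shift t) (h *: 1) - f t)) @ 0^' --> l.
  apply/cvgrPdist_le => e e0; have [d d0 Hd] := H e e0.
  apply/nbhs_ballP; exists d => //= s.
  rewrite /ball /= sub0r normrN => /ltW sd s0.
  have := Hd s sd; rewrite /= [s *: 1]mulr1 (addrC s t).
  rewrite -[X in _ <= X]mulrC -ler_pdivrMl ?normr_gt0//.
  rewrite -normfV -normrM mulrBr [s^-1 * (l * s)]mulrCA mulVf// mulr1.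
  by rewrite -normrN opprB.
split; last exact/cvg_lim.
by apply/cvg_ex; exists l.
Qed.

Lemma der_within f (f' : R -> R) a b :
  (forall t, a <= t <= b -> der f t (f' t)) -> {within `[a, b], continuous f}.
Proof.
move=> H; apply: derivable_within_continuous => t; rewrite in_itv /= => tab.
exact: der_derivable (H t tab).
Qed.

(** The comparison is with a majorant, and not only with a constant, because
    Picard iteration is estimated in an exponentially weighted norm. *)
Lemma mvt_major f f' g g' a b : a <= b ->
  (forall t, a <= t <= b -> der f t (f' t)) ->
  (forall t, a <= t <= b -> der g t (g' t)) ->
  (forall t, a <= t <= b -> `|f' t| <= g' t) ->
  `|f b - f a| <= g b - g a.
Proof.
move=> ab hf hg hb.
have key (k k' : R -> R) : (forall t, a <= t <= b -> der k t (k' t)) ->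
    (forall t, a <= t <= b -> 0 <= k' t) -> k a <= k b.
  move=> hk hp.
  have ioo t : t \in `]a, b[%R -> a <= t <= b.
    by rewrite in_itv /= => /andP[/ltW -> /ltW ->].
  have [t tab E] := @MVT_segment R k k' a b ab (fun t tab => hk t (ioo t tab)) (der_within hk).
  rewrite -subr_ge0 E mulr_ge0 ?subr_ge0//; apply: hp.
  by move: tab; rewrite in_itv.
rewrite ler_norml; apply/andP; split.
  rewrite lerNl opprB -subr_ge0.
  have := key (fun t => f t + g t) (fun t => f' t + g' t).
  move=> /(_ (fun t tab => derD (hf t tab) (hg t tab))) h.
  have : f a + g a <= f b + g b.
    by apply: h => t tab; have := hb t tab; rewrite ler_norml => /andP[]; lra.
  lra.
have := key (fun t => g t - f t) (fun t => g' t - f' t).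
move=> /(_ (fun t tab => derB (hg t tab) (hf t tab))) h.
have : g a - f a <= g b - f b.
  by apply: h => t tab; have := hb t tab; rewrite ler_norml => /andP[]; lra.
lra.
Qed.

Lemma mvt_bound f f' a b (c : R) : a <= b ->
  (forall t, a <= t <= b -> der f t (f' t)) ->
  (forall t, a <= t <= b -> `|f' t| <= c) ->
  `|f b - f a| <= c * (b - a).
Proof.
move=> ab hf hb.
have := @mvt_major f f' (fun t => c * t) (fun=> c * 1) a b ab hf.
rewrite mulrBr; apply => t tab.
by rewrite mulr1; apply: hb.
Qed.

Lemma der0_const f : (forall t, der f t 0) -> forall s t, f s = f t.
Proof.
move=> h s t; apply: (@is_derive_0_is_cst R f) => x; exact: h.
Qed.

Lemma der0_const_on f a b : a <= b -> (forall t, a <= t <= b -> der f t 0) ->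
  forall t, a <= t <= b -> f t = f a.
Proof.
move=> ab h t /andP[at_ tb].
have H : `|f t - f a| <= 0 * (t - a).
  apply: (mvt_bound (f' := fun=> 0)) => // s /andP[u v]; last by rewrite normr0.
  by apply: h; rewrite u (le_trans v).
by apply/eqP; rewrite -subr_eq0 -normr_le0 -[X in _ <= X](mul0r (t - a)).
Qed.

Lemma cont_der f f' : (forall t, der f t (f' t)) -> continuous f.
Proof. by move=> h t; apply: der_cont (h t). Qed.

Lemma mvt_point f f' a b : a <= b ->
  (forall t, a <= t <= b -> der f t (f' t)) ->
  exists2 c, a <= c <= b & f b - f a = f' c * (b - a).
Proof.
move=> ab hf.
have ioo t : t \in `]a, b[%R -> a <= t <= b.
  by rewrite in_itv /= => /andP[/ltW -> /ltW ->].
have [t tab E] := @MVT_segment R f f' a b ab (fun t tab => hf t (ioo t tab)) (der_within hf).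
by exists t => //; move: tab; rewrite in_itv.
Qed.

(** Serves to follow the sign of the dot or cross product of two square roots
    of vector fields along a path. *)
Lemma same_sign f a b : a <= b -> continuous f ->
  (forall t, a <= t <= b -> f t != 0) -> 0 < f a * f b.
Proof.
move=> ab cf nz; rewrite ltNge; apply/negP => h.
have [] := @IVT R f a b 0 ab (continuous_subspaceT cf); last first.
  by move=> c; rewrite in_itv /= => /nz/eqP.
have a0 : f a != 0 by apply: nz; rewrite lexx.
have b0 : f b != 0 by apply: nz; rewrite lexx ab.
rewrite ge_min le_max.
have [fa|fa] := leP (f a) 0; have [fb|fb] := leP (f b) 0 => //=.
- have fa' : f a < 0 by rewrite lt_neqAle a0.
  have fb' : f b < 0 by rewrite lt_neqAle b0.
  by move: h; rewrite leNgt nmulr_rgt0 ?fb'.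
- by rewrite (ltW fb) orbT.
- by rewrite (ltW fa) ?orbT.
- by move: h; rewrite leNgt mulr_gt0.
Qed.

(** The integrals from [- n], for growing [n], differ by constants; normalized
    at 0 they fit together to one primitive on the whole line. *)
Lemma primitive f : continuous f -> {F : R -> R | F 0 = 0 & forall t, der F t (f t)}.
Proof.
move=> cf.
pose mu := @lebesgue_measure R.
have intf a b : mu.-integrable `[a, b] (EFin \o f).
  apply: continuous_compact_integrable; first exact: segment_compact.
  exact: continuous_subspaceT.
pose G (n : R) (y : R) : R := (\int[mu]_(t in `[(- n)%R, y]) f t)%R.
have dG (n t : R) : - n < t -> der (G n) t (f t).
  move=> nt.
  have [|d1 d2] := @continuous_FTC1_closed R f (- n) t (t + 1) _ (intf _ _) nt (cf t).
    by rewrite ltrDl.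
  by rewrite -d2; apply: derivable_der.
have ext n m (y : R) : - n <= 0 -> - m <= 0 -> - n <= y -> - m <= y ->
   G n y - G n 0 = G m y - G m 0.
  wlog nm : n m / n <= m.
    move=> H a b c d; have [nm|/ltW mn] := leP n m; first exact: H.
    by rewrite (H m n).
  move=> n0 m0 ny my.
  have sub z : - n <= z -> G m z = G n z + \int[mu]_(t in `[- m, - n[) f t.
    move=> nz; rewrite addrC /G.
    have -> : `[- m, z]%classic = `[- m, - n[%classic `|` `[- n, z]%classic.
      by rewrite -itv_bndbnd_setU// ?bnd_simp// lerN2.
    rewrite Rintegral_setU//=.
    - apply: integrableS (intf (- m) z) => //; first exact: measurableU.
      rewrite subUset; split => u /=; rewrite !in_itv /=.
        by move=> /andP[-> /ltW h]; rewrite (le_trans h).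
      by move=> /andP[h ->]; rewrite andbT (le_trans _ h)// lerN2.
    - apply/disj_setPS => u /= []; rewrite !in_itv /= => /andP[_ h] /andP[h2 _].
      by move: (lt_le_trans h h2); rewrite ltxx.
  by rewrite (sub y)// (sub 0)//; lra.
pose F t := G (`|t| + 1) t - G (`|t| + 1) 0.
exists F; first by rewrite /F subrr.
move=> t.
have : der (fun s => G (`|t| + 2) s - G (`|t| + 2) 0) t (f t).
  have tn : - (`|t| + 2) < t.
    by rewrite ltrNl; apply: (le_lt_trans (ler_norm _)); rewrite normrN ltrDl.
  by have h := derB (dG _ t tn) (der_cst (G (`|t| + 2) 0) t); apply: der_eq h _; rewrite subr0.
apply: der_near.
near=> s.
have sd : `|t - s| < 1 by near: s; apply: cvgr_dist_lt.
have h1 := ler_norm (- s); rewrite normrN in h1.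
have h3 := ler_norm (s); have h4 := ler_norm t.
have h5 := ler_norm (- t); rewrite normrN in h5.
have /andP[h6 h7] : -1 < t - s < 1 by rewrite -ltr_norml.
have h0 := normr_ge0 t. have h0' := normr_ge0 s.
rewrite /F; apply: ext; lra.
Unshelve. all: by end_near. Qed.

Definition prim f : R -> R :=
  xget (fun=> 0) [set F | F 0 = 0 /\ forall t, der F t (f t)].

Lemma primP f : continuous f -> prim f 0 = 0 /\ forall t, der (prim f) t (f t).
Proof.
move=> cf; rewrite /prim; case: xgetP => [F _ //|no].
by have [F F0 dF] := primitive cf; case: (no F).
Qed.

Lemma prim0 f : continuous f -> prim f 0 = 0.
Proof. by move=> /primP[]. Qed.

Lemma der_prim f t : continuous f -> der (prim f) t (f t).
Proof. by move=> /primP[_]; apply. Qed.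

End Calculus.

(** * Square roots of plane vector fields *)

Section PlaneComplex.
Context {R : realType}.
Implicit Types (x y z p q f : R * R).

(** Points of the plane are read as complex numbers: [dot x y] and [crs x y]
    are the real and imaginary parts of the product of [x] with the conjugate
    of [y]. *)
Definition dot x y : R := x.1 * y.1 + x.2 * y.2.
Definition crs x y : R := x.2 * y.1 - x.1 * y.2.

(** The square of [x] is a positive multiple of [f]: the argument of [x] is half
    that of [f], modulo a half turn. No choice of an angle is involved. *)
Definition half_angle x f : Prop := exists l : R,
  [/\ 0 < l, x.1 ^+ 2 - x.2 ^+ 2 = l * f.1 & 2 * (x.1 * x.2) = l * f.2].

Definition mulc x y : R * R := (x.1 * y.1 - x.2 * y.2, x.1 * y.2 + x.2 * y.1).

Lemma half_angle_mul x y f f' : half_angle x f -> half_angle y f' ->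
  half_angle (mulc x y) (mulc f f').
Proof.
move=> [l [l0 h1 h2]] [m [m0 h3 h4]]; exists (l * m); split=> /=.
- exact: mulr_gt0.
- transitivity ((x.1 ^+ 2 - x.2 ^+ 2) * (y.1 ^+ 2 - y.2 ^+ 2)
     - (2 * (x.1 * x.2)) * (2 * (y.1 * y.2))); first by ring.
  by rewrite h1 h2 h3 h4; ring.
- transitivity ((2 * (x.1 * x.2)) * (y.1 ^+ 2 - y.2 ^+ 2)
     + (x.1 ^+ 2 - x.2 ^+ 2) * (2 * (y.1 * y.2))); first by ring.
  by rewrite h1 h2 h3 h4; ring.
Qed.

Lemma half_angle_scale x f f' (c : R) : 0 < c ->
  f'.1 = c * f.1 -> f'.2 = c * f.2 -> half_angle x f' -> half_angle x f.
Proof.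
move=> c0 e1 e2 [l [l0 h1 h2]]; exists (l * c).
by split; [exact: mulr_gt0|rewrite h1 e1 mulrA|rewrite h2 e2 mulrA].
Qed.

(** The sum of [f] and of its modulus bisects the angle between [f] and the
    positive half axis, and vanishes on the negative half axis only. *)
Lemma half_angle_principal f (n : R) : 0 <= n -> n ^+ 2 = dot f f -> 0 < f.1 + n ->
  half_angle (f.1 + n, f.2) f.
Proof.
move=> n0 n2 h; exists (2 * (f.1 + n)); split=> /=; first by rewrite mulr_gt0.
  by rewrite sqrrD n2 /dot; ring.
by rewrite mulrA.
Qed.

Lemma dot_gt0 x : x != 0 -> 0 < dot x x.
Proof.
case: x => a b h; rewrite /dot /= -!expr2 lt_def addr_ge0 ?sqr_ge0// andbT.
apply: contra h; rewrite paddr_eq0 ?sqr_ge0// !sqrf_eq0 => /andP[/eqP-> /eqP->].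
by rewrite eqxx.
Qed.

(** The square of the product of [x] with the conjugate of [y] is a positive
    number, so that this product is real and nonzero: square roots of the same
    direction agree up to a real factor. *)
Lemma half_angle_parallel x y f f' (c : R) : f != 0 -> 0 < c ->
  f'.1 = c * f.1 -> f'.2 = c * f.2 ->
  half_angle x f -> half_angle y f' -> dot x y != 0 /\ crs x y = 0.
Proof.
move=> f0 c0 e1 e2 [l [l0 h1 h2]] [m [m0 h3 h4]].
rewrite {}e1 in h3; rewrite {}e2 in h4.
have E1 : dot x y ^+ 2 - crs x y ^+ 2 = l * m * c * dot f f.
  transitivity ((x.1 ^+ 2 - x.2 ^+ 2) * (y.1 ^+ 2 - y.2 ^+ 2)
     + (2 * (x.1 * x.2)) * (2 * (y.1 * y.2))); first by rewrite /dot /crs; ring.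
  by rewrite h1 h2 h3 h4 /dot; ring.
have E2 : 2 * (dot x y * crs x y) = 0.
  transitivity ((2 * (x.1 * x.2)) * (y.1 ^+ 2 - y.2 ^+ 2)
     - (x.1 ^+ 2 - x.2 ^+ 2) * (2 * (y.1 * y.2))); first by rewrite /dot /crs; ring.
  by rewrite h1 h2 h3 h4; ring.
have P : 0 < l * m * c * dot f f by rewrite !mulr_gt0// dot_gt0.
have d0 : dot x y != 0.
  apply/eqP => d0; move: E1; rewrite d0 expr0n /= sub0r => E1.
  by move: P; rewrite -E1 oppr_gt0 ltNge sqr_ge0.
split=> //; apply/eqP; move/eqP: E2; rewrite mulf_eq0 mulf_eq0 (negbTE d0) /=.
by rewrite pnatr_eq0.
Qed.

(** Multiplying [y] by the imaginary unit turns the opposite direction into the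
    same one. *)
Lemma half_angle_antiparallel x y f f' : f != 0 ->
  f'.1 = - f.1 -> f'.2 = - f.2 ->
  half_angle x f -> half_angle y f' -> crs x y != 0 /\ dot x y = 0.
Proof.
move=> f0 e1 e2 hx [l [l0 h1 h2]].
have hy : half_angle (- y.2, y.1) f.
  exists l; rewrite /= sqrrN; split=> //.
    by rewrite -opprB h1 e1 mulrN opprK.
  by rewrite mulNr mulrN (mulrC y.2) h2 e2 mulrN opprK.
have [d c] := half_angle_parallel f0 ltr01 (esym (mul1r _)) (esym (mul1r _)) hx hy.
have E1 : dot x (- y.2, y.1) = crs x y by rewrite /dot /crs /=; ring.
have E2 : crs x (- y.2, y.1) = - dot x y by rewrite /dot /crs /=; ring.
by split; [rewrite -E1|apply/eqP; rewrite -oppr_eq0 -E2 c].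
Qed.

(** The sign chase at the end of the proof that there is no closed orbit: a
    half turn of the square root is met twice along the two short sides of the
    triangle, and not at all along the hypotenuse. *)
Lemma half_turn_parity x y z p q :
  0 < dot p q -> crs p q = 0 ->
  0 < dot x p * dot z q -> crs x p = 0 -> crs z q = 0 ->
  0 < crs y x * crs z y -> dot y x = 0 -> dot z y = 0 -> False.
Proof.
move=> h1 h2 h3 h4 h5 h6 h7 h8.
have E1 : dot x z * dot y y = - (crs y x * crs z y).
  transitivity (dot z y * dot y x - crs z y * crs y x).
    by rewrite /dot /crs; ring.
  by rewrite h7 h8; ring.
have E2 : dot x z * (dot p p * dot q q) = dot x p * dot z q * dot p q.
  transitivity (dot x p * dot p q * dot z q - crs x p * crs p q * dot z q
     + dot x p * crs p q * crs z q + crs x p * dot p q * crs z q).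
    by rewrite /dot /crs; ring.
  by rewrite h2 h4 h5; ring.
have dd (u : R * R) : 0 <= dot u u.
  by rewrite /dot -!expr2 addr_ge0 ?sqr_ge0.
have A : dot x z < 0.
  rewrite ltNge; apply/negP => xz.
  have : 0 <= dot x z * dot y y by rewrite mulr_ge0.
  by rewrite E1 oppr_ge0 leNgt h6.
have : dot x z * (dot p p * dot q q) <= 0.
  by rewrite mulr_le0_ge0 ?(ltW A)// mulr_ge0.
by rewrite E2 leNgt mulr_gt0.
Qed.

End PlaneComplex.

Section SquareRoot.
Context {R : realType}.
Implicit Types (f g : R * R -> R).

Lemma cont_pair (T : topologicalType) (k1 k2 : T -> R) :
  continuous k1 -> continuous k2 -> continuous (fun z => (k1 z, k2 z) : R * R).
Proof. by move=> h1 h2 z; exact: (cvg_pair (h1 z) (h2 z)). Qed.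

Lemma cont_fst : continuous (fun z : R * R => z.1).
Proof. by move=> z; apply: cvg_fst. Qed.

Lemma cont_snd : continuous (fun z : R * R => z.2).
Proof. by move=> z; apply: cvg_snd. Qed.

Lemma cont_cst (T : topologicalType) (c : R) : continuous (fun _ : T => c).
Proof. by move=> z; apply: cvg_cst. Qed.

Lemma contD (T : topologicalType) (f g : T -> R) :
  continuous f -> continuous g -> continuous (fun z => f z + g z).
Proof. by move=> hf hg z; apply: cvgD; [apply: hf|apply: hg]. Qed.

Lemma contB (T : topologicalType) (f g : T -> R) :
  continuous f -> continuous g -> continuous (fun z => f z - g z).
Proof. by move=> hf hg z; apply: cvgB; [apply: hf|apply: hg]. Qed.

Lemma contM (T : topologicalType) (f g : T -> R) :
  continuous f -> continuous g -> continuous (fun z => f z * g z).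
Proof. by move=> hf hg z; apply: cvgM; [apply: hf|apply: hg]. Qed.

Lemma cont_comp (T U V : topologicalType) (f : T -> U) (g : U -> V) :
  continuous f -> continuous g -> continuous (fun z => g (f z)).
Proof. by move=> hf hg z; apply: continuous_comp; [apply: hf|apply: hg]. Qed.

Lemma half_angle_exists (w : R * R) : w != 0 -> exists x : R * R, half_angle x w.
Proof.
case: w => a b w0.
have [n n0 n2] : exists2 n : R, 0 <= n & n ^+ 2 = a ^+ 2 + b ^+ 2.
  exists (Num.sqrt (a ^+ 2 + b ^+ 2)); first exact: sqrtr_ge0.
  by rewrite sqr_sqrtr// addr_ge0// sqr_ge0.
have [h|h] := ltP 0 (a + n).
  by exists (a + n, b); apply: (@half_angle_principal _ (a, b)).
have b0 : b = 0.
  apply/eqP; rewrite -sqrf_eq0 eq_le sqr_ge0 andbT.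
  have : 0 <= (a - n) * (a + n) by rewrite mulr_le0//; lra.
  have -> : (a - n) * (a + n) = a ^+ 2 - n ^+ 2 by ring.
  by rewrite n2; lra.
have a0 : a < 0.
  rewrite lt_neqAle; apply/andP; split; last by lra.
  by apply: contra w0 => /eqP ->; rewrite b0.
exists (0, 1), (- a^-1); split=> /=.
- by rewrite oppr_gt0 invr_lt0.
- by rewrite expr0n expr1n sub0r mulNr mulVf// lt_eqF.
- by rewrite b0; ring.
Qed.

(** The root is transported along rays from the lower left corner, in steps so
    short that the field turns by less than a right angle; over such a step the
    principal square root of the quotient is a continuous factor. *)
Lemma continuous_half_angle (f1 f2 : R * R -> R) (a1 b1 a2 b2 : R) :
  continuous f1 -> continuous f2 -> a1 <= b1 -> a2 <= b2 ->
  (forall u v, a1 <= u <= b1 -> a2 <= v <= b2 -> (f1 (u, v), f2 (u, v)) != 0) ->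
  exists g1 g2 : R * R -> R, [/\ continuous g1, continuous g2 &
    forall u v, a1 <= u <= b1 -> a2 <= v <= b2 ->
      half_angle (g1 (u, v), g2 (u, v)) (f1 (u, v), f2 (u, v))].
Proof.
move=> cf1 cf2 ab1 ab2 nz.
pose ray (tau : R) (z : R * R) : R * R :=
  (a1 + tau * (z.1 - a1), a2 + tau * (z.2 - a2)).
pose B : set (R * R) := `[a1, b1] `*` `[a2, b2].
have BP u v : B (u, v) <-> (a1 <= u <= b1) /\ (a2 <= v <= b2).
  by rewrite /B /= !in_itv /=.
have rayB tau z : B z -> 0 <= tau <= 1 -> B (ray tau z).
  case: z => u v /BP[/andP[h1 h2] /andP[h3 h4]] /andP[h5 h6].
  by apply/BP; split; apply/andP; split => /=; nra.
pose fv z : R * R := (f1 z, f2 z).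
have nzB z : B z -> fv z != 0.
  by case: z => u v /BP[h1 h2]; apply: nz.
(* one step length suits all rays, by compactness *)
have [eta eta0 Heta] : exists2 eta : R, 0 < eta & forall z tau sigma,
    B z -> 0 <= tau <= 1 -> 0 <= sigma <= 1 -> `|sigma - tau| < eta ->
    0 < dot (fv (ray sigma z)) (fv (ray tau z)).
  pose K := B `*` `[0, 1]%classic : set ((R * R) * R).
  have cK : compact K.
    apply: compact_setX; last exact: segment_compact.
    by apply: compact_setX; exact: segment_compact.
  pose G (w : ((R * R) * R) * R) := dot (fv (ray w.2 w.1.1)) (fv (ray w.1.2 w.1.1)).
  have cG : continuous G.
    have cr (k : ((R * R) * R) * R -> R) : continuous k ->
        continuous (fun w => ray (k w) w.1.1).
      move=> ck; have c1 : continuous (fun w : ((R * R) * R) * R => w.1.1).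
        apply: (@cont_comp _ _ _ (fun w : ((R * R) * R) * R => w.1) (fun w => w.1)) => w;
          exact: cvg_fst.
      have c11 : continuous (fun w : ((R * R) * R) * R => w.1.1.1).
        exact: (@cont_comp _ _ _ _ _ c1 cont_fst).
      have c12 : continuous (fun w : ((R * R) * R) * R => w.1.1.2).
        exact: (@cont_comp _ _ _ _ _ c1 cont_snd).
      by apply: cont_pair; (apply: contD; first exact: cont_cst); apply: contM => //;
        (apply: contB => //; exact: cont_cst).
    have c2 : continuous (fun w : ((R * R) * R) * R => w.2) by move=> w; exact: cvg_snd.
    have c3 : continuous (fun w : ((R * R) * R) * R => w.1.2).
      apply: (@cont_comp _ _ _ (fun w : ((R * R) * R) * R => w.1) (fun w => w.2)) => w.
        exact: cvg_fst.
      exact: cvg_snd.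
    by rewrite /G /dot; apply: contD; apply: contM; apply: cont_comp (cr _ _) _.
  pose Q (e : R) (x : (R * R) * R) :=
    forall sigma, `|sigma - x.2| < e -> 0 < G (x, sigma).
  have cov x : K x -> \forall x' \near x & e \near (0 : R)^'+, Q e x'.
    case: x => z tau [Bz /= tau01].
    have Gpos : 0 < G ((z, tau), tau).
      by apply: dot_gt0; apply: nzB; apply: rayB => //; move: tau01; rewrite in_itv.
    have : \forall w \near (((z, tau), tau) : ((R * R) * R) * R), 0 < G w.
      exact: (cvgr_gt (G ((z, tau), tau)) (cG _)).
    move=> /nbhs_ballP[r /= r0 Hr].
    exists (ball ((z, tau) : (R * R) * R) (r / 2), [set e : R | e < r / 2]).
      split; first by apply: nbhsx_ballx; rewrite divr_gt0.
      by apply: nbhs_right_lt; rewrite divr_gt0.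
    move=> [[z' tau'] e] [/= [hz ht] he] sigma hs; apply: Hr; split.
      split; first by apply: le_ball hz; rewrite ler_pdivrMr// ler_pMr// ler1n.
      by apply: le_ball ht; rewrite ler_pdivrMr// ler_pMr// ler1n.
    move: ht hs; rewrite /ball /= => ht hs.
    rewrite -(subrKA tau') (le_lt_trans (ler_normD _ _))// (splitr r) ltrD//.
    by rewrite distrC (lt_trans hs he).
  have : compact K := cK; move=> /compact_near_coveringP /(_ _ _ Q _ cov) He.
  have [e [/= e0 eQ]] := filter_ex (filterI (nbhs_right_gt (0 : R)) He).
  exists e => // z tau sigma Bz t01 s01 st.
  by apply: (eQ (z, tau)) => //; split=> //=; rewrite in_itv.
have [n n0 neta] : exists2 n : nat, (0 < n)%N & n%:R^-1 < eta.
  exists (Num.truncn eta^-1).+1 => //.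
  rewrite invf_plt ?posrE// ?truncnS_gt//; apply: truncnS_gt.
pose P k z := ray (k%:R / n%:R) z.
have n0' : 0 < n%:R :> R by rewrite ltr0n.
have k01 k : (k <= n)%N -> 0 <= (k%:R / n%:R : R) <= 1.
  move=> kn; apply/andP; split; first by rewrite divr_ge0 ?ler0n.
  by rewrite ler_pdivrMr// mul1r ler_nat.
pose w k z : R * R := (dot (fv (P k.+1 z)) (fv (P k z)), crs (fv (P k.+1 z)) (fv (P k z))).
pose nw k z := Num.sqrt (dot (w k z) (w k z)).
have [x0 Hx0] : exists x : R * R, half_angle x (fv (a1, a2)).
  by apply: half_angle_exists; apply: nzB; apply/BP; rewrite !lexx ab1 ab2.
pose g := fix g (k : nat) (z : R * R) {struct k} : R * R := if k is k'.+1 then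
  mulc (g k' z) ((w k' z).1 + nw k' z, (w k' z).2) else x0.
have cray tau : continuous (ray tau).
  by apply: cont_pair; (apply: contD; first exact: cont_cst);
    (apply: contM; first exact: cont_cst);
    (apply: contB; last exact: cont_cst); [exact: cont_fst|exact: cont_snd].
have cfP k : continuous (fun z => f1 (P k z)) /\ continuous (fun z => f2 (P k z)).
  by split; apply: cont_comp (cray _) _.
have cw k : continuous (fun z => (w k z).1) /\ continuous (fun z => (w k z).2).
  have [? ?] := cfP k; have [? ?] := cfP k.+1.
  by split; rewrite /w /dot /crs /=; [apply: contD|apply: contB]; apply: contM.
have cg k : continuous (fun z => (g k z).1) /\ continuous (fun z => (g k z).2).
  elim: k => [|k [IH1 IH2]] /=; first by split; exact: cont_cst.
  have [c1 c2] := cw k.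
  have c3 : continuous (fun z => (w k z).1 + nw k z).
    apply: contD => //; apply: cont_comp (@sqrt_continuous R).
    by rewrite /dot; apply: contD; apply: contM.
  by split; [apply: contB|apply: contD]; apply: contM.
have Hg k z : B z -> (k <= n)%N -> half_angle (g k z) (fv (P k z)).
  move=> Bz; elim: k => [_|k IH kn] /=.
    by rewrite /P /ray mul0r !mul0r !addr0.
  have w1 : 0 < (w k z).1.
    apply: Heta => //; [exact: k01 (ltnW kn)|exact: k01|].
    by rewrite -mulrBl -natrB ?leqnSn// subSnn mul1r ger0_norm ?invr_ge0 ?ler0n.
  have nw2 : nw k z ^+ 2 = dot (w k z) (w k z).
    by rewrite sqr_sqrtr// /dot -!expr2 addr_ge0// sqr_ge0.
  have nw0 : 0 <= nw k z by exact: sqrtr_ge0.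
  have fP : 0 < dot (fv (P k z)) (fv (P k z)).
    by apply: dot_gt0; apply: nzB; apply: rayB => //; exact: k01 (ltnW kn).
  have wp : 0 < (w k z).1 + nw k z by rewrite ltr_wpDr.
  have := half_angle_mul (IH (ltnW kn)) (half_angle_principal nw0 nw2 wp).
  by apply: half_angle_scale fP _ _; rewrite /w /mulc /dot /crs /=; ring.
have [c1 c2] := cg n.
exists (fun z => (g n z).1), (fun z => (g n z).2); split=> // u v hu hv.
have := Hg n (u, v) ((BP _ _).2 (conj hu hv)) (leqnn n).
rewrite /P divff ?gt_eqF// /ray /= !mul1r.
by rewrite [a1 + _]addrC subrK [a2 + _]addrC subrK; case: (g n (u, v)).
Qed.

End SquareRoot.

(** * Secants of a closed arc *)

Section ClosedOrbit.
Context {R : realType}.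
Implicit Types (f g : R -> R) (a b c s t u v x y : R).

Definition clamp (a b x : R) := Order.min (Order.max x a) b.

Lemma clamp_id a b x : a <= x <= b -> clamp a b x = x.
Proof.
by move=> /andP[ax xb]; rewrite /clamp (max_l ax) (min_l xb).
Qed.

Lemma clamp_in a b x : a <= b -> a <= clamp a b x <= b.
Proof. by move=> ab; rewrite /clamp le_min ge_min le_max !lexx ab !orbT. Qed.

Lemma cont_min (T : topologicalType) (f g : T -> R) :
  continuous f -> continuous g -> continuous (fun z => Order.min (f z) (g z)).
Proof. by move=> hf hg z; apply: continuous_min; [apply: hf|apply: hg]. Qed.

Lemma cont_max (T : topologicalType) (f g : T -> R) :
  continuous f -> continuous g -> continuous (fun z => Order.max (f z) (g z)).
Proof. by move=> hf hg z; apply: continuous_max; [apply: hf|apply: hg]. Qed.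

Lemma clamp_cont a b : continuous (clamp a b).
Proof.
apply: cont_min; last exact: cont_cst.
by apply: cont_max; [move=> z; exact: cvg_id|exact: cont_cst].
Qed.

Lemma clamp_lip a b x y : a <= b -> `|clamp a b x - clamp a b y| <= `|x - y|.
Proof.
move=> ab; wlog xy : x y / x <= y.
  move=> H; have [|/ltW] := leP x y; first exact: H.
  by move=> h; rewrite distrC (distrC x); apply: H.
rewrite distrC (distrC x) !ger0_norm ?subr_ge0//.
  rewrite /clamp; rewrite /Order.min /Order.max.
  by do !case: ifP => //; lra.
rewrite /clamp; rewrite /Order.min /Order.max.
by do !case: ifP => //; lra.
Qed.

(** Chords become tangents on the diagonal, so that the chords and tangents of a
    continuously differentiable arc form one continuous field on pairs of times. *)
Definition slope f (f' : R -> R) (z : R * R) : R :=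
  if z.1 == z.2 then f' z.1 else (f z.2 - f z.1) / (z.2 - z.1).

Lemma slope_eq f (f' : R -> R) u v : (forall t, der f t (f' t)) ->
  slope f f' (u, v) * (v - u) = f v - f u.
Proof.
move=> hf; rewrite /slope /=; case: eqVneq => [->|uv]; first by rewrite !subrr mulr0.
by rewrite mulfVK// subr_eq0 eq_sym.
Qed.

Lemma slope_mvt f (f' : R -> R) u v : (forall t, der f t (f' t)) ->
  exists2 c, Order.min u v <= c <= Order.max u v & slope f f' (u, v) = f' c.
Proof.
move=> hf; rewrite /slope /=; case: eqVneq => [->|uv].
  by exists v => //; rewrite minxx maxxx lexx.
wlog ltuv : u v uv / u < v.
  move=> H; have := uv; rewrite neq_lt => /orP[|vu]; first exact: H.
  have [|c h1 h2] := H v u _ vu; first by rewrite eq_sym.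
  exists c; first by rewrite minC maxC.
  by rewrite -h2 -[f v - _]opprB -[v - u]opprB invrN mulrNN.
have [c c1 c2] := mvt_point (ltW ltuv) (fun t _ => hf t).
exists c; first by rewrite min_l ?max_r ?(ltW ltuv).
by rewrite c2 mulfK// subr_eq0 eq_sym.
Qed.

Lemma slope_cont f (f' : R -> R) : (forall t, der f t (f' t)) -> continuous f' ->
  continuous (slope f f').
Proof.
move=> hf cf' [u v]; have cf := cont_der hf.
have [<-|uv] := eqVneq u v.
  rewrite /continuous_at; have -> : slope f f' (u, u) = f' u by rewrite /slope eqxx.
  apply/cvgrPdist_lt => e e0.
  have /cvgrPdist_lt/(_ e e0)/nbhs_ballP[d /= d0 Hd] := cf' u.
  suff : \forall z \near ((u, u) : R * R), `|f' u - slope f f' z| < e by [].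
  apply/nbhs_ballP; exists d => //= -[x y] [/= hx hy].
  have [c /andP[c1 c2] ->] := slope_mvt x y hf; apply: Hd.
  move: hx hy; rewrite /ball /= !ltr_distl => /andP[x1 x2] /andP[y1 y2].
  move: c1 c2; rewrite ge_min le_max => /orP[] c1 /orP[] c2; apply/andP; split; lra.
have c1 : {for (u, v), continuous (fun z : R * R => (f z.2 - f z.1) / (z.2 - z.1))}.
  apply: cvgM.
    by apply: contB; apply: cont_comp cf; [exact: cont_snd|exact: cont_fst].
  apply: cvgV; first by rewrite subr_eq0 eq_sym.
  by apply: contB; [exact: cont_snd|exact: cont_fst].
apply: cvg_trans; last first.
  have -> : slope f f' (u, v) = (f v - f u) / (v - u) by rewrite /slope (negbTE uv).
  exact: c1.
apply: near_eq_cvg.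
have : \forall z \near ((u, v) : R * R), 0 < `|z.1 - z.2|.
  have c2 : continuous (fun z : R * R => z.1 - z.2) by apply: contB; [exact: cont_fst|exact: cont_snd].
  apply: (cvgr_gt _ (cvg_norm (c2 (u, v)))); last by rewrite normr_gt0 subr_eq0.
by apply: filterS => z; rewrite normr_gt0 subr_eq0 /slope => /negbTE ->.
Qed.

(** The secants of an arc that returns to its starting point, rescaled so as to
    extend continuously to the closed triangle of parameters: to the velocity on
    the hypotenuse and to the opposite of the initial velocity at the corner.  The
    rescaled secant depends only on the points modulo the period, up to sign. *)
Definition secant f (f' : R -> R) (s t : R) (z : R * R) : R :=
  if z.2 - z.1 < t - s then slope f f' z / (t - s - (z.2 - z.1))
  else - f' s / (t - s).

(** A retraction of the plane onto the triangle [s <= u <= v <= t] of pairs of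
    times; a field on the triangle composed with it is continuous on the plane. *)
Definition to_triangle (s t : R) (z : R * R) : R * R :=
  (Order.min (Order.max z.1 s) (clamp s t z.2), clamp s t z.2).

Lemma to_triangle_in s t z : s <= t ->
  [/\ s <= (to_triangle s t z).1, (to_triangle s t z).1 <= (to_triangle s t z).2
    & (to_triangle s t z).2 <= t].
Proof.
move=> st; have /andP[h1 h2] := clamp_in z.2 st.
by split=> //=; [rewrite le_min le_max lexx orbT|rewrite ge_min lexx orbT].
Qed.

Lemma to_triangle_id s t u v : s <= u -> u <= v -> v <= t ->
  to_triangle s t (u, v) = (u, v).
Proof.
move=> su uv vt; rewrite /to_triangle /= clamp_id ?(le_trans su uv)//.
by rewrite (max_l su) (min_l uv).
Qed.

Lemma to_triangle_cont s t : continuous (to_triangle s t).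
Proof.
have c : continuous (fun z : R * R => clamp s t z.2).
  by apply: cont_comp (@clamp_cont s t); exact: cont_snd.
apply: cont_pair => //; apply: cont_min => //.
by apply: cont_max; [exact: cont_fst|exact: cont_cst].
Qed.

(** At the corner [(s, t)], the chord from time [u] to time [v] of a closed arc is
    opposite to the sum of the chords from [s] to [u] and from [v] to [t], which are
    both close to multiples of the initial velocity; hence the rescaled chord is a
    weighted mean of two slopes near that velocity, with the sign reversed. *)
Lemma secant_cont f (f' : R -> R) (s t : R) : s < t ->
  (forall u, der f u (f' u)) -> continuous f' -> f s = f t -> f' s = f' t ->
  continuous (fun z => secant f f' s t (to_triangle s t z)).
Proof.
move=> st hf cf' fst f'st z0.
have csl := slope_cont hf cf'.
have ctr := @to_triangle_cont s t.
have ctr1 : continuous (fun z => (to_triangle s t z).1) by apply: cont_comp ctr cont_fst.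
have ctr2 : continuous (fun z => (to_triangle s t z).2) by apply: cont_comp ctr cont_snd.
have cgap : continuous (fun z => (to_triangle s t z).2 - (to_triangle s t z).1).
  exact: contB.
have [h|h] := ltP ((to_triangle s t z0).2 - (to_triangle s t z0).1) (t - s).
  have c1 : {for z0, continuous (fun z => slope f f' (to_triangle s t z) /
      (t - s - ((to_triangle s t z).2 - (to_triangle s t z).1)))}.
    apply: cvgM; first exact: (cont_comp ctr csl).
    apply: cvgV; first by rewrite subr_eq0 gt_eqF.
    by apply: (contB _ cgap); exact: cont_cst.
  apply: cvg_trans; last first.
    have -> : secant f f' s t (to_triangle s t z0) = slope f f' (to_triangle s t z0) /
      (t - s - ((to_triangle s t z0).2 - (to_triangle s t z0).1)) by rewrite /secant h.
    exact: c1.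
  apply: near_eq_cvg.
  have : \forall z \near z0, (to_triangle s t z).2 - (to_triangle s t z).1 < t - s.
    exact: (cvgr_lt _ (cgap z0) _ h).
  by apply: filterS => z; rewrite /secant => ->.
(* at the corner the chord closes up, and is read from its complement *)
have [i1 i2 i3] := to_triangle_in z0 (ltW st).
have e1 : (to_triangle s t z0).1 = s by lra.
have e2 : (to_triangle s t z0).2 = t by lra.
pose N z := secant f f' s t (to_triangle s t z) *
   ((to_triangle s t z).2 - (to_triangle s t z).1).
have ts0 : t - s != 0 by rewrite subr_eq0 gt_eqF.
have N0 : N z0 = - f' s.
  by rewrite /N /secant e1 e2 ltxx mulfVK.
have cN : {for z0, continuous N}.
  suff : N z @[z --> z0] --> N z0 by [].
  rewrite N0; apply/cvgrPdist_le => e e0.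
  have n1 : \forall z \near z0, `|f' s - slope f f' (s, (to_triangle s t z).1)| <= e.
    have -> : f' s = slope f f' (s, (to_triangle s t z0).1) by rewrite e1 /slope eqxx.
    have cA : continuous (fun z => slope f f' (s, (to_triangle s t z).1)).
      by apply: (cont_comp _ csl); apply: (cont_pair _ ctr1); exact: cont_cst.
    by have /cvgrPdist_le/(_ e e0) := cA z0.
  have n2 : \forall z \near z0, `|f' s - slope f f' ((to_triangle s t z).2, t)| <= e.
    have -> : f' s = slope f f' ((to_triangle s t z0).2, t) by rewrite e2 /slope eqxx.
    have cB : continuous (fun z => slope f f' ((to_triangle s t z).2, t)).
      by apply: (cont_comp _ csl); apply: (cont_pair ctr2); exact: cont_cst.
    by have /cvgrPdist_le/(_ e e0) := cB z0.
  apply: filterS2 n1 n2 => z; have [j1 j2 j3] := to_triangle_in z (ltW st).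
  have := slope_eq s (to_triangle s t z).1 hf; have := slope_eq (to_triangle s t z).2 t hf.
  have := slope_eq (to_triangle s t z).1 (to_triangle s t z).2 hf.
  rewrite /N /secant -surjective_pairing.
  set A := slope f f' (s, _); set B := slope f f' (_, t); set C := slope f f' _.
  move: (to_triangle s t z) j1 j2 j3 @A @B @C => [x y] /= j1 j2 j3.
  set A := slope f f' (s, _); set B := slope f f' (_, t); set C := slope f f' _.
  move=> EC EB EA hA hB.
  have [g|g] := ltP (y - x) (t - s); last first.
    have -> : x = s by lra.
    have -> : y = t by lra.
    by rewrite mulfVK// subrr normr0 ltW.
  have p : 0 < t - s - (y - x) by lra.
  have p0 : t - s - (y - x) != 0 by rewrite gt_eqF.
  have Exy : C * (y - x) = - (B * (t - y)) - A * (x - s) by rewrite EC EB EA fst; ring.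
  have -> : - f' s - C / (t - s - (y - x)) * (y - x) =
     ((t - y) * (B - f' s) + (x - s) * (A - f' s)) / (t - s - (y - x)).
    rewrite [C / _ * _]mulrAC Exy; field; exact: p0.
  rewrite normrM normfV (gtr0_norm p) ler_pdivrMr//.
  rewrite distrC in hA; rewrite distrC in hB.
  apply: (le_trans (ler_normD _ _)); rewrite !normrM.
  have ty : 0 <= t - y by lra.
  have xs : 0 <= x - s by lra.
  rewrite (ger0_norm ty) (ger0_norm xs).
  have := lerD (ler_wpM2l ty hB) (ler_wpM2l xs hA).
  by move=> /le_trans; apply; lra.
have c1 : {for z0, continuous (fun z => N z /
    ((to_triangle s t z).2 - (to_triangle s t z).1))}.
  apply: cvgM; first exact: cN.
  apply: cvgV; first by rewrite e1 e2.
  exact: cgap.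
apply: cvg_trans; last first.
  have -> : secant f f' s t (to_triangle s t z0) =
      N z0 / ((to_triangle s t z0).2 - (to_triangle s t z0).1).
    by rewrite /N mulfK// e1 e2.
  exact: c1.
apply: near_eq_cvg.
have : \forall z \near z0, 0 < (to_triangle s t z).2 - (to_triangle s t z).1.
  by apply: (cvgr_gt _ (cgap z0)); rewrite e1 e2 subr_gt0.
by apply: filterS => z zp; rewrite /N mulfK// gt_eqF.
Qed.

End ClosedOrbit.

(** * A field without zeros has no closed orbit in a star-shaped set *)

Section NoClosedOrbit.
Context {R : realType}.

Lemma within_comp (T U : topologicalType) (D : set U) (F : U -> R) (k : T -> U) :
  {within D, continuous F} -> continuous k -> (forall x, D (k x)) ->
  continuous (fun x => F (k x)).
Proof.
move=> /subspace_continuousP cF ck Dk x P nP.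
have H : \forall y \near x, D (k y) -> P (F (k y)).
  exact: (ck x _ (cF (k x) (Dk x) P nP)).
by apply: filterS H => y /= /(_ (Dk y)).
Qed.

(** Contracting the orbit to the centre of the star makes the direction of the
    field along it constant, so a continuous square root comes back to itself after
    one turn; but this root changes its sign, as the secants through the base point
    sweep two half turns. *)
Lemma no_simple_closed_orbit (D : set (R * R)) (F1 F2 : R * R -> R)
    (g1 g2 : R -> R) (s t : R) :
  (forall z (a : R), D z -> 0 <= a <= 1 -> D (a * z.1, a * z.2)) ->
  {within D, continuous F1} -> {within D, continuous F2} ->
  (forall z, D z -> (F1 z, F2 z) != 0) ->
  (forall u, D (g1 u, g2 u)) ->
  (forall u : R, der g1 u (F1 (g1 u, g2 u))) ->
  (forall u : R, der g2 u (F2 (g1 u, g2 u))) ->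
  s < t -> (g1 s, g2 s) = (g1 t, g2 t) ->
  (forall u v, s <= u -> u < v -> v <= t -> v - u < t - s ->
     (g1 u, g2 u) != (g1 v, g2 v)) ->
  False.
Proof.
move=> star cF1 cF2 nzF Dg dg1 dg2 st closed simple.
pose g u := (g1 u, g2 u).
have cg1 := cont_der dg1; have cg2 := cont_der dg2.
have cg : continuous g by exact: cont_pair.
have cFg1 : continuous (fun u => F1 (g u)) by exact: within_comp cF1 cg Dg.
have cFg2 : continuous (fun u => F2 (g u)) by exact: within_comp cF2 cg Dg.
have [e1 e2] : g1 s = g1 t /\ g2 s = g2 t by case: closed.
have egs : g s = g t := closed.
pose hom (w : R * R) : R * R :=
  (clamp 0 1 w.1 * g1 w.2, clamp 0 1 w.1 * g2 w.2).
have chom : continuous hom.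
  have c1 : continuous (fun w : R * R => clamp 0 1 w.1).
    by apply: cont_comp (@clamp_cont R 0 1); exact: cont_fst.
  have c2 : continuous (fun w : R * R => g1 w.2) by apply: (cont_comp _ cg1); exact: cont_snd.
  have c3 : continuous (fun w : R * R => g2 w.2) by apply: (cont_comp _ cg2); exact: cont_snd.
  by apply: cont_pair; exact: contM.
have Dhom w : D (hom w).
  apply: (star (g w.2)); first exact: Dg.
  by apply: clamp_in; exact: ler01.
have hom1 u : hom (1, u) = g u.
  by rewrite /hom /= clamp_id ?lexx ?ler01// !mul1r.
have [G1 [G2 [cG1 cG2 HG]]] := @continuous_half_angle R
   (fun w => F1 (hom w)) (fun w => F2 (hom w)) 0 1 s t
   (within_comp cF1 chom Dhom) (within_comp cF2 chom Dhom) ler01 (ltW st)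
   (fun u v _ _ => nzF _ (Dhom (u, v))).
pose sec1 z := secant g1 (fun u => F1 (g u)) s t (to_triangle s t z).
pose sec2 z := secant g2 (fun u => F2 (g u)) s t (to_triangle s t z).
have ts : 0 < t - s by rewrite subr_gt0.
have secE u v : s <= u -> u < v -> v <= t -> v - u < t - s ->
    sec1 (u, v) = (g1 v - g1 u) / ((v - u) * (t - s - (v - u))) /\
    sec2 (u, v) = (g2 v - g2 u) / ((v - u) * (t - s - (v - u))).
  move=> h1 h2 h3 h4; rewrite /sec1 /sec2 /secant to_triangle_id ?(ltW h2)//=.
  by rewrite h4 /slope /= (lt_eqF h2) !invfM !mulrA.
have secD u : s <= u <= t ->
    sec1 (u, u) = F1 (g u) / (t - s) /\ sec2 (u, u) = F2 (g u) / (t - s).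
  move=> /andP[h1 h2]; rewrite /sec1 /sec2 /secant to_triangle_id//= subrr ts.
  by rewrite /slope eqxx subr0.
have secC : sec1 (s, t) = - F1 (g s) / (t - s) /\ sec2 (s, t) = - F2 (g s) / (t - s).
  by rewrite /sec1 /sec2 /secant to_triangle_id ?lexx ?(ltW st)//= ltxx.
have nzsec u v : s <= u <= t -> s <= v <= t -> (sec1 (u, v), sec2 (u, v)) != 0.
  move=> _ _; have [j1 j2 j3] := to_triangle_in (u, v) (ltW st).
  have -> : sec1 (u, v) = sec1 (to_triangle s t (u, v)).
    by rewrite /sec1; case: (to_triangle s t (u, v)) j1 j2 j3 => x y /= *; rewrite to_triangle_id.
  have -> : sec2 (u, v) = sec2 (to_triangle s t (u, v)).
    by rewrite /sec2; case: (to_triangle s t (u, v)) j1 j2 j3 => x y /= *; rewrite to_triangle_id.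
  case: (to_triangle s t (u, v)) j1 j2 j3 => x y /= su uv vt.
  have := nzF _ (Dg x); rewrite /= !xpair_eqE.
  have [->|xy] := eqVneq x y.
    have [|-> ->] := secD y; first by rewrite (le_trans su uv) vt.
    by rewrite !mulf_eq0 !invr_eq0 (gt_eqF ts) !orbF.
  have ltxy : x < y by rewrite lt_neqAle xy.
  have [h|h] := ltP (y - x) (t - s); last first.
    have -> : x = s by lra.
    have -> : y = t by lra.
    by case: secC => -> ->; rewrite !mulf_eq0 !invr_eq0 (gt_eqF ts) !orbF !oppr_eq0.
  move=> _; have [-> ->] := secE x y su ltxy vt h.
  rewrite !mulf_eq0 !invr_eq0 !mulf_eq0 !subr_eq0 (gt_eqF ltxy) (gt_eqF h) !orbF.
  have := simple x y su ltxy vt h; rewrite xpair_eqE.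
  by rewrite (eq_sym (g1 x)) (eq_sym (g2 x)).
have csec1 : continuous sec1.
  by apply: secant_cont => //; rewrite -?egs.
have csec2 : continuous sec2.
  by apply: secant_cont => //; rewrite -?egs.
have [A1 [A2 [cA1 cA2 HA]]] := continuous_half_angle csec1 csec2 (ltW st) (ltW st) nzsec.
pose G a u := (G1 (a, u), G2 (a, u)).
pose A u v := (A1 (u, v), A2 (u, v)).
have cp (k : R * R -> R) (x y : R -> R) : continuous k -> continuous x ->
    continuous y -> continuous (fun u => k (x u, y u)).
  by move=> ck cx cy; apply: (cont_comp _ ck); exact: cont_pair.
have cid : continuous (fun u : R => u) by move=> u; exact: cvg_id.
have ccst (c : R) : continuous (fun _ : R => c) by exact: cont_cst.
have nF w : (F1 (hom w), F2 (hom w)) != 0 by apply: nzF; exact: Dhom.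
have in_s : s <= s <= t by rewrite lexx ltW.
have in_t : s <= t <= t by rewrite lexx ltW.
have in_1 : 0 <= (1 : R) <= 1 by rewrite lexx ler01.
have in_0 : 0 <= (0 : R) <= 1 by rewrite lexx ler01.
have par a u v : 0 <= a <= 1 -> s <= u <= t -> s <= v <= t ->
    hom (a, v) = hom (a, u) -> dot (G a u) (G a v) != 0 /\ crs (G a u) (G a v) = 0.
  move=> ha hu hv E; have := HG a v ha hv; rewrite E => H.
  by apply: (half_angle_parallel (nF (a, u)) ltr01 _ _ (HG a u ha hu) H); rewrite mul1r.
have dpos a u : 0 <= a <= 1 -> s <= u <= t -> 0 < dot (G a u) (G a u).
  move=> ha hu; have [d _] := par a u u ha hu hu erefl.
  by rewrite lt_def d /dot -!expr2 addr_ge0 ?sqr_ge0.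
(* the contracted field gives the two ends of the orbit the same root *)
have step1 : 0 < dot (G 0 s) (G 0 t).
  have H : 0 < dot (G 0 s) (G 0 s) * dot (G 0 s) (G 0 t).
    apply: (@same_sign R (fun u => dot (G 0 s) (G 0 u))); first exact: ltW.
      by rewrite /dot /=; apply: contD; (apply: contM; first exact: ccst);
        apply: cp => //; exact: ccst.
    move=> u hu; apply: (par 0 s u in_0 in_s hu _).1.
    by rewrite /hom /= clamp_id// !mul0r.
  by move: H; rewrite pmulr_rgt0// dpos.
have hst a : hom (a, t) = hom (a, s) by rewrite /hom /= e1 e2.
have step2 : 0 < dot (G 1 s) (G 1 t).
  have H : 0 < dot (G 0 s) (G 0 t) * dot (G 1 s) (G 1 t).
    apply: (@same_sign R (fun a => dot (G a s) (G a t))); first exact: ler01.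
      by rewrite /dot /=; apply: contD; apply: contM; apply: cp.
    by move=> a ha; apply: (par a s t ha in_s in_t _).1.
  by move: H; rewrite pmulr_rgt0.
have diag u : s <= u <= t -> dot (A u u) (G 1 u) != 0 /\ crs (A u u) (G 1 u) = 0.
  move=> hu; have := HG 1 u in_1 hu; rewrite hom1 => H.
  have [E1 E2] := secD u hu.
  apply: (half_angle_parallel (nzsec u u hu hu) ts _ _ (HA u u hu hu) H) => /=.
    by rewrite E1 mulrC mulfVK// gt_eqF.
  by rewrite E2 mulrC mulfVK// gt_eqF.
have step3 : 0 < dot (A s s) (G 1 s) * dot (A t t) (G 1 t).
  apply: (@same_sign R (fun u => dot (A u u) (G 1 u))); first exact: ltW.
    by rewrite /dot /=; apply: contD; apply: contM; apply: cp.
  by move=> u hu; apply: (diag u hu).1.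
have anti u : s <= u <= t -> crs (A u t) (A s u) != 0 /\ dot (A u t) (A s u) = 0.
  move=> hu.
  suff [E1 E2] : sec1 (s, u) = - sec1 (u, t) /\ sec2 (s, u) = - sec2 (u, t).
    exact: (@half_angle_antiparallel R _ _ _ (sec1 (s, u), sec2 (s, u))
      (nzsec u t hu in_t) E1 E2 (HA u t hu in_t) (HA s u in_s hu)).
  move: hu => /andP[su ut].
  have [->|us] := eqVneq u s.
    by case: secC => -> ->; case: (secD s in_s) => -> ->; rewrite !mulNr !opprK.
  have [->|ut'] := eqVneq u t.
    by case: secC => -> ->; case: (secD t in_t) => -> ->; rewrite !mulNr egs.
  have lsu : s < u by rewrite lt_neqAle eq_sym us.
  have lut : u < t by rewrite lt_neqAle ut'.
  have [|-> ->] := secE s u (lexx s) lsu ut; first by lra.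
  have [|-> ->] := secE u t su lut (lexx t); first by lra.
  have -> : (t - u) * (t - s - (t - u)) = (u - s) * (t - s - (u - s)) by ring.
  by rewrite e1 e2 -!mulNr !opprB.
have step4 : 0 < crs (A s t) (A s s) * crs (A t t) (A s t).
  apply: (@same_sign R (fun u => crs (A u t) (A s u))); first exact: ltW.
    by rewrite /crs /=; apply: contB; apply: contM; apply: cp.
  by move=> u hu; apply: (anti u hu).1.
exact: (half_turn_parity step2 (par 1 s t in_1 in_s in_t (hst 1)).2 step3
  (diag s in_s).2 (diag t in_t).2 step4 (anti s in_s).2 (anti t in_t).2).
Qed.

End NoClosedOrbit.

(** * Bounded orbits of Hamiltonian fields *)

Lemma near_l1 (R : realType) (z : R * R) (d : R) : 0 < d ->
  \forall z' \near z, `|z'.1 - z.1| + `|z'.2 - z.2| <= d.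
Proof.
move=> d0; apply/nbhs_ballP; exists (d / 2); first by rewrite /= divr_gt0.
move=> z' [h1 h2]; move: h1 h2; rewrite /ball /= distrC [`|z.2 - _|]distrC; lra.
Qed.

Section HamiltonianOrbit.
Context {R : realType}.
Variables (D : set (R * R)) (h F1 F2 : R * R -> R).

(** The field [(F1, F2)] is the Hamiltonian field of [h], with a first order
    expansion of [h] that is uniform over [D]; the uniformity makes the field
    continuous on [D]. *)
Definition hamiltonian_on : Prop := forall e : R, 0 < e ->
  exists2 d : R, 0 < d & forall z, D z -> forall v1 v2, `|v1| + `|v2| <= d ->
    `|h (z.1 + v1, z.2 + v2) - h z - (F2 z * v1 - F1 z * v2)| <= e * (`|v1| + `|v2|).

Hypothesis hF : hamiltonian_on.

(** The expansions of [h] at [z] and at [z'] have to agree at the points near both,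
    which are at a distance comparable to that of [z] and [z']. *)
Lemma hamiltonian_unif (e : R) : 0 < e -> exists2 d : R, 0 < d &
  forall z z', D z -> D z' -> `|z'.1 - z.1| + `|z'.2 - z.2| <= d ->
    `|F1 z' - F1 z| <= e /\ `|F2 z' - F2 z| <= e.
Proof.
move=> e0; have e4 : 0 < e / 4 by rewrite divr_gt0.
have [d d0 Hd] := hF e4; exists (d / 2); first by rewrite divr_gt0.
move=> z z' Dz Dz' hzz.
have [v1 [v2 [E hv]]] : exists v1 v2, z' = (z.1 + v1, z.2 + v2) /\ `|v1| + `|v2| <= d / 2.
  exists (z'.1 - z.1), (z'.2 - z.2); split => //.
  by rewrite ![_ + (_ - _)]addrC !subrK -surjective_pairing.
have [r rE] : exists r, r = `|v1| + `|v2| by exists (`|v1| + `|v2|).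
have r0 : 0 <= r by rewrite rE addr_ge0.
have [rz|rn] := eqVneq r 0.
  move: rz; rewrite rE => /eqP; rewrite paddr_eq0// !normr_eq0 => /andP[/eqP v10 /eqP v20].
  by rewrite E v10 v20 !addr0 -surjective_pairing !subrr normr0 ltW.
have rp : 0 < r by rewrite lt_def rn.
have Hz : `|h z' - h z - (F2 z * v1 - F1 z * v2)| <= e / 4 * r.
  by rewrite {1}E rE; apply: Hd => //; lra.
have key w1 w2 : `|w1| + `|w2| <= r ->
   `|(F2 z' - F2 z) * w1 - (F1 z' - F1 z) * w2| <= e * r.
  move=> hw; have Ha := Hd z' Dz' w1 w2; have Hb := Hd z Dz (v1 + w1) (v2 + w2).
  have n1 := ler_normD v1 w1; have n2 := ler_normD v2 w2.
  have Ha1 : `|h (z'.1 + w1, z'.2 + w2) - h z' - (F2 z' * w1 - F1 z' * w2)| <= e / 4 * r.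
    apply: (le_trans (Ha _)); first by lra.
    by rewrite ler_wpM2l// ltW.
  have Hb1 : `|h (z.1 + (v1 + w1), z.2 + (v2 + w2)) - h z -
      (F2 z * (v1 + w1) - F1 z * (v2 + w2))| <= e / 4 * (2 * r).
    apply: (le_trans (Hb _)); first by lra.
    by rewrite ler_wpM2l ?(ltW e4)//; lra.
  have EE : (z'.1 + w1, z'.2 + w2) = (z.1 + (v1 + w1), z.2 + (v2 + w2)) by rewrite E /= !addrA.
  move: Ha1 Hb1 Hz; rewrite EE !ler_norml !mulrDr.
  set X := h (_ , _); have [k kE] : exists k, k = e / 4 * r by exists (e / 4 * r).
  rewrite [e / 4 * (2 * r)]mulrCA -kE.
  have -> : e * r = 4 * k by rewrite kE; field.
  by move=> /andP[i1 i2] /andP[i3 i4] /andP[i5 i6]; apply/andP; split; lra.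
split.
  have := key 0 r; rewrite normr0 add0r (ger0_norm r0) => /(_ (lexx r)).
  by rewrite mulr0 sub0r normrN normrM (ger0_norm r0) ler_pM2r.
have := key r 0; rewrite normr0 addr0 (ger0_norm r0) => /(_ (lexx r)).
by rewrite mulr0 subr0 normrM (ger0_norm r0) ler_pM2r.
Qed.

Lemma hamiltonian_within : {within D, continuous F1} /\ {within D, continuous F2}.
Proof.
split; apply/subspace_continuousP => z Dz; apply/cvgrPdist_le => e e0;
  have [d d0 Hd] := hamiltonian_unif e0;
  apply: filterS (near_l1 z d0) => z' Hz' Dz'; rewrite distrC;
  by case: (Hd z z' Dz Dz' Hz').
Qed.

Hypothesis cD : compact D.
Hypothesis starD : forall z (a : R), D z -> 0 <= a <= 1 -> D (a * z.1, a * z.2).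
Hypothesis nzF : forall z, D z -> (F1 z, F2 z) != 0.

Let Fv z : R * R := (F1 z, F2 z).

Lemma hamiltonian_bound : exists2 C : R, 0 < C &
  forall z, D z -> `|F1 z| + `|F2 z| <= C.
Proof.
have [D0|D0] := pselect (D !=set0); last first.
  by exists 1 => // z Dz; case: D0; exists z.
have [c1 c2] := hamiltonian_within.
have [|z _ Hz] := compact_EVT_max (f := fun z => `|F1 z| + `|F2 z|) D0 cD.
  by move=> z; apply: cvgD; apply: cvg_norm; [apply: c1|apply: c2].
exists (`|F1 z| + `|F2 z| + 1); first by rewrite ltr_wpDl// addr_ge0.
by move=> w Dw; rewrite ler_wpDr// Hz// inE.
Qed.

Lemma hamiltonian_lower : exists2 m : R, 0 < m &
  forall z, D z -> m <= dot (Fv z) (Fv z).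
Proof.
have [D0|D0] := pselect (D !=set0); last first.
  by exists 1 => // z Dz; case: D0; exists z.
have [c1 c2] := hamiltonian_within.
have [|z Dz Hz] := compact_EVT_min (f := fun z => dot (Fv z) (Fv z)) D0 cD.
  by move=> z; apply: cvgD; apply: cvgM; (apply: c1 || apply: c2).
exists (dot (Fv z) (Fv z)); first by apply: dot_gt0; apply: nzF; rewrite inE in Dz.
by move=> w Dw; apply: Hz; rewrite inE.
Qed.


Variables (g1 g2 : R -> R).
Let g u : R * R := (g1 u, g2 u).
Hypothesis Dg : forall u : R, D (g u).
Hypothesis dg1 : forall u : R, der g1 u (F1 (g u)).
Hypothesis dg2 : forall u : R, der g2 u (F2 (g u)).

Lemma hamiltonian_conserved s t : h (g s) = h (g t).
Proof.
apply: (@der0_const R (fun u => h (g u))) => u; apply/der_epsP => e e0.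
have [C C0 HC] := hamiltonian_bound.
pose e1 : R := Num.min 1 (e / (2 * C)); pose e2 : R := e / (2 * (C + 2)).
have e10 : 0 < e1 by rewrite lt_min ltr01 divr_gt0// mulr_gt0.
have e20 : 0 < e2 by rewrite divr_gt0// mulr_gt0// addr_gt0.
have e11 : e1 <= 1 by rewrite ge_min lexx.
have e1C : C * e1 <= e / 2.
  have : e1 <= e / (2 * C) by rewrite ge_min lexx orbT.
  rewrite ler_pdivlMr ?mulr_gt0//; lra.
have e2C : e2 * (C + 2) = e / 2.
  by rewrite /e2; field; rewrite gt_eqF// addr_gt0.
clearbody e1 e2.
have [d1 d10 H1] := (der_epsP g1 u (F1 (g u))).1 (dg1 u) e1 e10.
have [d2 d20 H2] := (der_epsP g2 u (F2 (g u))).1 (dg2 u) e1 e10.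
have [d d0 Hd] := hF e20.
pose d3 := d / (C + 2).
have d30 : 0 < d3 by rewrite divr_gt0// addr_gt0.
have d3E : d3 * (C + 2) = d by rewrite mulfVK// gt_eqF// addr_gt0.
clearbody d3.
exists (Num.min d1 (Num.min d2 d3)); first by rewrite !lt_min d10 d20.
move=> s1; rewrite !le_min => /and3P[k1 k2 k3].
have {H1} := H1 s1 k1; have {H2} := H2 s1 k2.
rewrite mul0r subr0.
set w1 := g1 (u + s1) - g1 u; set w2 := g2 (u + s1) - g2 u.
set f1 := F1 (g u); set f2 := F2 (g u) => H2 H1.
have E : g (u + s1) = ((g u).1 + w1, (g u).2 + w2).
  by rewrite /g /= /w1 /w2 ![_ + (_ - _)]addrC !subrK.
have HCu : `|f1| + `|f2| <= C := HC _ (Dg u).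
have a0 := normr_ge0 s1; have f10 := normr_ge0 f1; have f20 := normr_ge0 f2.
have b1 : `|w1| <= (`|f1| + e1) * `|s1|.
  have := ler_normD (w1 - f1 * s1) (f1 * s1); rewrite subrK normrM mulrDl; lra.
have b2 : `|w2| <= (`|f2| + e1) * `|s1|.
  have := ler_normD (w2 - f2 * s1) (f2 * s1); rewrite subrK normrM mulrDl; lra.
have b3 : `|w1| + `|w2| <= (C + 2) * `|s1|.
  have b4 : (`|f1| + e1) * `|s1| + (`|f2| + e1) * `|s1| <= (C + 2) * `|s1|.
    by rewrite -mulrDl ler_wpM2r//; lra.
  lra.
have b5 : (C + 2) * `|s1| <= d by rewrite -d3E [d3 * _]mulrC ler_wpM2l// addr_ge0// ltW.
have := Hd _ (Dg u) w1 w2 (le_trans b3 b5); rewrite -E -/f1 -/f2.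
have c1 : `|f2 * w1 - f1 * w2| <= C * e1 * `|s1|.
  have -> : f2 * w1 - f1 * w2 = f2 * (w1 - f1 * s1) - f1 * (w2 - f2 * s1) by ring.
  rewrite (le_trans (ler_normB _ _))// !normrM.
  have d4 := ler_wpM2l f20 H1; have d5 := ler_wpM2l f10 H2.
  have d6 : (`|f1| + `|f2|) * (e1 * `|s1|) <= C * (e1 * `|s1|).
    by rewrite ler_wpM2r// mulr_ge0// ltW.
  by clear H1 H2 b1 b2 b3 b5; move: d6; rewrite mulrDl -mulrA; lra.
have c2 : C * e1 * `|s1| <= e / 2 * `|s1| by rewrite ler_wpM2r.
have c3 : e2 * (`|w1| + `|w2|) <= e / 2 * `|s1|.
  by rewrite -e2C -mulrA ler_wpM2l// ltW.
move=> c4; have := ler_normD (h (g (u + s1)) - h (g u) - (f2 * w1 - f1 * w2)) (f2 * w1 - f1 * w2).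
by clear H1 H2 b1 b2 b3 b5; rewrite subrK; lra.
Qed.

Lemma orbit_speed C s t : (forall z, D z -> `|F1 z| + `|F2 z| <= C) ->
  `|g1 t - g1 s| + `|g2 t - g2 s| <= C * `|t - s| *+ 2.
Proof.
move=> HC; wlog st : s t / s <= t.
  move=> H; have [|/ltW ts] := leP s t; first exact: H.
  by rewrite distrC [`|g2 _ - _|]distrC [`|t - s|]distrC; apply: H.
rewrite (ger0_norm (_ : 0 <= t - s)) ?subr_ge0// mulr2n lerD//.
  apply: (mvt_bound st (fun u _ => dg1 u)) => u _.
  by apply: le_trans (HC _ (Dg u)); rewrite lerDl.
apply: (mvt_bound st (fun u _ => dg2 u)) => u _.
by apply: le_trans (HC _ (Dg u)); rewrite lerDr.
Qed.

(** Near a point of its limit set the orbit is a level line of [h], hence passes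
    through that very point, infinitely often. *)
Lemma orbit_returns : exists t1 t2, t1 < t2 /\ g t1 = g t2.
Proof.
have [C C0 HC] := hamiltonian_bound.
have [q [Dq clq]] : D `&` cluster (g n%:R @[n --> \oo]) !=set0.
  by apply: cD; exists 0%N => // n _; exact: Dg.
have near_q (d : R) (N : nat) : 0 < d -> exists2 n : nat, (N <= n)%N &
    `|g1 n%:R - q.1| + `|g2 n%:R - q.2| <= d.
  move=> d0.
  have [|z [[n Nn <-]] zq] := clq [set g n%:R | n in [set n | (N <= n)%N]] _ _ (near_l1 q d0).
    by exists N => // n Nn; exists n.
  by exists n.
set f := Fv q; set m := dot f f.
have m0 : 0 < m by apply: dot_gt0; exact: nzF.
pose c0 : R := `|f.1| + `|f.2| + 1.
have c00 : 0 < c0 by rewrite ltr_wpDl// addr_ge0.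
have hq t : h (g t) = h q.
  have H (e : R) : 0 < e -> `|h (g t) - h q| <= e.
    move=> e0; have [d d0 Hd] := hF ltr01.
    have dd : 0 < Num.min d (e / (c0 + 1)) by rewrite lt_min d0 divr_gt0// addr_gt0.
    have [n _] := near_q _ 0%N dd; rewrite le_min => /andP[n1 n2].
    have := Hd q Dq _ _ n1; rewrite ![_ + (_ - _)]addrC !subrK.
    rewrite -[(_, _)]/(g n%:R) (hamiltonian_conserved n%:R t) mul1r.
    set w1 := g1 _ - _; set w2 := g2 _ - _.
    have k0 : F2 q * w1 - F1 q * w2 = f.2 * w1 - f.1 * w2 by [].
    have k1 : `|f.2 * w1 - f.1 * w2| <= (c0 - 1) * (`|w1| + `|w2|).
      rewrite (le_trans (ler_normB _ _))// !normrM /c0 addrK.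
      have := mulr_ge0 (normr_ge0 f.1) (normr_ge0 w1).
      have := mulr_ge0 (normr_ge0 f.2) (normr_ge0 w2).
      by rewrite mulrDl !mulrDr; lra.
    have k2 : (c0 + 1) * (`|w1| + `|w2|) <= e.
      by rewrite mulrC -ler_pdivlMr// addr_gt0.
    move=> k3; have := ler_normD (h (g t) - h q - (f.2 * w1 - f.1 * w2)) (f.2 * w1 - f.1 * w2).
    have k4 : 0 <= `|w1| + `|w2| by rewrite addr_ge0.
    have k5 : (c0 - 1) * (`|w1| + `|w2|) + (`|w1| + `|w2|) <= (c0 + 1) * (`|w1| + `|w2|).
      by rewrite -[X in _ + X <= _]mul1r -mulrDl ler_wpM2r//; lra.
    rewrite subrK; move: k3; rewrite k0; lra.
  apply/eqP; rewrite -subr_eq0 -normr_le0; apply/ler_addgt0Pr => e e0.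
  by rewrite add0r; exact: H.
(* a radius within which the component along [f] increases along the orbit and,
   on the level line of [h] through [q], takes the value of [q] at [q] only *)
have [rho rho0 [Hmono Huniq]] : exists2 rho : R, 0 < rho &
    (forall z, D z -> `|z.1 - q.1| + `|z.2 - q.2| <= rho -> m / 2 <= dot f (Fv z)) /\
    (forall z, D z -> `|z.1 - q.1| + `|z.2 - q.2| <= rho -> h z = h q ->
       f.1 * (z.1 - q.1) + f.2 * (z.2 - q.2) = 0 -> z = q).
  have e10 : 0 < m / (2 * c0) by rewrite divr_gt0// mulr_gt0.
  have [d1 d10 H1] := hamiltonian_unif e10.
  pose e2 : R := Num.min 1 (m / 4).
  have e20 : 0 < e2 by rewrite lt_min ltr01 divr_gt0.
  have e2m : e2 ^+ 2 * 2 < m.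
    have a1 : e2 <= 1 by rewrite ge_min lexx.
    have a2 : e2 <= m / 4 by rewrite ge_min lexx orbT.
    have a3 : e2 ^+ 2 <= e2 by rewrite expr2 ler_piMr// ltW.
    lra.
  have [d2 d20 H2] := hF e20.
  exists (Num.min d1 d2); first by rewrite lt_min d10.
  split=> z Dz; rewrite le_min => /andP[k1 k2].
    have [a1 a2] := H1 q z Dq Dz k1.
    have -> : dot f (Fv z) = m + (f.1 * (F1 z - F1 q) + f.2 * (F2 z - F2 q)).
      by rewrite /m /dot /f /Fv /=; ring.
    have b1 : `|f.1 * (F1 z - F1 q) + f.2 * (F2 z - F2 q)| <= m / 2.
      rewrite (le_trans (ler_normD _ _))// !normrM.
      have b2 := ler_wpM2l (normr_ge0 f.1) a1; have b3 := ler_wpM2l (normr_ge0 f.2) a2.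
      have b4 : (`|f.1| + `|f.2|) * (m / (2 * c0)) <= m / 2.
        have -> : m / (2 * c0) = m / 2 / c0 by rewrite invfM mulrA.
        rewrite mulrCA; apply: ler_piMr; first by rewrite divr_ge0// ltW.
        by rewrite ler_pdivrMr// mul1r /c0; lra.
      by move: b4; rewrite mulrDl; lra.
    by move: b1; rewrite ler_norml => /andP[]; lra.
  move=> hz z0; have := H2 q Dq _ _ k2.
  rewrite ![_ + (_ - _)]addrC !subrK -surjective_pairing hz subrr sub0r normrN.
  move: z0; set w1 := z.1 - q.1; set w2 := z.2 - q.2 => z0 cr.
  have E : (F2 q * w1 - F1 q * w2) ^+ 2 + (f.1 * w1 + f.2 * w2) ^+ 2 =
      m * (w1 ^+ 2 + w2 ^+ 2) by rewrite /m /f /Fv /dot /=; ring.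
  have cr2 : (F2 q * w1 - F1 q * w2) ^+ 2 <= e2 ^+ 2 * (2 * (w1 ^+ 2 + w2 ^+ 2)).
    rewrite -real_normK ?num_real//.
    apply: (@le_trans _ _ ((e2 * (`|w1| + `|w2|)) ^+ 2)).
      by rewrite lerXn2r ?nnegrE ?mulr_ge0 ?addr_ge0 ?(ltW e20).
    rewrite exprMn ler_wpM2l ?sqr_ge0//.
    rewrite -(real_normK (num_real w1)) -(real_normK (num_real w2)).
    have := sqr_ge0 (`|w1| - `|w2|); rewrite sqrrB sqrrD; lra.
  rewrite z0 expr0n /= addr0 in E.
  have S0 : 0 <= w1 ^+ 2 + w2 ^+ 2 by rewrite addr_ge0 ?sqr_ge0.
  have : w1 ^+ 2 + w2 ^+ 2 = 0.
    apply/eqP; rewrite eq_le S0 andbT leNgt; apply/negP => Sp.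
    have := ltr_pM2r Sp (e2 ^+ 2 * 2) m; rewrite e2m -E; lra.
  move=> /eqP; rewrite paddr_eq0 ?sqr_ge0// !sqrf_eq0 !subr_eq0 => /andP[/eqP A /eqP B].
  by rewrite (surjective_pairing z) A B -surjective_pairing.
pose tau : R := rho / (4 * C).
have tau0 : 0 < tau by rewrite divr_gt0// mulr_gt0.
have Ctau : C * tau *+ 2 = rho / 2.
  by rewrite /tau -mulr_natr; field; rewrite gt_eqF.
pose rho1 : R := Num.min (rho / 2) (tau * (m / 4) / c0).
have tm : 0 < tau * (m / 4) by rewrite mulr_gt0// divr_gt0.
have rho10 : 0 < rho1 by rewrite lt_min; apply/andP; split; exact: divr_gt0.
have r1 : rho1 <= rho / 2 by rewrite ge_min lexx.
have r2 : c0 * rho1 <= tau * (m / 4).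
  by rewrite mulrC -ler_pdivlMr// ge_min lexx orbT.
clearbody rho1.
pose pos (t : R) : R := f.1 * (g1 t - q.1) + f.2 * (g2 t - q.2).
have dpos (t : R) : der pos t (dot f (Fv (g t))).
  apply: derD; first by have := derZ f.1 (derB (dg1 t) (der_cst q.1 t)); rewrite subr0.
  by have := derZ f.2 (derB (dg2 t) (der_cst q.2 t)); rewrite subr0.
have visit (n : R) : `|g1 n - q.1| + `|g2 n - q.2| <= rho1 ->
    exists2 t, n - tau <= t <= n + tau & g t = q.
  move=> hn.
  have inr t : `|t - n| <= tau -> `|g1 t - q.1| + `|g2 t - q.2| <= rho.
    move=> tn; have k1 := orbit_speed n t HC.
    have k2 : C * `|t - n| *+ 2 <= rho / 2 by rewrite -Ctau lerMn2r ler_wpM2l// ltW.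
    have k3 := ler_normD (g1 t - g1 n) (g1 n - q.1).
    have k4 := ler_normD (g2 t - g2 n) (g2 n - q.2).
    by move: k3 k4; rewrite !subrKA; lra.
  have posn : `|pos n| <= tau * (m / 4).
    apply: le_trans r2; rewrite (le_trans (ler_normD _ _))// !normrM.
    have k1 : c0 * (`|g1 n - q.1| + `|g2 n - q.2|) <= c0 * rho1.
      by rewrite ler_wpM2l// ltW.
    have k2 : 0 <= `|f.2| * `|g1 n - q.1| by rewrite mulr_ge0.
    have k3 : 0 <= `|f.1| * `|g2 n - q.2| by rewrite mulr_ge0.
    have k4 := normr_ge0 (g1 n - q.1); have k5 := normr_ge0 (g2 n - q.2).
    by move: k1; rewrite {1}/c0 !mulrDl !mulrDr; lra.
  have incr a b : a <= b -> n - tau <= a -> b <= n + tau ->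
      (m / 2) * (b - a) <= pos b - pos a.
    move=> ab na bn; have [c /andP[c1 c2] ->] := mvt_point ab (fun t _ => dpos t).
    rewrite ler_wpM2r ?subr_ge0//; apply: Hmono; first exact: Dg.
    apply: inr; rewrite ler_norml; clear Ctau tm rho10 r1 r2.
    by apply/andP; split; lra.
  have [m1 m2] : n - tau <= n /\ n <= n + tau by lra.
  have i1 := incr _ _ m1 (lexx _) m2; have i2 := incr _ _ m2 m1 (lexx _).
  have ez : m / 2 * (n - (n - tau)) = 2 * (tau * (m / 4)) by field.
  have ez' : m / 2 * (n + tau - n) = 2 * (tau * (m / 4)) by field.
  rewrite ez in i1; rewrite ez' in i2.
  move: posn; rewrite ler_norml => /andP[p1 p2].
  have [|t] := @IVT R pos (n - tau) (n + tau) 0 (le_trans m1 m2) (continuous_subspaceT (cont_der dpos)).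
    rewrite ge_min le_max; clear Ctau tm rho10 r1 r2 m1 m2 ez ez'.
    by apply/andP; split; apply/orP; [left|right]; lra.
  rewrite in_itv /= => /andP[t1 t2] pt; exists t; first by rewrite t1.
  apply: (Huniq _ (Dg t) _ (hq t) pt).
  apply: inr; rewrite ler_norml; clear Ctau tm rho10 r1 r2 m1 m2 ez ez' i1 i2 p1 p2.
  by apply/andP; split; lra.
have [n1 _ h1] := near_q _ 0%N rho10.
have [n2 hn h2] := near_q _ (n1 + (Num.truncn (2 * tau)).+1)%N rho10.
have [t1 /andP[_ a1] b1] := visit _ h1; have [t2 /andP[a2 _] b2] := visit _ h2.
exists t1, t2; split; last by rewrite b1.
have : n1%:R + (Num.truncn (2 * tau)).+1%:R <= n2%:R :> R by rewrite -natrD ler_nat.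
have := truncnS_gt (2 * tau); lra.
Qed.

(** For a short time the component of the position along the initial velocity
    increases, as the field hardly turns. *)
Lemma orbit_locally_injective : exists2 tau : R, 0 < tau &
  forall u v, u < v -> v - u <= tau -> g u != g v.
Proof.
have [C C0 HC] := hamiltonian_bound.
have [m m0 Hm] := hamiltonian_lower.
have e0 : 0 < m / (2 * C) by rewrite divr_gt0// mulr_gt0.
have [d d0 Hd] := hamiltonian_unif e0.
exists (d / (2 * C)); first by rewrite divr_gt0// mulr_gt0.
move=> u v uv; rewrite ler_pdivlMr ?mulr_gt0// => vu.
set f := Fv (g u).
pose pos (t : R) : R := f.1 * g1 t + f.2 * g2 t.
have dpos (t : R) : der pos t (dot f (Fv (g t))).
  exact: (derD (derZ f.1 (dg1 t)) (derZ f.2 (dg2 t))).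
apply/eqP => guv; have [c /andP[c1 c2]] := mvt_point (ltW uv) (fun t _ => dpos t).
have -> : pos v - pos u = 0.
  by case: guv => E1 E2; rewrite /pos E1 E2 subrr.
move=> /esym/eqP; rewrite mulf_eq0 subr_eq0 (gt_eqF uv) orbF => /eqP E.
have Hc : `|(g c).1 - (g u).1| + `|(g c).2 - (g u).2| <= d.
  apply: (le_trans (orbit_speed u c HC)); rewrite ger0_norm ?subr_ge0// -mulr_natr.
  have := ler_wpM2l (ltW C0) (_ : c - u <= v - u); rewrite lerB// => /(_ isT); lra.
have [a1 a2] := Hd _ _ (Dg u) (Dg c) Hc.
have : dot f (Fv (g c)) = dot f f + (f.1 * (F1 (g c) - F1 (g u)) + f.2 * (F2 (g c) - F2 (g u))).
  by rewrite /dot /f /Fv /=; ring.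
have b1 : `|f.1 * (F1 (g c) - F1 (g u)) + f.2 * (F2 (g c) - F2 (g u))| <= m / 2.
  rewrite (le_trans (ler_normD _ _))// !normrM.
  have b2 := ler_wpM2l (normr_ge0 f.1) a1; have b3 := ler_wpM2l (normr_ge0 f.2) a2.
  have b4 : (`|f.1| + `|f.2|) * (m / (2 * C)) <= m / 2.
    have -> : m / (2 * C) = m / 2 / C by rewrite invfM mulrA.
    rewrite mulrCA; apply: ler_piMr; first by rewrite divr_ge0// ltW.
    by rewrite ler_pdivrMr// mul1r; exact: HC.
  by move: b4; rewrite mulrDl; lra.
have := Hm _ (Dg u); rewrite -/f E; move: b1; rewrite ler_norml => /andP[]; lra.
Qed.

(** Poincare-Bendixson for Hamiltonian fields: a complete orbit would return to one
    of its points, and a shortest return would be a simple closed orbit. *)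
Theorem no_hamiltonian_orbit : False.
Proof.
have [t1 [t2 [t12 gt12]]] := orbit_returns.
have [tau tau0 inj] := orbit_locally_injective.
have [c1 c2] := hamiltonian_within.
have cg1 := cont_der dg1; have cg2 := cont_der dg2.
have gap u v : u < v -> g u = g v -> tau <= v - u.
  by move=> uv E; rewrite leNgt; apply/negP => /ltW /(inj _ _ uv); rewrite E eqxx.
pose Z : set (R * R) := `[t1, t2] `*` `[t1, t2].
pose S : set (R * R) := [set z | Z z /\ tau <= z.2 - z.1 /\ g z.1 = g z.2].
have cS : compact S.
  apply: (@subclosed_compact _ _ Z); last by move=> z [].
    have -> : S = Z `&` ((fun z : R * R => z.2 - z.1) @^-1` [set x | tau <= x] `&`
       ((fun z : R * R => g1 z.1 - g1 z.2) @^-1` [set x | x = 0] `&`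
        (fun z : R * R => g2 z.1 - g2 z.2) @^-1` [set x | x = 0])).
      rewrite eqEsubset; split=> z /=.
        by move=> [h1 [h2 [-> ->]]]; rewrite !subrr.
      by move=> [h1 [h2 [/eqP h3 /eqP h4]]]; split => //; split => //;
        move: h3 h4; rewrite !subr_eq0 /g => /eqP -> /eqP ->.
    apply: closedI.
      by apply: compact_closed; [exact: norm_hausdorff|apply: compact_setX; exact: segment_compact].
    apply: closedI; first apply: preimage_closed; [|exact: closed_ge|apply: closedI].
    - by move=> z _; apply: contB; [exact: cont_snd|exact: cont_fst].
    - apply: preimage_closed; last exact: closed_eq.
      by move=> z _; apply: contB; apply: (cont_comp _ cg1); [exact: cont_fst|exact: cont_snd].
    - apply: preimage_closed; last exact: closed_eq.
      by move=> z _; apply: contB; apply: (cont_comp _ cg2); [exact: cont_fst|exact: cont_snd].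
  by apply: compact_setX; exact: segment_compact.
have S0 : S !=set0.
  exists (t1, t2); split; last by split => //=; exact: gap.
  by split; rewrite /= in_itv /= lexx ltW.
have [|[s t] Sst smin] := compact_EVT_min (f := fun z => z.2 - z.1) S0 cS.
  by apply: continuous_subspaceT; apply: contB; [exact: cont_snd|exact: cont_fst].
have [[/= hs ht] [h1 /= h2]] : S (s, t) by rewrite inE in Sst.
move: hs ht; rewrite !in_itv /= => /andP[s1 s2] /andP[u1 u2].
have st : s < t by rewrite -subr_gt0 (lt_le_trans tau0).
apply: (no_simple_closed_orbit starD c1 c2 nzF Dg dg1 dg2 st h2).
move=> u v su uv vt short; apply/eqP => guv.
have : S (u, v).
  split; last by split => //=; exact: gap.
  by split; rewrite /= in_itv /=; apply/andP; split; lra.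
by move=> /mem_set /smin /=; rewrite leNgt short.
Qed.

End HamiltonianOrbit.

(** * Trapped sequences of small steps *)

Section SmallSteps.
Context {R : realType}.

Lemma ultra_fmap (T U : Type) (f : T -> U) (G : set_system T) :
  UltraFilter G -> UltraFilter (f @ G).
Proof.
move=> UG; have PG := @ultra_proper _ _ UG; split; first exact: fmap_proper_filter.
move=> H PH sub; rewrite eqEsubset; split=> A HA; last exact: sub.
have [//|nA] := in_ultra_setVsetC (f @^-1` A) UG.
have : H (A `&` ~` A) by apply: filterI => //; apply: sub.
by rewrite setICr => /filter_ex[].
Qed.

Lemma le_of_slack (x b M : R) : (forall a : R, 0 < a -> a <= 1 -> x <= b + a * M) -> x <= b.
Proof.
move=> H; apply/ler_addgt0Pr => e e0.
pose a : R := Num.min 1 (e / (`|M| + 1)).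
have M1 : 0 < `|M| + 1 by rewrite ltr_wpDl.
have a0 : 0 < a by rewrite lt_min ltr01 divr_gt0.
have ae : a * (`|M| + 1) <= e by rewrite -ler_pdivlMr// ge_min lexx orbT.
have a1 : a <= 1 by rewrite ge_min lexx.
apply: (le_trans (H a a0 a1)); rewrite lerD2l (le_trans _ ae)// ler_wpM2l ?(ltW a0)//.
by have := ler_norm M; lra.
Qed.

Lemma truncn_step (x e : R) : 0 < e -> 0 <= x ->
  (Num.truncn (x / e))%:R * e <= x /\ x - e < (Num.truncn (x / e))%:R * e.
Proof.
move=> e0 x0; have q0 : 0 <= x / e by rewrite divr_ge0// ltW.
have /andP[] := truncn_itv q0; rewrite ler_pdivlMr// ltr_pdivrMr// -natr1 mulrDl mul1r.
by move=> ? ?; split=> //; rewrite ltrBlDr.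
Qed.

(** Passage to the limit in an increment: [x], [x'], [s] and [f] are limits, within
    [a], of [y], [y'], [J] and [f']. *)
Lemma increment_estimate (a s J eta w C x x' y y' f f' : R) : 0 <= a -> a <= 1 ->
  0 <= s -> 0 <= J -> `|J - s| <= a -> 0 <= eta -> eta <= a -> 0 <= w ->
  `|y - x| <= a -> `|y' - x'| <= a -> `|f' - f| <= a ->
  `|f'| <= C -> `|y' - y - J * f'| <= J * (eta + w) ->
  `|x' - x - s * f| <= s * w + a * (4 + s + s + w + C).
Proof.
move=> a0 a1 s0 J0 Js eta0 etaa w0 a2 a3 a4 a5 a6.
have -> : x' - x - s * f = - (y' - x') + (y - x) + (y' - y - J * f')
    + ((J - s) * f' + s * (f' - f)) by ring.
have c1 : `|(J - s) * f'| <= a * C by rewrite normrM ler_pM.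
have c2 : `|s * (f' - f)| <= s * a by rewrite normrM (ger0_norm s0) ler_wpM2l.
have c3 : J * (eta + w) <= (s + a) * (a + w).
  apply: ler_pM => //; [by rewrite addr_ge0| |by rewrite lerD2r].
  by move: Js; rewrite ler_norml lerBlDl => /andP[_].
have c4 : a * a <= a by rewrite ler_piMl.
have e1 := ler_normD (- (y' - x') + (y - x) + (y' - y - J * f')) ((J - s) * f' + s * (f' - f)).
have e2 := ler_normD (- (y' - x') + (y - x)) (y' - y - J * f').
have e3 := ler_normD (- (y' - x')) (y - x); rewrite normrN in e3.
have e4 := ler_normD ((J - s) * f') (s * (f' - f)).
have -> : s * w + a * (4 + s + s + w + C) = s * w + 4 * a + 2 * (s * a) + a * w + a * C by ring.
have c5 : (s + a) * (a + w) = s * w + s * a + a * a + a * w by ring.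
rewrite c5 in c3; clear -a0 a2 a3 a6 c1 c2 c3 c4 e1 e2 e3 e4; lra.
Qed.

Variables (D : set (R * R)) (h F1 F2 : R * R -> R).
Hypothesis hF : hamiltonian_on D h F1 F2.
Hypothesis cD : compact D.

(** Inexact Euler steps that stay in [D]. The error is small relative to the step,
    as for the iterates of the period map of a weakly perturbed system. *)
Definition euler_steps (e eta : R) (z : nat -> R * R) : Prop := forall n,
  [/\ D (z n), `|(z n.+1).1 - (z n).1 - e * F1 (z n)| <= eta * e
    & `|(z n.+1).2 - (z n).2 - e * F2 (z n)| <= eta * e].

Lemma euler_steps_range C e eta z n j : 0 < e -> 0 < eta <= 1 ->
  (forall w, D w -> `|F1 w| + `|F2 w| <= C) -> euler_steps e eta z ->
  `|(z (n + j)%N).1 - (z n).1| + `|(z (n + j)%N).2 - (z n).2| <= j%:R * e * (C + 2).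
Proof.
move=> e0 /andP[eta0 eta1] HC Hz; elim: j => [|j IH].
  by rewrite addn0 !subrr normr0 !mul0r addr0.
rewrite addnS; have [Dz h1 h2] := Hz (n + j)%N; have c := HC _ Dz.
have k1 := ler_normD ((z (n + j).+1).1 - (z (n + j)%N).1) ((z (n + j)%N).1 - (z n).1).
have k2 := ler_normD ((z (n + j).+1).2 - (z (n + j)%N).2) ((z (n + j)%N).2 - (z n).2).
rewrite !subrKA in k1 k2.
have k3 := ler_normD ((z (n + j).+1).1 - (z (n + j)%N).1 - e * F1 (z (n + j)%N)) (e * F1 (z (n + j)%N)).
have k4 := ler_normD ((z (n + j).+1).2 - (z (n + j)%N).2 - e * F2 (z (n + j)%N)) (e * F2 (z (n + j)%N)).
rewrite !subrK !normrM (gtr0_norm e0) in k3 k4.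
have k5 : e * `|F1 (z (n + j)%N)| + e * `|F2 (z (n + j)%N)| <= e * C.
  by rewrite -mulrDr ler_wpM2l// ltW.
have k6 : eta * e <= e by rewrite ler_piMl// ltW.
have -> : j.+1%:R * e * (C + 2) = j%:R * e * (C + 2) + (e * C + 2 * e).
  by rewrite -natr1; ring.
lra.
Qed.

(** As long as the sequence stays where the field varies by at most [w], it moves
    as under a constant field, whatever the number of steps. *)
Lemma euler_steps_drift C e eta z n j (w d : R) : 0 < e -> 0 < eta <= 1 ->
  (forall z, D z -> `|F1 z| + `|F2 z| <= C) -> euler_steps e eta z ->
  (forall z z', D z -> D z' -> `|z'.1 - z.1| + `|z'.2 - z.2| <= d ->
    `|F1 z' - F1 z| <= w /\ `|F2 z' - F2 z| <= w) ->
  j%:R * e * (C + 2) <= d ->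
  `|(z (n + j)%N).1 - (z n).1 - j%:R * e * F1 (z n)| <= j%:R * e * (eta + w) /\
  `|(z (n + j)%N).2 - (z n).2 - j%:R * e * F2 (z n)| <= j%:R * e * (eta + w).
Proof.
move=> e0 eta01 HC Hz Hw; elim: j => [|j IH] hj.
  by rewrite addn0 !subrr !mul0r subr0 normr0.
have [Dn _ _] := Hz n.
have C0 : 0 <= C by apply: le_trans (HC _ Dn); rewrite addr_ge0.
have hj' : j%:R * e * (C + 2) <= d.
  apply: le_trans hj; rewrite ler_wpM2r//; first by rewrite addr_ge0.
  by rewrite ler_wpM2r ?(ltW e0)// ler_nat.
have [i1 i2] := IH hj'; rewrite addnS; have [Dz h1 h2] := Hz (n + j)%N.
have [w1 w2] := Hw _ _ Dn Dz (le_trans (euler_steps_range n j e0 eta01 HC Hz) hj').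
have aux (x y y0 f f0 : R) : `|y - y0 - j%:R * e * f0| <= j%:R * e * (eta + w) ->
    `|x - y - e * f| <= eta * e -> `|f - f0| <= w ->
    `|x - y0 - j.+1%:R * e * f0| <= j.+1%:R * e * (eta + w).
  move=> a1 a2 a3.
  have -> : x - y0 - j.+1%:R * e * f0 =
      (y - y0 - j%:R * e * f0) + ((x - y - e * f) + e * (f - f0)) by rewrite -natr1; ring.
  have -> : j.+1%:R * e * (eta + w) = j%:R * e * (eta + w) + (eta * e + e * w).
    by rewrite -natr1; ring.
  rewrite (le_trans (ler_normD _ _))// lerD// (le_trans (ler_normD _ _))// lerD//.
  by rewrite normrM (gtr0_norm e0) ler_wpM2l// ltW.
by split; [exact: aux i1 h1 w1|exact: aux i2 h2 w2].
Qed.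

(** The sequences are run from times that recede to minus infinity, so that the
    limit is defined on the whole line; an ultrafilter provides limits at all times
    at once. *)
Lemma euler_steps_limit :
  (forall eta : R, 0 < eta -> exists (e : R) z, [/\ 0 < e, e < eta & euler_steps e eta z]) ->
  exists g1 g2 : R -> R, [/\ forall u : R, D (g1 u, g2 u),
    forall u : R, der g1 u (F1 (g1 u, g2 u)) & forall u : R, der g2 u (F2 (g1 u, g2 u))].
Proof.
move=> H.
have [C C0 HC] := hamiltonian_bound hF cD.
have /choice[ez Hez] : forall k : nat, exists ez : R * (nat -> R * R),
    [/\ 0 < ez.1, ez.1 < k.+1%:R^-1 & euler_steps ez.1 k.+1%:R^-1 ez.2].
  move=> k; have [|e [z [e0 ek st]]] := H k.+1%:R^-1; first by rewrite invr_gt0.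
  by exists (e, z).
pose ee k := (ez k).1; pose zz k := (ez k).2.
pose N (t : R) k := Num.truncn ((t + k%:R) / ee k).
have [U [UU sub]] := ultraFilterLemma (eventually_filter : ProperFilter \oo).
have PU := @ultra_proper _ _ UU.
have /choice[g Hg] : forall t : R, exists w : R * R,
    D w /\ (zz k (N t k)) @[k --> U] --> w.
  move=> t; have := compact_ultra (R * R)%type; move: cD => /[swap] -> /=.
  move=> /(_ ((fun k => zz k (N t k)) @ U) (ultra_fmap _ UU)) [|w [Dw cw]].
    by apply: (@filterE _ U) => k; have [_ _ /(_ (N t k))[]] := Hez k.
  by exists w.
have Dg t := (Hg t).1.
have U_near (t d : R) : 0 < d ->
    U [set k | `|(zz k (N t k)).1 - (g t).1| + `|(zz k (N t k)).2 - (g t).2| <= d].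
  by move=> d0; apply: ((Hg t).2 _ (near_l1 (g t) d0)).
have U_small (d : R) : 0 < d -> U [set k | k.+1%:R^-1 <= d].
  move=> d0; apply: sub; exists (Num.truncn d^-1) => // k /= hk.
  rewrite invf_ple ?posrE//; apply: ltW; apply: lt_le_trans (truncnS_gt _) _.
  by rewrite ler_nat ltnS.
have U_far (t : R) : U [set k | 0 <= t + k%:R].
  apply: sub; exists (Num.truncn `|t|).+1 => // k /= hk.
  have a1 := truncnS_gt `|t|; have a2 := ler_norm (- t); rewrite normrN in a2.
  have a3 : (Num.truncn `|t|).+1%:R <= k%:R :> R by rewrite ler_nat.
  lra.
(* the expansion has to be uniform in [t], as it is used below at moving times *)
have incr (w : R) : 0 < w -> exists2 d : R, 0 < d & forall t s : R, 0 <= s -> s <= d ->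
    `|(g (t + s)).1 - (g t).1 - s * F1 (g t)| <= s * w /\
    `|(g (t + s)).2 - (g t).2 - s * F2 (g t)| <= s * w.
  move=> w0; have [d d0 Hd] := hamiltonian_unif hF w0.
  pose dd : R := d / (2 * (C + 2)).
  have C2 : 0 < C + 2 by rewrite addr_gt0.
  have dd0 : 0 < dd by rewrite divr_gt0// mulr_gt0.
  have ddE : 2 * (dd * (C + 2)) = d by rewrite /dd; field; rewrite gt_eqF.
  clearbody dd; exists dd => // t s s0 sd.
  suff main (a : R) : 0 < a -> a <= 1 -> 
      `|(g (t + s)).1 - (g t).1 - s * F1 (g t)| <= s * w + a * (4 + s + s + w + C) /\
      `|(g (t + s)).2 - (g t).2 - s * F2 (g t)| <= s * w + a * (4 + s + s + w + C).
    by split; apply: le_of_slack => a a0 a1; [exact: (main a a0 a1).1|exact: (main a a0 a1).2].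
  move=> a0 a1; have [da da0 Hda] := hamiltonian_unif hF a0.
  have m0 : 0 < Num.min a da by rewrite lt_min a0.
  have m1 : 0 < Num.min a dd by rewrite lt_min a0.
  have [k [[hk1 hk2] [[hk3 hk4] hk5]]] := filter_ex (filterI
    (filterI (U_near t _ m0) (U_near (t + s) _ a0))
    (filterI (filterI (U_far t) (U_far (t + s))) (U_small _ m1))).
  rewrite /= in hk1 hk2 hk3 hk4 hk5.
  have [e0 ek st] := Hez k; rewrite -/(ee k) in e0 ek st; rewrite -/(zz k) in st.
  have k1 : 0 < (k.+1%:R^-1 : R) <= 1.
    by rewrite invr_gt0 ltr0n /= invf_le1 ?ltr0n// ler1n.
  move: (k.+1%:R^-1 : R) k1 hk5 ek st => eta k1 hk5 ek st.
  move: hk1 hk5; rewrite !le_min => /andP[hk1 hk1'] /andP[hk5 hk5'].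
  have [l1 l2] := truncn_step e0 hk3; have [l3 l4] := truncn_step e0 hk4.
  rewrite -/(N t k) in l1 l2; rewrite -/(N (t + s) k) in l3 l4.
  have NN : (N t k <= N (t + s)%R k)%N.
    rewrite /N; apply: le_truncn; by rewrite ler_pM2r ?invr_gt0// lerD2r lerDl.
  have [j Ej] : exists j, N (t + s) k = (N t k + j)%N.
    by exists (N (t + s)%R k - N t k)%N; rewrite subnKC.
  rewrite Ej natrD mulrDl in l3 l4; rewrite Ej in hk2.
  set J : R := j%:R * ee k in l3 l4.
  have J1 : `|J - s| <= ee k.
    by move: l1 l2 l3 l4; clear; rewrite ler_norml => *; apply/andP; split; lra.
  have ea : ee k <= a by rewrite (le_trans (ltW ek)).
  have ed : ee k <= dd by rewrite (le_trans (ltW ek)).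
  have Js : J <= s + ee k by move: J1; clear; rewrite ler_norml => /andP[]; lra.
  have J0 : 0 <= J by rewrite /J mulr_ge0// ltW.
  have Jd : j%:R * ee k * (C + 2) <= d.
    rewrite -/J -ddE mulrA ler_wpM2r ?(ltW C2)//.
    by move: Js ed sd; clear; lra.
  have [Dn _ _] := st (N t k).
  have [b1 b2] := euler_steps_drift (N t k) e0 k1 HC st Hd Jd.
  have [f1 f2] := Hda _ _ (Dg t) Dn hk1'.
  have cc := HC _ Dn.
  have ay : `|(zz k (N t k)).1 - (g t).1| <= a by apply: le_trans hk1; rewrite lerDl.
  have by_ : `|(zz k (N t k)).2 - (g t).2| <= a by apply: le_trans hk1; rewrite lerDr.
  have ay' : `|(zz k (N t k + j)%N).1 - (g (t + s)).1| <= a.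
    by apply: le_trans hk2; rewrite lerDl.
  have by' : `|(zz k (N t k + j)%N).2 - (g (t + s)).2| <= a.
    by apply: le_trans hk2; rewrite lerDr.
  have cF1 : `|F1 (zz k (N t k))| <= C by apply: le_trans cc; rewrite lerDl.
  have cF2 : `|F2 (zz k (N t k))| <= C by apply: le_trans cc; rewrite lerDr.
  have Ja := le_trans J1 ea; have /andP[/ltW eta0 _] := k1.
  have est := increment_estimate (ltW a0) a1 s0 J0 Ja eta0 hk5 (ltW w0).
  by split; [exact: est ay ay' f1 cF1 b1|exact: est by_ by' f2 cF2 b2].
(* an increment backwards in time is a forward one from a nearby point, where the
   field is nearly the same *)
exists (fun t => (g t).1), (fun t => (g t).2).
have [u0 u00 Hu0] := incr 1 ltr01.
have two_sided (p : R * R -> R) (F : R * R -> R) :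
    (forall w : R, 0 < w -> exists2 d : R, 0 < d & forall t s : R, 0 <= s -> s <= d ->
       `|p (g (t + s)) - p (g t) - s * F (g t)| <= s * w) ->
    (forall w : R, 0 < w -> exists2 d : R, 0 < d & forall z z', D z -> D z' ->
       `|z'.1 - z.1| + `|z'.2 - z.2| <= d -> `|F z' - F z| <= w) ->
    forall u : R, der (fun t => p (g t)) u (F (g u)).
  move=> Hp HF u; apply/der_epsP => e e0.
  have e2 : 0 < e / 2 by rewrite divr_gt0.
  have [d d0 Hd] := Hp _ e2; have [d1 d10 Hd1] := HF _ e2.
  have C2 : 0 < C + 2 by rewrite addr_gt0.
  exists (Num.min d (Num.min u0 (d1 / (C + 2)))).
    by rewrite !lt_min d0 u00 divr_gt0.
  move=> s; rewrite !le_min => /and3P[s1 s2 s3].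
  have [s0|s0] := leP 0 s.
    rewrite [F _ * _]mulrC; rewrite (ger0_norm s0) in s1 *.
    by apply: (le_trans (Hd u s s0 s1)); rewrite mulrC ler_wpM2r//; lra.
  rewrite (ltr0_norm s0) in s1 s2 s3 *.
  have ns0 : 0 <= - s by lra.
  have := Hd (u + s) (- s) ns0 s1; rewrite addrK.
  have [v1 v2] := Hu0 (u + s) (- s) ns0 s2; rewrite !addrK in v1 v2.
  have cc := HC _ (Dg (u + s)).
  have w1 := ler_normD ((g u).1 - (g (u + s)).1 - - s * F1 (g (u + s))) (- s * F1 (g (u + s))).
  have w2 := ler_normD ((g u).2 - (g (u + s)).2 - - s * F2 (g (u + s))) (- s * F2 (g (u + s))).
  rewrite !subrK [`|- s * _|]normrM [`|- s * _|]normrM (ger0_norm ns0) in w1 w2.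
  have w3 : - s * `|F1 (g (u + s))| + - s * `|F2 (g (u + s))| <= - s * C.
    by rewrite -mulrDr ler_wpM2l.
  have w4 : - s * (C + 2) <= d1 by rewrite -ler_pdivlMr.
  have w5 : - s * (C + 2) = - s * C + - s * 1 + - s * 1 by ring.
  have := Hd1 _ _ (Dg (u + s)) (Dg u) _.
  set A := F (g u); set B := F (g (u + s)) => hAB hA.
  have {}hAB : `|A - B| <= e / 2 by apply: hAB; lra.
  have -> : p (g (u + s)) - p (g u) - A * s =
     - (p (g u) - p (g (u + s)) - - s * B) + (- s) * (A - B) by ring.
  rewrite (le_trans (ler_normD _ _))// normrN normrM (ger0_norm ns0).
  have := ler_wpM2l ns0 hAB; move: hA; clear; lra.
split=> u; rewrite -?surjective_pairing//.
- apply: (two_sided (fun z => z.1) F1).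
    by move=> w /incr[d d0 Hd]; exists d => // t s s0 sd; case: (Hd t s s0 sd).
  by move=> w /(hamiltonian_unif hF)[d d0 Hd]; exists d => // z z' Dz Dz' hz; case: (Hd z z' Dz Dz' hz).
- apply: (two_sided (fun z => z.2) F2).
    by move=> w /incr[d d0 Hd]; exists d => // t s s0 sd; case: (Hd t s s0 sd).
  by move=> w /(hamiltonian_unif hF)[d d0 Hd]; exists d => // z z' Dz Dz' hz; case: (Hd z z' Dz Dz' hz).
Qed.

Hypothesis starD : forall z (a : R), D z -> 0 <= a <= 1 -> D (a * z.1, a * z.2).
Hypothesis nzF : forall z, D z -> (F1 z, F2 z) != 0.

(** Otherwise a limit of trapped sequences would be a complete orbit in [D] of a
    Hamiltonian field without zeros. *)
Lemma euler_steps_escape : exists2 eta : R, 0 < eta &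
  forall (e : R) z, 0 < e -> e < eta -> ~ euler_steps e eta z.
Proof.
apply: contrapT => /forall2NP no.
have [g1 [g2 [Dg dg1 dg2]]] : exists g1 g2 : R -> R, [/\ forall u : R, D (g1 u, g2 u),
    forall u : R, der g1 u (F1 (g1 u, g2 u)) & forall u : R, der g2 u (F2 (g1 u, g2 u))].
  apply: euler_steps_limit => eta eta0.
  have [//|] := no eta; apply: contra_notP => H e z e0 ee st; apply: H.
  by exists e, z.
exact: (no_hamiltonian_orbit hF cD starD nzF Dg dg1 dg2).
Qed.

End SmallSteps.

(** * Solvability and stability of Newton's equation *)

Section Cauchy.
Context {R : realType}.

Lemma geometric_small (K e : R) : 0 < e ->
  exists n : nat, forall m, (n <= m)%N -> K * 2^-1 ^+ m <= e.
Proof.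
move=> e0; exists (Num.truncn (`|K| / e)).+1 => m nm.
have m2 : m%:R <= 2 ^+ m :> R by rewrite -natrX ler_nat ltnW// ltn_expl.
have h1 : `|K| / e < m%:R.
  by apply: lt_le_trans (truncnS_gt _) _; rewrite ler_nat.
rewrite ltr_pdivrMr// in h1.
rewrite exprVn ler_pdivrMr ?exprn_gt0//.
apply: (le_trans (ler_norm K)); apply: (le_trans (ltW h1)).
by rewrite mulrC ler_wpM2l// ltW.
Qed.

(** Each integration gains a factor [1 / lam] in the norm with the exponential
    weight, which is what makes Picard iteration contract on the whole line. *)
Lemma exp_weight_major (f f' : R -> R) (S c lam : R) : 0 <= c -> 0 < lam ->
  (forall t : R, der f t (f' t)) -> f 0 = 0 ->
  (forall t : R, `|t| <= S -> `|f' t| <= c * expR (lam * `|t|)) ->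
  forall t : R, `|t| <= S -> `|f t| <= c / lam * expR (lam * `|t|).
Proof.
move=> c0 l0.
have pos (k k' : R -> R) : (forall t : R, der k t (k' t)) -> k 0 = 0 ->
    (forall t : R, `|t| <= S -> `|k' t| <= c * expR (lam * `|t|)) ->
    forall t : R, 0 <= t -> t <= S -> `|k t| <= c / lam * expR (lam * t).
  move=> hk k0 hb t t0 tS.
  have dg (s : R) : der (fun s => c / lam * expR (lam * s)) s (c * expR (lam * s)).
    have h1 := derZ lam (der_id s).
    have h2 := @der_comp R expR (fun s => lam * s) s _ _ h1 (is_derive_expR (lam * s)).
    by apply: der_eq (derZ (c / lam) h2) _; field; rewrite gt_eqF.
  have := mvt_major t0 (fun s _ => hk s) (fun s _ => dg s) _.
  rewrite k0 subr0 mulr0 expR0 mulr1 => H; apply: le_trans (H _) _.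
    move=> s /andP[s0 st]; have := hb s; rewrite (ger0_norm s0); apply.
    exact: le_trans st tS.
  by rewrite lerBlDr lerDl divr_ge0// ltW.
move=> hf f0 hb t tS; have [t0|t0] := leP 0 t.
  by rewrite (ger0_norm t0); apply: (pos f f') => //; rewrite -(ger0_norm t0).
have -> : f t = (fun s => f (- s)) (- t) by rewrite opprK.
rewrite (ltr0_norm t0) in tS *.
apply: (pos (fun s => f (- s)) (fun s => - f' (- s))) => //; last by rewrite oppr_ge0 ltW.
- by move=> s; exact: der_rev.
- by rewrite oppr0.
- by move=> s sS; rewrite normrN; have := hb (- s); rewrite normrN; apply.
Qed.

(** Picard iteration on the whole line at once: with the weight [expR (lam * |t|)],
    each step halves the errors. *)
Theorem global_cauchy (b G : R -> R) (L x0 u0 : R) : continuous b -> 0 < L ->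
  (forall x y, `|G x - G y| <= L * `|x - y|) ->
  exists x u : R -> R, [/\ x 0 = x0, u 0 = u0 &
    forall t : R, der x t (u t + b t) /\ der u t (- G (x t))].
Proof.
move=> cb L0 lipG.
have cG : continuous G.
  move=> y; apply/cvgrPdist_le => e e0.
  have : \forall z \near y, `|y - z| <= e / L.
    have /cvgrPdist_le := @cvg_id _ (nbhs y); apply; exact: divr_gt0.
  apply: filterS => z hz; apply: (le_trans (lipG _ _)).
  by rewrite mulrC -ler_pdivlMr.
have cpr (f : R -> R) : continuous f -> continuous (prim f).
  by move=> cf t; apply: der_cont (der_prim t cf).
have cGx (x : R -> R) : continuous x -> continuous (fun t => G (x t)).
  by move=> cx; exact: (cont_comp cx cG).
pose v (x : R -> R) (t : R) : R := u0 - prim (fun s => G (x s)) t + b t.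
have cv (x : R -> R) : continuous x -> continuous (v x).
  move=> cx; apply: contD cb; apply: contB; first exact: cont_cst.
  by apply: cpr; exact: cGx.
pose T (x : R -> R) (t : R) : R := x0 + prim (v x) t.
have dT (x : R -> R) (t : R) : continuous x -> der (T x) t (v x t).
  move=> cx; have h := derD (der_cst x0 t) (der_prim t (cv x cx)).
  by apply: der_eq h _; rewrite add0r.
have cT (x : R -> R) : continuous x -> continuous (T x).
  by move=> cx t; apply: der_cont (dT x t cx).
have T0 (x : R -> R) : continuous x -> T x 0 = x0 by move=> cx; rewrite /T prim0 ?addr0//; exact: cv.
pose lam : R := 2 * L + 1.
have lam0 : 0 < lam by rewrite addr_gt0// mulr_gt0.
have contr (x y : R -> R) (S c : R) : continuous x -> continuous y -> 0 <= c ->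
    (forall t : R, `|t| <= S -> `|x t - y t| <= c * expR (lam * `|t|)) ->
    forall t : R, `|t| <= S -> `|T x t - T y t| <= c / 2 * expR (lam * `|t|).
  move=> cx cy c0 hb t tS.
  have s1 (s : R) : `|s| <= S -> `|prim (fun r => G (x r)) s - prim (fun r => G (y r)) s| <=
      L * c / lam * expR (lam * `|s|).
    apply: (@exp_weight_major (fun s => prim (fun r => G (x r)) s - prim (fun r => G (y r)) s)
      (fun r => G (x r) - G (y r)) S (L * c)) => //.
    - by rewrite mulr_ge0// ltW.
    - by move=> r; apply: derB; apply: der_prim; exact: cGx.
    - by rewrite !prim0 ?subrr//; exact: cGx.
    - move=> r rS; apply: (le_trans (lipG _ _)).
      by rewrite -mulrA ler_wpM2l ?(ltW L0)//; exact: hb.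
  have s2 : `|T x t - T y t| <= L * c / lam / lam * expR (lam * `|t|).
    apply: (@exp_weight_major (fun s => T x s - T y s) (fun r => v x r - v y r) S
      (L * c / lam)) => //.
    - by rewrite divr_ge0 ?mulr_ge0// ltW.
    - by move=> r; apply: derB; exact: dT.
    - by rewrite !T0 ?subrr.
    - move=> r rS; have -> : v x r - v y r =
        - (prim (fun r => G (x r)) r - prim (fun r => G (y r)) r) by rewrite /v; ring.
      by rewrite normrN; exact: s1.
  apply: (le_trans s2); rewrite ler_wpM2r ?expR_ge0//.
  rewrite -mulrA -invfM ler_pdivrMr ?mulr_gt0//.
  have -> : c / 2 * (lam * lam) = c * (2 * L ^+ 2 + 2 * L + 2^-1) by rewrite /lam; field.
  by rewrite mulrC ler_wpM2l//; have := sqr_ge0 L; lra.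
pose X n := iter n T (fun=> x0).
have cX n : continuous (X n) by elim: n => [|n IH] /=; [exact: cont_cst|exact: cT].
have tail (S : R) : exists2 K : R, 0 <= K & forall n j (t : R), `|t| <= S ->
    `|X (n + j)%N t - X n t| <= K * 2^-1 ^+ n.
  have [M M0 HM] : exists2 M : R, 0 <= M & forall t : R, `|t| <= S -> `|X 1%N t - X 0%N t| <= M.
    have [S0|S0] := leP 0 S; last first.
      exists 0 => // t; rewrite leNgt => /negP[]; exact: lt_le_trans S0 _.
    have cdiff : continuous (fun t => `|X 1%N t - X 0%N t|).
      by move=> t; apply: cvg_norm; apply: (contB (cX 1%N) (cX 0%N)).
    have SS : - S <= S by lra.
    have [c _ Hc] := EVT_max SS (continuous_subspaceT cdiff).
    exists (`|X 1%N c - X 0%N c|) => // t; rewrite ler_norml => tS.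
    by apply: Hc; rewrite in_itv.
  have step n (t : R) : `|t| <= S -> `|X n.+1 t - X n t| <= M * 2^-1 ^+ n * expR (lam * `|t|).
    elim: n t => [|n IH] t tS.
      rewrite expr0 mulr1; apply: (le_trans (HM t tS)).
      by rewrite ler_peMr// -expR0 ler_expR mulr_ge0// ltW.
    rewrite exprSr mulrA.
    apply: (contr _ _ S (M * 2^-1 ^+ n) (cX n.+1) (cX n)) => //.
    by rewrite mulr_ge0// exprn_ge0.
  exists (2 * (M * expR (lam * S))); first by rewrite !mulr_ge0// expR_ge0.
  move=> n j t tS; set K := M * expR (lam * S).
  have K0 : 0 <= K by rewrite mulr_ge0// expR_ge0.
  have step' k : `|X k.+1 t - X k t| <= K * 2^-1 ^+ k.
    apply: (le_trans (step k t tS)); rewrite /K mulrAC ler_wpM2r ?exprn_ge0//.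
    by rewrite ler_wpM2l// ler_expR ler_wpM2l// ltW.
  have : `|X (n + j)%N t - X n t| <= 2 * K * 2^-1 ^+ n - 2 * K * 2^-1 ^+ (n + j).
    elim: j => [|j IH]; first by rewrite addn0 !subrr normr0.
    have := ler_normD (X (n + j).+1 t - X (n + j)%N t) (X (n + j)%N t - X n t).
    rewrite subrKA addnS exprS; have := step' (n + j)%N.
    move: IH; set q := 2^-1 ^+ (n + j); have -> : 2 * K * (2^-1 * q) = K * q by field.
    by lra.
  have : 0 <= 2 * K * 2^-1 ^+ (n + j) by rewrite !mulr_ge0 ?exprn_ge0.
  by lra.
have q0 m : 0 <= (2^-1 : R) ^+ m by rewrite exprn_ge0.
have /choice[x Hx] : forall t : R, exists l : R, X n t @[n --> \oo] --> l.
  move=> t; have [K K0 HK] := tail `|t|.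
  apply/cvg_ex; apply: cauchy_cvg; apply: cauchy_exP => e e0.
  have [n Hn] := @geometric_small K (e / 2) (divr_gt0 e0 (ltr0Sn _ 1)).
  exists (X n t); exists n => // m /= nm; rewrite /ball /= distrC.
  rewrite -(subnKC nm); apply: (le_lt_trans (HK n (m - n)%N t (lexx _))).
  by apply: (le_lt_trans (Hn n (leqnn n))); rewrite ltr_pdivrMr// ltr_pMr// ltr1n.
have near_x (S : R) : exists2 K : R, 0 <= K & forall n (t : R), `|t| <= S ->
    `|x t - X n t| <= K * 2^-1 ^+ n.
  have [K K0 HK] := tail S; exists K => // n t tS; apply/ler_addgt0Pr => e e0.
  have /cvgrPdist_le/(_ e e0)[m _ Hm] := Hx t.
  have h1 := Hm (n + m)%N (leq_addl _ _); have h2 := HK n m t tS.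
  have := ler_normD (x t - X (n + m)%N t) (X (n + m)%N t - X n t).
  by rewrite subrKA /= in h1 *; lra.
have cx : continuous x.
  move=> t; have [K K0 HK] := near_x (`|t| + 1); apply/cvgrPdist_le => e e0.
  have e3 : 0 < e / 3 by rewrite divr_gt0.
  have [n /(_ n (leqnn n)) Hn] := @geometric_small K _ e3.
  have n1 : \forall s \near t, `|X n t - X n s| <= e / 3.
    by have /cvgrPdist_le/(_ _ e3) := cX n t.
  have n2 : \forall s \near t, `|t - s| <= 1 by have /cvgrPdist_le/(_ _ ltr01) := @cvg_id _ (nbhs t).
  apply: filterS2 n1 n2 => s h1 h2.
  have h3 := HK n t; have h4 := HK n s.
  have h5 := ler_normD (s - t) t; rewrite subrK distrC in h5.
  have {}h3 : `|x t - X n t| <= e / 3 by apply: le_trans Hn; apply: h3; rewrite lerDl.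
  have {}h4 : `|x s - X n s| <= e / 3 by apply: le_trans Hn; apply: h4; lra.
  have h6 := ler_normD (x t - X n t) (X n t - X n s).
  have h7 := ler_normB (x t - X n s) (x s - X n s).
  rewrite subrKA in h6; rewrite opprB addrA subrK in h7.
  lra.
have fix_x : T x = x.
  apply/funext => t; apply/eqP; rewrite -subr_eq0 -normr_le0; apply/ler_addgt0Pr => e e0.
  rewrite add0r; have [K K0 HK] := near_x `|t|.
  have [n Hn] := @geometric_small (K * expR (lam * `|t|) + K) _ e0.
  have h1 := HK n.+1 t (lexx _).
  have h2 : `|T x t - X n.+1 t| <= K * 2^-1 ^+ n / 2 * expR (lam * `|t|).
    apply: (contr x (X n) `|t|) => //; first by rewrite mulr_ge0.
    move=> s hs; apply: (le_trans (HK n s hs)); rewrite ler_peMr ?mulr_ge0//.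
    by rewrite -expR0 ler_expR mulr_ge0// ltW.
  have := ler_normB (T x t - X n.+1 t) (x t - X n.+1 t).
  rewrite opprB addrA subrK => h3; apply: (le_trans h3).
  apply: le_trans (Hn n.+1 (leqnSn n)); rewrite mulrDl lerD//.
  by apply: (le_trans h2); rewrite exprSr le_eqVlt; apply/orP; left; apply/eqP; ring.
exists x, (fun t => u0 - prim (fun s => G (x s)) t); split.
- by rewrite -fix_x T0.
- by rewrite prim0 ?subr0//; exact: cGx.
- move=> t; split; first by have := dT x t cx; rewrite fix_x.
  have h := derB (der_cst u0 t) (der_prim t (cGx x cx)).
  by apply: der_eq h _; rewrite sub0r.
Qed.

(** Gronwall's inequality. The sum of squares, unlike that of absolute values, is
    differentiable; including [c ^+ 2] in it absorbs the constant term. *)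
Lemma gronwall (f g f' g' : R -> R) (T L c : R) : 0 <= L -> 0 <= c ->
  (forall t : R, 0 <= t <= T -> der f t (f' t)) ->
  (forall t : R, 0 <= t <= T -> der g t (g' t)) ->
  (forall t : R, 0 <= t <= T -> `|f' t| <= L * (`|f t| + `|g t|) + c) ->
  (forall t : R, 0 <= t <= T -> `|g' t| <= L * (`|f t| + `|g t|) + c) ->
  forall t : R, 0 <= t <= T ->
    `|f t| + `|g t| <= 2 * expR ((4 * L + 2) * T) * (`|f 0| + `|g 0| + c).
Proof.
move=> L0 c0 hf hg bf bg t /andP[t0 tT].
pose K : R := 4 * L + 2.
have K0 : 0 < K by rewrite /K; lra.
pose N s := f s ^+ 2 + g s ^+ 2 + c ^+ 2.
pose N' s := 2 * (f s * f' s) + 2 * (g s * g' s).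
have dN (s : R) : 0 <= s <= T -> der N s (N' s).
  move=> sT; have h := derD (derD (derM (hf s sT) (hf s sT)) (derM (hg s sT) (hg s sT)))
    (der_cst (c ^+ 2) s).
  by apply: der_eq h _; rewrite /N'; ring.
have N'K (s : R) : 0 <= s <= T -> N' s <= K * N s.
  move=> sT; have h1 := bf s sT; have h2 := bg s sT.
  have a0 := normr_ge0 (f s); have b0 := normr_ge0 (g s).
  have e1 : f s * f' s <= `|f s| * (L * (`|f s| + `|g s|) + c).
    by rewrite (le_trans (ler_norm _))// normrM ler_wpM2l.
  have e2 : g s * g' s <= `|g s| * (L * (`|f s| + `|g s|) + c).
    by rewrite (le_trans (ler_norm _))// normrM ler_wpM2l.
  rewrite /N /N' /K -(real_normK (num_real (f s))) -(real_normK (num_real (g s))).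
  move: (`|f s|) (`|g s|) a0 b0 e1 e2 => A B a0 b0 e1 e2.
  have e3 : A * (L * (A + B) + c) + B * (L * (A + B) + c) = L * (A + B) ^+ 2 + (A + B) * c by ring.
  have e4 : 2 * ((A + B) * c) <= (A + B) ^+ 2 + c ^+ 2.
    by have := sqr_ge0 (A + B - c); rewrite sqrrB; lra.
  have e5 : (A + B) ^+ 2 <= 2 * (A ^+ 2 + B ^+ 2).
    by have := sqr_ge0 (A - B); rewrite sqrrB sqrrD; lra.
  have e6 := ler_wpM2l L0 e5.
  have e7 : 0 <= L * c ^+ 2 by rewrite mulr_ge0// sqr_ge0.
  have e8 := sqr_ge0 c.
  have -> : (4 * L + 2) * (A ^+ 2 + B ^+ 2 + c ^+ 2) =
     2 * (L * (2 * (A ^+ 2 + B ^+ 2))) + 2 * (A ^+ 2 + B ^+ 2) + 4 * (L * c ^+ 2) + 2 * c ^+ 2 by ring.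
  lra.
pose E s := expR (- K * s).
have dE (s : R) : der E s (- K * E s).
  have h1 := derZ (- K) (der_id s).
  have h2 := @der_comp R expR (fun s => - K * s) s _ _ h1 (is_derive_expR (- K * s)).
  by apply: der_eq h2 _; rewrite /E; ring.
have mono : N t * E t <= N 0 * E 0.
  have dNE (s : R) : 0 <= s <= t -> der (fun s => N s * E s) s ((N' s - K * N s) * E s).
    move=> /andP[s0 st]; have sT : 0 <= s <= T by rewrite s0 (le_trans st).
    by apply: der_eq (derM (dN s sT) (dE s)) _; ring.
  have [s /andP[s0 st] E1] := mvt_point t0 dNE.
  have sT : 0 <= s <= T by rewrite s0 (le_trans st).
  rewrite -subr_le0 E1 subr0 mulr_le0_ge0// mulr_le0_ge0 ?expR_ge0//.
  by rewrite subr_le0 N'K.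
have Nt : N t <= N 0 * expR (K * t).
  move: mono; rewrite /E mulr0 expR0 mulr1 mulNr expRN ler_pdivrMr ?expR_gt0//.
have S0 : 0 <= `|f 0| + `|g 0| + c by rewrite !addr_ge0.
have N0 : N 0 <= (`|f 0| + `|g 0| + c) ^+ 2.
  rewrite /N -(real_normK (num_real (f 0))) -(real_normK (num_real (g 0))).
  have a1 := mulr_ge0 (normr_ge0 (f 0)) (normr_ge0 (g 0)).
  have a2 := mulr_ge0 (normr_ge0 (f 0)) c0; have a3 := mulr_ge0 (normr_ge0 (g 0)) c0.
  by rewrite !expr2 in a1 a2 a3 *; lra.
set S := `|f 0| + _ + c in S0 N0 *.
have X0 : 0 <= expR (K * T) by exact: expR_ge0.
have X1 : 1 <= expR (K * T) by rewrite -expR0 ler_expR mulr_ge0 ?(ltW K0)// (le_trans t0).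
have X2 : expR (K * t) <= expR (K * T) by rewrite ler_expR ler_wpM2l// ltW.
have sq : (`|f t| + `|g t|) ^+ 2 <= (2 * expR (K * T) * S) ^+ 2.
  apply: (@le_trans _ _ (2 * N t)).
    rewrite /N -(real_normK (num_real (f t))) -(real_normK (num_real (g t))).
    by have := sqr_ge0 (`|f t| - `|g t|); have := sqr_ge0 c; rewrite sqrrB sqrrD; lra.
  apply: (@le_trans _ _ (2 * (S ^+ 2 * expR (K * T)))).
    rewrite ler_wpM2l//; apply: (le_trans Nt).
    by apply: ler_pM => //; rewrite !addr_ge0// sqr_ge0.
  have -> : (2 * expR (K * T) * S) ^+ 2 = 2 * (S ^+ 2 * expR (K * T)) * (2 * expR (K * T)) by ring.
  by rewrite ler_peMr ?mulr_ge0 ?sqr_ge0//; lra.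
by move: sq; rewrite ler_pXn2r// nnegrE ?mulr_ge0 ?addr_ge0.
Qed.

End Cauchy.

(** * One period of the perturbed motion *)

Section OnePeriod.
Context {R : realType}.
Variables (G Q P : R -> R) (L tau a b : R).
Hypothesis L0 : 0 < L.
Hypothesis tau0 : 0 < tau.
Hypothesis lipG : forall x y, `|G x - G y| <= L * `|x - y|.
Hypothesis boundQ : forall x, `|Q x| <= L.
Hypothesis taylorG : forall e : R, 0 < e -> exists2 d : R, 0 < d &
  forall x y, a <= x <= b -> `|y - x| <= d -> `|G y - G x - Q x * (y - x)| <= e * `|y - x|.
Hypothesis cP : continuous P.

(** A motion under the force [k P'], in the variables [x] and [u = x' - k P]
    in which it is continuously differentiable. *)
Definition motion (k : R) (x u : R -> R) : Prop := forall t : R, 0 <= t <= tau ->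
  der x t (u t + k * P t) /\ der u t (- G (x t)).

Variables (X Y : R * R -> R -> R).
Hypothesis X0 : forall z, X z 0 = z.1.
Hypothesis Y0 : forall z, Y z 0 = z.2.
Hypothesis dX : forall z (t : R), der (X z) t (Y z t).
Hypothesis dY : forall z (t : R), der (Y z) t (- G (X z t)).

Definition variational (z : R * R) (w w' : R -> R) : Prop := forall t : R,
  der w t (w' t) /\ der w' t (- (Q (X z t) * w t)).

(** The value of the integral of [P' w] over a period, written without [P']. *)
Definition moment (w w' : R -> R) : R :=
  P tau * w tau - prim (fun t => P t * w' t) tau.

Variables (O D : set (R * R)).
Hypothesis hO : forall z, O z ->
  [/\ forall t : R, 0 <= t <= tau -> a <= X z t <= b, X z tau = z.1 & Y z tau = z.2].
Hypothesis DO : forall z, D z -> exists2 d : R, 0 < d &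
  forall v1 v2, `|v1| + `|v2| <= d -> O (z.1 + v1, z.2 + v2).

Let in1 : 0 <= tau <= tau.
Proof. by rewrite lexx andbT ltW. Qed.

Lemma D_in_O z : D z -> O z.
Proof.
move=> /DO[d d0 /(_ 0 0)]; rewrite normr0 addr0 !addr0 -surjective_pairing; apply.
exact: ltW.
Qed.

Let Cg : R := 2 * expR ((4 * (L + 1) + 2) * tau).

Let Cg0 : 0 < Cg.
Proof. by rewrite mulr_gt0// expR_gt0. Qed.

Lemma force_bound : exists2 B : R, 0 < B & forall t : R, 0 <= t <= tau -> `|P t| <= B.
Proof.
have cn : continuous (fun t => `|P t|) by move=> t; apply: cvg_norm; apply: cP.
have [c _ Hc] := EVT_max (ltW tau0) (continuous_subspaceT cn).
exists (`|P c| + 1); first by rewrite ltr_wpDl.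
by move=> t ht; rewrite ler_wpDr// Hc// in_itv.
Qed.

Lemma variational_bound z w w' : variational z w w' -> `|w 0| + `|w' 0| <= 1 ->
  forall t : R, 0 <= t <= tau -> `|w t| + `|w' t| <= Cg.
Proof.
move=> hw w1 t ht.
have L1 : 0 <= L + 1 by rewrite addr_ge0// ltW.
have := @gronwall R w w' w' (fun t => - (Q (X z t) * w t)) tau (L + 1) 0 L1 (lexx _).
move=> /(_ (fun s _ => (hw s).1) (fun s _ => (hw s).2)) H.
apply: (le_trans (H _ _ _ ht)).
- move=> s _; rewrite addr0 mulrDl mul1r.
  have h1 := normr_ge0 (w s); have h2 := normr_ge0 (w' s).
  have : 0 <= L * (`|w s| + `|w' s|) by rewrite mulr_ge0 ?addr_ge0// ltW.
  lra.
- move=> s _; rewrite addr0 normrN normrM.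
  apply: (@le_trans _ _ (L * `|w s|)); first by rewrite ler_wpM2r.
  by apply: ler_pM => //; [exact: ltW|lra|rewrite lerDl].
- by rewrite addr0 ler_piMr// ltW.
Qed.

Lemma motion_near B k x u z : (forall t : R, 0 <= t <= tau -> `|P t| <= B) -> 0 <= B ->
  motion k x u -> forall t : R, 0 <= t <= tau ->
  `|x t - X z t| + `|u t - Y z t| <= Cg * (`|x 0 - z.1| + `|u 0 - z.2| + `|k| * B).
Proof.
move=> hB B0 hm t ht.
have L1 : 0 <= L + 1 by rewrite addr_ge0// ltW.
have kB : 0 <= `|k| * B by rewrite mulr_ge0.
have := @gronwall R (fun t => x t - X z t) (fun t => u t - Y z t)
  (fun t => u t + k * P t - Y z t) (fun t => - G (x t) - - G (X z t)) tau (L + 1) _ L1 kB.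
move=> /(_ (fun s hs => derB (hm s hs).1 (dX z s)) (fun s hs => derB (hm s hs).2 (dY z s))) H.
rewrite -(X0 z) -(Y0 z); apply: (H _ _ _ ht).
- move=> s hs; have -> : u s + k * P s - Y z s = (u s - Y z s) + k * P s by ring.
  apply: (le_trans (ler_normD _ _)); rewrite lerD//; last by rewrite normrM ler_wpM2l// hB.
  rewrite mulrDl mul1r; have h1 := normr_ge0 (x s - X z s); have h2 := normr_ge0 (u s - Y z s).
  have : 0 <= L * (`|x s - X z s| + `|u s - Y z s|) by rewrite mulr_ge0 ?addr_ge0// ltW.
  lra.
- move=> s hs; rewrite -opprD normrN ler_wpDr//; apply: (le_trans (lipG _ _)).
  by apply: ler_pM => //; [exact: ltW|lra|rewrite lerDl].
Qed.

Let pairing (w w' x u : R -> R) (z : R * R) (t : R) : R :=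
  w' t * (x t - X z t) - w t * (u t - Y z t).

(** The pairing of a variational solution with the difference of a motion and a
    free motion would be constant if that difference satisfied the variational
    equation; it varies by the work of the force, up to second order. *)
Lemma pairing_change (e : R) : 0 < e -> exists2 d : R, 0 < d &
  forall z w w' k x u, O z -> variational z w w' -> `|w 0| + `|w' 0| <= 1 ->
    motion k x u -> `|x 0 - z.1| + `|u 0 - z.2| + `|k| <= d ->
    forall t : R, 0 <= t <= tau ->
    `|pairing w w' x u z t - pairing w w' x u z 0 - k * prim (fun t => P t * w' t) t|
      <= e * (`|x 0 - z.1| + `|u 0 - z.2| + `|k|).
Proof.
move=> e0; have [B B0 hB] := force_bound.
pose c : R := Cg * (1 + B).
have c0 : 0 < c by apply: (mulr_gt0 Cg0); rewrite addr_gt0.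
pose e' : R := e / (Cg * c * tau).
have K0 : 0 < Cg * c * tau by exact: (mulr_gt0 (mulr_gt0 Cg0 c0) tau0).
have [d d0 Hd] := taylorG (divr_gt0 e0 K0 : 0 < e').
exists (d / c); first by rewrite divr_gt0.
move=> z w w' k x u Oz hw w1 hm hs t /andP[t0 tt].
set S := `|x 0 - z.1| + `|u 0 - z.2| + `|k| in hs *.
have S0 : 0 <= S by rewrite !addr_ge0.
have near s : 0 <= s <= tau -> `|x s - X z s| <= c * S.
  move=> hs'; have h := motion_near z hB (ltW B0) hm hs'.
  apply: le_trans (le_trans _ h) _; first by rewrite lerDl.
  rewrite /c -mulrA ler_wpM2l ?(ltW Cg0)// mulrDl mul1r /S.
  have h1 := mulr_ge0 (ltW B0) (normr_ge0 (x 0 - z.1)).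
  have h2 := mulr_ge0 (ltW B0) (normr_ge0 (u 0 - z.2)).
  have h3 := normr_ge0 k.
  by rewrite !mulrDr (mulrC `|k|); lra.
have cw' : continuous w' by move=> s; apply: der_cont (hw s).2.
have cPw : continuous (fun s => P s * w' s) by exact: contM.
pose f s := pairing w w' x u z s - k * prim (fun t => P t * w' t) s.
have df (s : R) : 0 <= s <= t -> der f s (w s * (G (x s) - G (X z s) - Q (X z s) * (x s - X z s))).
  move=> /andP[s0 st]; have hs' : 0 <= s <= tau by rewrite s0 (le_trans st).
  have [h1 h2] := hw s; have [h3 h4] := hm s hs'.
  have h := derB (derB (derM h2 (derB h3 (dX z s))) (derM h1 (derB h4 (dY z s))))
    (derZ k (der_prim s cPw)).
  by apply: der_eq h _; ring.
have bf (s : R) : 0 <= s <= t ->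
    `|w s * (G (x s) - G (X z s) - Q (X z s) * (x s - X z s))| <= Cg * (e' * (c * S)).
  move=> /andP[s0 st]; have hs' : 0 <= s <= tau by rewrite s0 (le_trans st).
  rewrite normrM; apply: ler_pM => //.
    by apply: le_trans (variational_bound hw w1 hs'); rewrite lerDl.
  have [inX _ _] := hO Oz.
  apply: (le_trans (Hd _ _ (inX s hs') _)).
    by apply: (le_trans (near s hs')); rewrite mulrC -ler_pdivlMr.
  by rewrite ler_wpM2l ?near// ltW// divr_gt0.
have := mvt_bound t0 df bf.
rewrite /f prim0// mulr0 subr0 -addrA [- (k * _) - _]addrC addrA.
move=> h; apply: (le_trans h); rewrite subr0.
have -> : Cg * (e' * (c * S)) * t = e * S * (t / tau).
  by rewrite /e'; field; rewrite !gt_eqF.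
by rewrite ler_piMr// ?mulr_ge0 ?(ltW e0)// ler_pdivrMr// mul1r.
Qed.

(** Up to second order, the pairing of a variational solution with the difference
    of two free motions is the same at both ends of the period. All free motions
    having this period, the difference is the same there as well, and its direction
    is arbitrary; hence so is the variational solution. *)
Lemma variational_periodic z w w' : D z -> variational z w w' ->
  `|w 0| + `|w' 0| <= 1 -> w tau = w 0 /\ w' tau = w' 0.
Proof.
move=> Dz hw w1; have Oz := D_in_O Dz; have [_ Xz Yz] := hO Oz.
have [d1 d10 H1] := DO Dz.
have free z' : motion 0 (X z') (Y z').
  by move=> t _; split; [rewrite mul0r addr0|].
have key (e : R) v1 v2 : 0 < e -> `|v1| + `|v2| = 1 ->
    `|(w' tau - w' 0) * v1 - (w tau - w 0) * v2| <= e.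
  move=> e0 v; have [d d0 Hd] := pairing_change e0.
  pose s : R := Num.min d d1.
  have s0 : 0 < s by rewrite lt_min d0.
  have sd : s <= d by rewrite ge_min lexx.
  have sd1 : s <= d1 by rewrite ge_min lexx orbT.
  clearbody s.
  have Es : `|s * v1| + `|s * v2| = s.
    by rewrite !normrM (gtr0_norm s0) -mulrDr v mulr1.
  have Oz' : O (z.1 + s * v1, z.2 + s * v2) by apply: H1; rewrite Es.
  have [_ Xz' Yz'] := hO Oz'.
  have := Hd z w w' 0 _ _ Oz hw w1 (free (z.1 + s * v1, z.2 + s * v2)).
  rewrite X0 Y0 /= [z.1 + _]addrC [z.2 + _]addrC !addrK normr0 addr0 Es => /(_ sd tau in1).
  rewrite /pairing ![_ + z.1]addrC ![_ + z.2]addrC Xz' Yz' Xz Yz !X0 !Y0 /=.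
  rewrite ![z.1 + _]addrC ![z.2 + _]addrC !addrK mul0r subr0.
  have -> : w' tau * (s * v1) - w tau * (s * v2) - (w' 0 * (s * v1) - w 0 * (s * v2)) =
    s * ((w' tau - w' 0) * v1 - (w tau - w 0) * v2) by ring.
  by rewrite normrM (gtr0_norm s0) mulrC ler_pM2r.
split; apply/eqP; rewrite -subr_eq0 -normr_le0; apply/ler_addgt0Pr => e e0; rewrite add0r.
  have := key e 0 1 e0; rewrite normr0 add0r normr1 => /(_ erefl).
  by rewrite mulr0 sub0r normrN mulr1.
have := key e 1 0 e0; rewrite normr0 addr0 normr1 => /(_ erefl).
by rewrite mulr0 subr0 mulr1.
Qed.

Hypothesis hpsi : forall z, D z -> exists p p' q q' : R -> R,
  [/\ variational z p p', variational z q q', (p 0, p' 0) = (1, 0),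
      (q 0, q' 0) = (0, 1) & (moment p p', moment q q') != 0].

(** The displacement of the perturbed motion over one period is read from its
    pairings with the two normalized variational solutions, which are periodic. The
    Hamiltonian is the mean of the perturbation along free motions. *)
Theorem period_map_expansion : exists h F1 F2 : R * R -> R,
  [/\ hamiltonian_on D h F1 F2, forall z, D z -> (F1 z, F2 z) != 0 &
    forall eta : R, 0 < eta -> exists2 d : R, 0 < d &
      forall z k x u, D z -> `|k| <= d -> motion k x u -> x 0 = z.1 -> u 0 = z.2 ->
        `|x tau - z.1 - k * F1 z| <= eta * `|k| /\
        `|u tau + k * P tau - z.2 - k * F2 z| <= eta * `|k|].
Proof.
have /choice[pq Hpq] : forall z, exists pq : ((R -> R) * (R -> R)) * ((R -> R) * (R -> R)),
  D z -> [/\ variational z pq.1.1 pq.1.2, variational z pq.2.1 pq.2.2,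
     (pq.1.1 0, pq.1.2 0) = (1, 0), (pq.2.1 0, pq.2.2 0) = (0, 1) &
     (moment pq.1.1 pq.1.2, moment pq.2.1 pq.2.2) != 0].
  move=> z; have [Dz|nDz] := pselect (D z); last by exists ((id, id), (id, id)).
  by have [p [p' [q [q' H]]]] := hpsi Dz; exists ((p, p'), (q, q')).
pose p z := (pq z).1.1; pose p' z := (pq z).1.2.
pose q z := (pq z).2.1; pose q' z := (pq z).2.2.
pose F1 z := - moment (q z) (q' z); pose F2 z := moment (p z) (p' z).
pose h z := moment (X z) (Y z).
have norm1 z : D z -> `|p z 0| + `|p' z 0| <= 1 /\ `|q z 0| + `|q' z 0| <= 1.
  move=> /Hpq[_ _ [e1 e2] [e3 e4] _].
  by rewrite /p /p' /q /q' e1 e2 e3 e4 normr0 normr1 addr0 add0r.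
exists h, F1, F2; split.
- move=> e e0; have [B B0 hB] := force_bound.
  pose e1 : R := e / (2 * Cg * B * (1 + tau)).
  have K0 : 0 < 2 * Cg * B * (1 + tau).
    by apply: mulr_gt0; [exact: (mulr_gt0 (mulr_gt0 (ltr0Sn _ 1) Cg0) B0)|rewrite addr_gt0].
  have e10 : 0 < e1 by rewrite divr_gt0.
  have [d d0 Hd] := pairing_change e10.
  exists d => // z Dz v1 v2 hv; have Oz := D_in_O Dz.
  have [hp hq [p0 p'0] [q00 q'0] _] := Hpq z Dz; have [np nq] := norm1 z Dz.
  rewrite -/(p z) -/(p' z) -/(q z) -/(q' z) in hp hq p0 p'0 q00 q'0.
  set z' := (z.1 + v1, z.2 + v2).
  have free : motion 0 (X z') (Y z').
    by move=> t _; split; [rewrite mul0r addr0|].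
  have Es : `|X z' 0 - z.1| + `|Y z' 0 - z.2| + `|0 : R| = `|v1| + `|v2|.
    by rewrite X0 Y0 /z' /= [z.1 + _]addrC [z.2 + _]addrC !addrK normr0 addr0.
  have E1 : X z' 0 - X z 0 = v1 by rewrite !X0 /z' /= [z.1 + _]addrC addrK.
  have E2 : Y z' 0 - Y z 0 = v2 by rewrite !Y0 /z' /= [z.2 + _]addrC addrK.
  have Wp (t : R) : 0 <= t <= tau -> `|pairing (p z) (p' z) (X z') (Y z') z t + v2| <=
      e1 * (`|v1| + `|v2|).
    move=> ht; have := Hd z _ _ 0 _ _ Oz hp np free; rewrite Es => /(_ hv t ht).
    by rewrite {2}/pairing E1 E2 p0 p'0 !mul0r mul1r sub0r opprK subr0.
  have Wq (t : R) : 0 <= t <= tau -> `|pairing (q z) (q' z) (X z') (Y z') z t - v1| <=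
      e1 * (`|v1| + `|v2|).
    move=> ht; have := Hd z _ _ 0 _ _ Oz hq nq free; rewrite Es => /(_ hv t ht).
    by rewrite {2}/pairing E1 E2 q00 q'0 !mul0r mul1r !subr0.
  have wron (t : R) : p z t * q' z t - p' z t * q z t = 1.
    have dW (s : R) : der (fun s => p z s * q' z s - p' z s * q z s) s 0.
      have [h1 h2] := hp s; have [h3 h4] := hq s.
      by apply: der_eq (derB (derM h1 h4) (derM h2 h3)) _; ring.
    by rewrite (der0_const dW t 0) p0 p'0 q00 q'0; ring.
  set r := `|v1| + `|v2| in Wp Wq *.
  have r0 : 0 <= r by rewrite addr_ge0.
  have comb (A B' C' D' y1 y2 : R) : `|A| + `|C'| <= Cg -> `|B'| + `|D'| <= Cg ->
      `|y1| <= e1 * r -> `|y2| <= e1 * r -> `|A * y1 - B' * y2| <= 2 * Cg * e1 * r.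
    move=> hA hB' h1 h2; apply: (le_trans (ler_normB _ _)); rewrite !normrM.
    have k1 : `|A| * `|y1| <= Cg * (e1 * r).
      by apply: ler_pM => //; apply: le_trans hA; rewrite lerDl.
    have k2 : `|B'| * `|y2| <= Cg * (e1 * r).
      by apply: ler_pM => //; apply: le_trans hB'; rewrite lerDl.
    by lra.
  have bp (t : R) (ht : 0 <= t <= tau) := variational_bound hp np ht.
  have bq (t : R) (ht : 0 <= t <= tau) := variational_bound hq nq ht.
  have dxi (t : R) : 0 <= t <= tau ->
      `|X z' t - X z t - (p z t * v1 + q z t * v2)| <= 2 * Cg * e1 * r.
    move=> ht; have -> : X z' t - X z t - (p z t * v1 + q z t * v2) =
       p z t * (pairing (q z) (q' z) (X z') (Y z') z t - v1)
       - q z t * (pairing (p z) (p' z) (X z') (Y z') z t + v2).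
      transitivity ((p z t * q' z t - p' z t * q z t) * (X z' t - X z t)
         - (p z t * v1 + q z t * v2)); first by rewrite wron mul1r.
      by rewrite /pairing; ring.
    exact: comb (bp t ht) (bq t ht) (Wq t ht) (Wp t ht).
  have deta (t : R) : 0 <= t <= tau ->
      `|Y z' t - Y z t - (p' z t * v1 + q' z t * v2)| <= 2 * Cg * e1 * r.
    move=> ht; have -> : Y z' t - Y z t - (p' z t * v1 + q' z t * v2) =
       p' z t * (pairing (q z) (q' z) (X z') (Y z') z t - v1)
       - q' z t * (pairing (p z) (p' z) (X z') (Y z') z t + v2).
      transitivity ((p z t * q' z t - p' z t * q z t) * (Y z' t - Y z t)
         - (p' z t * v1 + q' z t * v2)); first by rewrite wron mul1r.
      by rewrite /pairing; ring.
    have b1 := bp t ht; have b2 := bq t ht; rewrite addrC in b1; rewrite addrC in b2.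
    exact: comb b1 b2 (Wq t ht) (Wp t ht).
  have cc (f : R -> R) (f' : R -> R) : (forall t : R, der f t (f' t)) ->
      continuous (fun t => P t * f t).
    by move=> df; apply: contM cP _; exact: cont_der df.
  have cY w := cc _ _ (dY w).
  have cp' := cc _ _ (fun t => (hp t).2); have cq' := cc _ _ (fun t => (hq t).2).
  pose f (t : R) := prim (fun s => P s * Y z' s) t - prim (fun s => P s * Y z s) t -
    (v1 * prim (fun s => P s * p' z s) t + v2 * prim (fun s => P s * q' z s) t).
  have df (t : R) : 0 <= t <= tau ->
      der f t (P t * (Y z' t - Y z t - (p' z t * v1 + q' z t * v2))).
    move=> _; apply: der_eq (derB (derB (der_prim t (cY z')) (der_prim t (cY z)))
      (derD (derZ v1 (der_prim t cp')) (derZ v2 (der_prim t cq')))) _.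
    by ring.
  have bfd (t : R) : 0 <= t <= tau ->
      `|P t * (Y z' t - Y z t - (p' z t * v1 + q' z t * v2))| <= B * (2 * Cg * e1 * r).
    by move=> ht; rewrite normrM; apply: ler_pM => //; [exact: hB|exact: deta].
  have := mvt_bound (ltW tau0) df bfd.
  rewrite {2}/f !prim0// !mulr0 addr0 !subr0 => k1.
  have k2 : `|P tau * (X z' tau - X z tau - (p z tau * v1 + q z tau * v2))| <=
      B * (2 * Cg * e1 * r).
    by rewrite normrM; apply: ler_pM => //; [exact: hB|exact: dxi].
  have -> : h z' - h z - (F2 z * v1 - F1 z * v2) =
     P tau * (X z' tau - X z tau - (p z tau * v1 + q z tau * v2)) - f tau.
    by rewrite /h /F1 /F2 /moment /f; ring.
  apply: (le_trans (ler_normB _ _)); apply: (le_trans (lerD k2 k1)).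
  have -> : B * (2 * Cg * e1 * r) + B * (2 * Cg * e1 * r) * tau = e * r.
    by rewrite /e1; field; rewrite !gt_eqF// addr_gt0.
  exact: lexx.
- move=> z Dz; have [_ _ _ _] := Hpq z Dz.
  rewrite -/(p z) -/(p' z) -/(q z) -/(q' z) !xpair_eqE /F1 /F2 oppr_eq0.
  by rewrite andbC.
- move=> eta eta0; have [d d0 Hd] := pairing_change eta0.
  exists d => // z k x u Dz kd hm x0 u0.
  have Oz := D_in_O Dz; have [_ Xz Yz] := hO Oz.
  have [hp hq [p0 p'0] [q00 q'0] _] := Hpq z Dz; have [np nq] := norm1 z Dz.
  rewrite -/(p z) -/(p' z) -/(q z) -/(q' z) in hp hq p0 p'0 q00 q'0.
  have [pt p't] := variational_periodic Dz hp np.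
  have [qt q't] := variational_periodic Dz hq nq.
  have Es : `|x 0 - z.1| + `|u 0 - z.2| + `|k| = `|k|.
    by rewrite x0 u0 !subrr normr0 !add0r.
  have Hp := Hd z _ _ k _ _ Oz hp np hm; rewrite Es in Hp.
  have Hq := Hd z _ _ k _ _ Oz hq nq hm; rewrite Es in Hq.
  move: (Hp kd tau in1) (Hq kd tau in1).
  rewrite /pairing pt p't qt q't p0 p'0 q00 q'0 X0 Y0 Xz Yz x0 u0 !subrr !mulr0 !mul0r !mul1r.
  rewrite !subr0 sub0r => Hp1 Hq1.
  split.
    have -> : x tau - z.1 - k * F1 z = x tau - z.1 - k * prim (fun t => P t * q' z t) tau.
      by rewrite /F1 /moment qt q00; ring.
    exact: Hq1.
  have -> : u tau + k * P tau - z.2 - k * F2 z =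
    - (- (u tau - z.2) - k * prim (fun t => P t * p' z t) tau).
    by rewrite /F2 /moment pt p0; ring.
  by rewrite normrN.
Qed.

End OnePeriod.

(** * Translation of Lebesgue integrals *)

Section Translation.
Context {R : realType}.
Local Notation mu := (@lebesgue_measure R).
Local Notation shiftby c := ((fun x : R => x + c) : measurableTypeR R -> measurableTypeR R).

Lemma shift_preimage_itv (c a b : R) (l r : bool) :
  (fun x : R => x + c) @^-1` [set` Interval (BSide l (a + c)) (BSide r (b + c))] =
  [set` Interval (BSide l a) (BSide r b)].
Proof.
apply/seteqP; split=> x /=; rewrite !in_itv /=;
  by case: l; case: r => /=; rewrite ?lerD2r ?ltrD2r.
Qed.

Lemma measurable_shift (c : R) : measurable_fun setT (shiftby c).
Proof. by apply: continuous_measurable_fun; apply: contD; [move=> x; exact: cvg_id|exact: cont_cst]. Qed.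

Lemma lebesgue_measure_shift (c : R) (A : set R) : measurable A ->
  pushforward mu (shiftby c) A = mu A.
Proof.
move=> mA; apply/esym/lebesgue_measure_unique => //=; first exact: measurable_shift.
move=> _ _ [[a b]] _ <-.
rewrite /pushforward /=.
have -> : (fun x : R => x + c) @^-1` `]a, b] = `]a - c, b - c].
  by rewrite -[RHS](@shift_preimage_itv c) !subrK.
rewrite !lebesgue_measure_itv/= !lte_fin ltrD2r.
by case: ifP => // _; rewrite -!EFinB opprB addrA subrK.
Qed.

Lemma integral_shift (f : R -> R) (a b c : R) :
  mu.-integrable `[a + c, b + c] (EFin \o f) ->
  mu.-integrable `[a, b] (EFin \o (fun x => f (x + c))) /\
  \int[mu]_(x in `[a, b]) f (x + c) = \int[mu]_(x in `[a + c, b + c]) f x.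
Proof.
move=> intf; set D := `[a + c, b + c]%classic.
have mD : measurable D by exact: measurable_itv.
have pre : (shiftby c) @^-1` D = `[a, b]%classic by exact: shift_preimage_itv.
pose g := (EFin \o f) \_ D.
have intg : mu.-integrable setT g.
  exact: ((integrable_mkcond (mu := mu) (EFin \o f) mD).1 intf).
have mg : measurable_fun setT g by exact: measurable_int intg.
have intg2 : mu.-integrable ((shiftby c) @^-1` D) (g \o shiftby c).
  apply/integrableP; split.
    by apply: measurable_funTS; apply: (measurableT_comp mg (measurable_shift c)).
  have -> : (\int[mu]_(x in shiftby c @^-1` D) `|(g \o shiftby c) x| =
      \int[mu]_(x in D) `|g x|)%E.
    rewrite -(@ge0_integral_pushforward _ _ _ _ _ _ (measurable_shift c) mu D (abse \o g))//=.
    - by apply: eq_measure_integral => [|ms A mA _]; [exact: measurable_shift|exact: lebesgue_measure_shift].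
    - by apply: measurable_funTS; exact: measurableT_comp.
  have /integrableP[_] : mu.-integrable D g by exact: integrableS intg.
  by [].
have gE x : D (x + c) -> g (x + c) = (f (x + c))%:E.
  by move=> Dx; rewrite /g patchE mem_set.
split.
  rewrite -pre; apply: eq_integrable intg2 => //.
    by rewrite pre; exact: measurable_itv.
  by move=> x; rewrite inE => Dx; rewrite /= gE.
rewrite /Rintegral; congr fine; rewrite -pre.
transitivity (\int[mu]_(x in shiftby c @^-1` D) (g \o shiftby c) x)%E.
  by apply: eq_integral => x; rewrite inE => Dx; rewrite /= gE.
rewrite -(integral_pushforward (measurable_shift c) mg intg2 mD).
transitivity (\int[mu]_(x in D) g x)%E.
  by apply: eq_measure_integral => [|ms A mA _]; [exact: measurable_shift|exact: lebesgue_measure_shift].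
by apply: eq_integral => x xD; rewrite /g patchE xD.
Qed.

End Translation.

(** * The primitive of a periodic integrable function *)

Section LebesguePrimitive.
Context {R : realType}.
Local Notation mu := (@lebesgue_measure R).

Lemma integrable_adjacent (f : R -> R) (a b c : R) : a <= b -> b <= c ->
  mu.-integrable `[a, b] (EFin \o f) -> mu.-integrable `[b, c] (EFin \o f) ->
  mu.-integrable `[a, c] (EFin \o f).
Proof.
move=> ab bc i1 i2.
have i3 : mu.-integrable `]b, c] (EFin \o f).
  by apply: integrableS i2 => //; exact: subset_itv_oc_cc.
have -> : `[a, c]%classic = `[a, b]%classic `|` `]b, c]%classic.
  by rewrite -itv_bndbnd_setU// bnd_simp.
have /integrableP[m1 f1] := i1; have /integrableP[m3 f3] := i3.
have mU : measurable_fun (`[a, b]%classic `|` `]b, c]%classic) (EFin \o f).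
  by apply/measurable_funU => //; exact: measurable_itv.
apply/integrableP; split => //.
rewrite ge0_integral_setU//=.
- exact: lte_add_pinfty.
- by apply/measurable_EFinP; apply: measurableT_comp => //; exact/measurable_EFinP.
- apply/disj_setPS => u /= []; rewrite !in_itv /= => /andP[_ h] /andP[h2 _].
  by move: (le_lt_trans h h2); rewrite ltxx.
Qed.

Variables (p : R -> R) (tau : R).
Hypothesis tau0 : 0 < tau.
Hypothesis per : periodic p tau.
Hypothesis intp : mu.-integrable `[0, tau] (EFin \o p).

Lemma integrable_sub (f : R -> R) (a b c d : R) : a <= c -> d <= b ->
  mu.-integrable `[a, b] (EFin \o f) -> mu.-integrable `[c, d] (EFin \o f).
Proof.
move=> ac db; apply: integrableS => //.
by move=> x /=; rewrite !in_itv /= => /andP[h1 h2]; rewrite (le_trans ac h1) (le_trans h2 db).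
Qed.

Lemma integrable_periods (n : nat) : mu.-integrable `[0, n%:R * tau] (EFin \o p).
Proof.
elim: n => [|n IH].
  by rewrite mul0r; apply: integrable_sub intp => //; exact: ltW.
have nt : 0 <= n%:R * tau by rewrite mulr_ge0// ltW.
have nt2 : n%:R * tau <= n.+1%:R * tau by rewrite ler_wpM2r ?ler_nat// ltW.
apply: (integrable_adjacent nt nt2 IH).
have E1 : 0 = n%:R * tau + - (n%:R * tau) by rewrite subrr.
have E2 : tau = n.+1%:R * tau + - (n%:R * tau) by rewrite -natr1; ring.
have h : mu.-integrable `[n%:R * tau + - (n%:R * tau), n.+1%:R * tau + - (n%:R * tau)] (EFin \o p).
  by rewrite -E1 -E2.
have [h' _] := integral_shift h.
apply: eq_integrable h' => // x _ /=; congr (_%:E).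
by rewrite -[LHS](periodicn per n) -(mulr_natl tau) subrK.
Qed.

Lemma integrable_half_line (a b : R) : 0 <= a -> mu.-integrable `[a, b] (EFin \o p).
Proof.
move=> a0; apply: integrable_sub (integrable_periods (Num.truncn (b / tau)).+1) => //.
by rewrite -ler_pdivrMr// ltW// truncnS_gt.
Qed.

Definition primL (t : R) : R := \int[mu]_(x in `[0, t]) p x.
Definition primL_abs (t : R) : R := \int[mu]_(x in `[0, t]) `|p x|.

Lemma integrable_norm_half_line (a b : R) : 0 <= a ->
  mu.-integrable `[a, b] (EFin \o (fun x => `|p x|)).
Proof. by move=> a0; have := integrable_norm (integrable_half_line b a0). Qed.

Lemma primL_lt0 (t : R) : t < 0 -> primL t = 0.
Proof. by move=> t0; rewrite /primL set_itv_ge ?Rintegral_set0// bnd_simp -ltNge. Qed.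

Lemma primL0 : primL 0 = 0.
Proof. by rewrite /primL set_itv1 Rintegral_set1. Qed.

Lemma Rintegral_segmentB (f : R -> R) (s t : R) : 0 <= s -> s <= t ->
  mu.-integrable `[0, t] (EFin \o f) ->
  \int[mu]_(x in `[0, t]) f x - \int[mu]_(x in `[0, s]) f x = \int[mu]_(x in `]s, t]) f x.
Proof. by move=> s0 st h; apply: Rintegral_itvB => //; rewrite bnd_simp. Qed.

Lemma primLB (s t : R) : 0 <= s -> s <= t ->
  primL t - primL s = \int[mu]_(x in `]s, t]) p x.
Proof. by move=> s0 st; apply: Rintegral_segmentB => //; exact: integrable_half_line. Qed.

Lemma primL_absB (s t : R) : 0 <= s -> s <= t ->
  primL_abs t - primL_abs s = \int[mu]_(x in `]s, t]) `|p x|.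
Proof.
by move=> s0 st; apply: Rintegral_segmentB => //; exact: integrable_norm_half_line.
Qed.

Lemma integrable_oc (f : R -> R) (s t : R) : mu.-integrable `[s, t] (EFin \o f) ->
  mu.-integrable `]s, t] (EFin \o f).
Proof. by move=> h; apply: integrableS h => //; exact: subset_itv_oc_cc. Qed.

Lemma primL_le (s t : R) : 0 <= s -> s <= t ->
  `|primL t - primL s| <= primL_abs t - primL_abs s.
Proof.
move=> s0 st; rewrite primLB// primL_absB//; apply: le_normr_Rintegral => //.
by apply: integrable_oc; exact: integrable_half_line.
Qed.

Lemma primL_abs_mono (s t : R) : 0 <= s -> s <= t -> primL_abs s <= primL_abs t.
Proof.
by move=> s0 st; rewrite -subr_ge0 primL_absB//; apply: Rintegral_ge0.
Qed.

Lemma primL_period (t : R) : 0 <= t -> primL (t + tau) = primL t + primL tau.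
Proof.
move=> t0; apply/eqP; rewrite -subr_eq; apply/eqP.
rewrite primLB ?(ltW tau0) ?lerDr//.
have it : mu.-integrable `[0 + tau, t + tau] (EFin \o p).
  by rewrite add0r; apply: integrable_half_line; exact: ltW.
have [_ E] := integral_shift it.
rewrite Rintegral_itv_obnd_cbnd; last first.
  by apply: integrable_oc; apply: integrable_half_line; exact: ltW.
rewrite add0r in E; rewrite -E /primL.
by apply: eq_Rintegral => x _; exact: per.
Qed.

Lemma primL_periods (n : nat) (t : R) : 0 <= t ->
  primL (t + n%:R * tau) = primL t + primL (n%:R * tau).
Proof.
elim: n => [|n IH] t0; first by rewrite mul0r primL0 !addr0.
have nt : 0 <= n%:R * tau by rewrite mulr_ge0// ltW.
rewrite -natr1 mulrDl mul1r addrA !primL_period//; last by rewrite addr_ge0.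
by rewrite IH// addrA.
Qed.

(** Absolute continuity of the primitive is that of the integral of [`|p|] as a
    function of the set. *)
Lemma primL_absolutely_continuous (T : R) : absolutely_continuous 0 T primL.
Proof.
move=> e e0.
pose f := p \_ `[0, T].
have intf : mu.-integrable setT (EFin \o f).
  rewrite /f -restrict_EFin.
  exact: ((integrable_mkcond (mu := mu) (EFin \o p) (measurable_itv _)).1
    (integrable_half_line T (lexx 0))).
have [d [d0 Hd]] := integral_normr_continuous intf e0.
exists d => // n u v huv triv sd.
pose A : set R := \big[setU/set0]_(i < n) `]u i, v i[%classic.
have mA : measurable A by apply: bigsetU_measurable => i _; exact: measurable_itv.
have h1 : (mu A < d%:E)%E.
  rewrite /A measure_bigsetU_ord//.
  have -> : (\sum_(i < n) mu `]u i, v i[%classic = (\sum_(i < n) (v i - u i))%:E)%E.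
    rewrite -sumEFin; apply: eq_bigr => i _; have [_ uv _] := huv i.
    rewrite lebesgue_measure_itv /= lte_fin; case: ltP => // vu.
    by have -> : v i = u i; [apply/eqP; rewrite eq_le vu uv|rewrite subrr].
  by rewrite lte_fin.
apply: le_lt_trans (Hd A mA h1).
have intA (B : set R) : measurable B -> mu.-integrable B (EFin \o (fun x => `|f x|)).
  by move=> mB; apply: integrableS (integrable_norm intf).
rewrite /Rintegral /A integral_bigsetU_EFin//; last 3 first.
- exact: index_enum_uniq.
- by apply: sub_trivIset triv.
- exact: measurable_int (intA _ mA).
have fin i : (\int[mu]_(x in `]u i, v i[) `|f x|%:E)%E \is a fin_num.
  apply: integrable_fin_num => //; exact: intA.
rewrite -sum_fine//.
apply: ler_sum => i _; have [u0 uv vT] := huv i.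
apply: (le_trans (primL_le u0 uv)); rewrite primL_absB//.
rewrite -Rintegral_itv_bndo_bndc; last first.
  apply: integrableS (integrable_norm_half_line (v i) u0) => // x /=.
  by rewrite !in_itv /= => /andP[/ltW -> /ltW ->].
rewrite le_eqVlt; apply/orP; left; apply/eqP; apply: eq_Rintegral => x.
rewrite inE /= in_itv /= => /andP[ux xv]; rewrite /f patchE mem_set//=.
by rewrite in_itv /=; apply/andP; split; lra.
Qed.

Lemma primL_cont : continuous primL.
Proof.
move=> t; apply/cvgrPdist_lt => e e0.
have [d d0 Hd] := primL_absolutely_continuous (`|t| + 1) e0.
have key (s r : R) : s <= r -> r <= `|t| + 1 -> r - s < d -> `|primL r - primL s| < e.
  move=> sr rt rs.
  have max0 (x : R) : primL x = primL (Order.max x 0).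
    by have [x0|//] := ltP x 0; rewrite primL_lt0// primL0.
  rewrite max0 (max0 s).
  have := Hd 1%N (fun=> Order.max s 0) (fun=> Order.max r 0).
  rewrite !big_ord_recl !big_ord0 !addr0; apply.
  - move=> _; split.
    + by rewrite le_max lexx orbT.
    + by rewrite ge_max !le_max lexx sr orbT.
    + by rewrite ge_max rt addr_ge0.
  - by apply/trivIsetP => i j _ _; rewrite !ord1 eqxx.
  - by move: rs; rewrite /Order.max; do !case: ifP; lra.
have n1 : \forall s \near t, `|t - s| < Num.min 1 d.
  have m0 : 0 < Num.min 1 d by rewrite lt_min ltr01.
  by have /cvgrPdist_lt/(_ _ m0) := @cvg_id _ (nbhs t).
apply: filterS n1 => s; rewrite lt_min => /andP[ts td].
have tt := ler_norm t.
rewrite !ltr_norml in ts td; move: ts td => /andP[a1 a2] /andP[a3 a4].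
have [st|st] := leP s t; first by apply: (key s t) => //; lra.
by rewrite distrC; apply: (key t s); lra.
Qed.

Lemma primL_derive (T : R) :
  {ae mu, forall t : R, 0 < t < T -> is_derive t (1 : R) primL (p t)}.
Proof.
pose f := p \_ `[0, T].
have intf : mu.-integrable setT (EFin \o f).
  rewrite /f -restrict_EFin.
  exact: ((integrable_mkcond (mu := mu) (EFin \o p) (measurable_itv _)).1
    (integrable_half_line T (lexx 0))).
have H := @FTC1 R f (BLeft 0) _ (open_integrable_locally openT intf).
have iy (y : R) : mu.-integrable `[0, y] (EFin \o f) by apply: integrableS intf.
have {}H := H iy.
move: H; apply: filterS; first exact: (ae_filter_ringOfSetsType mu).
move=> t Ht /andP[t0 tT].
have [|d1 d2] := Ht; first by rewrite lte_fin.
have -> : p t = f t by rewrite /f patchE mem_set//= in_itv /= !ltW.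
rewrite -d2; apply: (der_near _ (derivable_der d1)).
have : \forall s \near t, s < T by exact: lt_nbhsl.
apply: filterS => s sT; apply: eq_Rintegral => x; rewrite inE /= in_itv /= => /andP[x0 xs].
by rewrite /f patchE mem_set//= in_itv /= x0 (le_trans xs)// ltW.
Qed.

(** Integration by parts, with an integrable factor: on short intervals the
    defect is the length times the integral of [`|p|]. *)
Lemma primL_by_parts (w w' : R -> R) (T : R) : 0 < T ->
  (forall t : R, der w t (w' t)) -> continuous w' ->
  mu.-integrable `[0, T] (EFin \o (fun x => p x * w x)) /\
  \int[mu]_(x in `[0, T]) (p x * w x) =
    primL T * w T - prim (fun t => primL t * w' t) T.
Proof.
move=> T0 dw cw'; have cw := cont_der dw.
have [C C0 HC] : exists2 C : R, 0 <= C & forall t, 0 <= t <= T -> `|w' t| <= C.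
  have cn : continuous (fun t => `|w' t|) by move=> t; apply: cvg_norm; apply: cw'.
  have [c _ Hc] := EVT_max (ltW T0) (continuous_subspaceT cn).
  by exists (`|w' c|) => // t ht; apply: Hc; rewrite in_itv.
have iw (s t : R) (g : R -> R) : 0 <= s -> continuous g ->
    mu.-integrable `[s, t] (EFin \o (fun x => p x * g x)).
  move=> s0 cg; have mg : measurable_fun `[s, t] g.
    by apply: measurable_funTS; exact: continuous_measurable_fun.
  apply: (integrableMl _ (integrable_half_line t s0) mg); first exact: measurable_itv.
  have [M [Mr HM]] := compact_bounded (continuous_compact (continuous_subspaceT cg) (@segment_compact _ s t)).
  by exists M; split=> // N MN x hx; apply: (HM N MN); exists x.
split; first exact: iw.
have cPw : continuous (fun t => primL t * w' t) by apply: contM => //; exact: primL_cont.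
pose f (t : R) := \int[mu]_(x in `[0, t]) (p x * w x) -
  (primL t * w t - prim (fun s => primL s * w' s) t).
have step (s t : R) : 0 <= s -> s <= t -> t <= T ->
    `|f t - f s| <= 2 * C * (t - s) * (primL_abs t - primL_abs s).
  move=> s0 st tT.
  have m0 : 0 <= primL_abs t - primL_abs s by rewrite subr_ge0 primL_abs_mono.
  have win (r : R) : s <= r -> r <= t -> `|w r - w s| <= C * (t - s).
    move=> sr rt.
    have h : `|w r - w s| <= C * (r - s).
      apply: (mvt_bound sr (fun x _ => dw x)) => x /andP[sx xr].
      by apply: HC; rewrite (le_trans s0 sx) (le_trans xr (le_trans rt tT)).
    by apply: (le_trans h); rewrite ler_wpM2l// lerD2r.
  have E : f t - f s = \int[mu]_(x in `]s, t]) (p x * (w x - w s)) -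
     ((primL t * w t - prim (fun s => primL s * w' s) t) -
      (primL t * w s - prim (fun s => primL s * w' s) s)).
    have e1 : \int[mu]_(x in `[0, t]) (p x * w x) - \int[mu]_(x in `[0, s]) (p x * w x) =
       \int[mu]_(x in `]s, t]) (p x * w x).
      by apply: Rintegral_segmentB => //; exact: iw.
    have e2 : \int[mu]_(x in `]s, t]) (p x * (w x - w s)) =
       \int[mu]_(x in `]s, t]) (p x * w x) - (primL t - primL s) * w s.
      rewrite primLB// -RintegralZr//; last first.
        by apply: integrable_oc; exact: integrable_half_line.
      rewrite -RintegralB//.
      - by apply: eq_Rintegral => x _; rewrite mulrBr.
      - by apply: integrable_oc; exact: iw.
      - by apply: integrable_oc; apply: (iw _ _ (fun=> w s)) => //; exact: cont_cst.
    by rewrite e2 -e1 /f; ring.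
  have b1 : `|\int[mu]_(x in `]s, t]) (p x * (w x - w s))| <=
      C * (t - s) * (primL_abs t - primL_abs s).
    have i1 : mu.-integrable `]s, t] (EFin \o (fun x => p x * (w x - w s))).
      by apply: integrable_oc; apply: iw => //; apply: contB => //; exact: cont_cst.
    apply: (le_trans (le_normr_Rintegral _ i1)); first exact: measurable_itv.
    have i2 : mu.-integrable `]s, t] (EFin \o (fun x => `|p x|)).
      by apply: integrable_oc; exact: integrable_norm_half_line.
    rewrite primL_absB// -RintegralZl//.
    apply: le_Rintegral => //.
    - exact: integrable_norm i1.
    - exact: integrableZl i2.
    - move=> x /=; rewrite in_itv /= => /andP[sx xt].
      by rewrite normrM mulrC ler_wpM2r// win// ltW.
  have b2 : `|(primL t * w t - prim (fun s => primL s * w' s) t) -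
      (primL t * w s - prim (fun s => primL s * w' s) s)| <=
      (primL_abs t - primL_abs s) * C * (t - s).
    apply: (@mvt_bound R (fun r => primL t * w r - prim (fun s => primL s * w' s) r)
      (fun r => (primL t - primL r) * w' r)) => // r /andP[sr rt].
      by apply: der_eq (derB (derZ (primL t) (dw r)) (der_prim r cPw)) _; rewrite mulrBl.
    rewrite normrM; apply: ler_pM => //.
      apply: (le_trans (primL_le (le_trans s0 sr) rt)).
      by rewrite lerD2l lerN2 primL_abs_mono.
    by apply: HC; rewrite (le_trans s0 sr) (le_trans rt tT).
  rewrite E; apply: (le_trans (ler_normB _ _)).
  by apply: (le_trans (lerD b1 b2)); rewrite le_eqVlt; apply/orP; left; apply/eqP; ring.
have f0 : f 0 = 0.
  by rewrite /f set_itv1 Rintegral_set1 primL0 mul0r prim0// !subrr.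
suff : f T = 0 by move=> /eqP; rewrite subr_eq0 => /eqP.
pose M := primL_abs T - primL_abs 0.
have M0 : 0 <= M by rewrite subr_ge0 primL_abs_mono// ltW.
have sub (n k : nat) (s : R) : (0 < n)%N -> s = T / n%:R -> (k <= n)%N ->
    `|f (k%:R * s)| <= 2 * C * s * (primL_abs (k%:R * s) - primL_abs 0).
  move=> n0 sE kn; have s0 : 0 <= s by rewrite sE divr_ge0// ltW.
  elim: k kn => [_|k IH kn]; first by rewrite mul0r f0 normr0 subrr mulr0.
  have h1 : 0 <= k%:R * s by rewrite mulr_ge0.
  have h2 : k%:R * s <= k.+1%:R * s by rewrite ler_wpM2r// ler_nat.
  have h3 : k.+1%:R * s <= T.
    by rewrite sE mulrA ler_pdivrMr ?ltr0n// mulrC ler_wpM2l ?ler_nat// ltW.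
  have := step _ _ h1 h2 h3; have := IH (ltnW kn).
  rewrite (_ : k.+1%:R * s - k%:R * s = s); last by rewrite -natr1; ring.
  have := ler_normD (f (k.+1%:R * s) - f (k%:R * s)) (f (k%:R * s)).
  rewrite subrK !mulrBr; lra.
apply/eqP; rewrite -normr_le0; apply/ler_addgt0Pr => e e0; rewrite add0r.
pose n := (Num.truncn (2 * C * T * M / e)).+1.
have n0 : (0 < n)%N by [].
have nR : n%:R != 0 :> R by rewrite pnatr_eq0.
have := sub n n _ n0 erefl (leqnn n); rewrite (_ : n%:R * (T / n%:R) = T); last by rewrite mulrC divfK.
move=> h; apply: (le_trans h); rewrite -/M.
have -> : 2 * C * (T / n%:R) * M = 2 * C * T * M / n%:R by field.
by rewrite ler_pdivrMr ?ltr0n// [e * _]mulrC -ler_pdivrMr//; apply: ltW; exact: truncnS_gt.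
Qed.

End LebesguePrimitive.

(** * Absolutely continuous functions *)

Section AbsoluteContinuity.
Context {R : realType}.

Lemma absolutely_continuousD (a b : R) (f g : R -> R) : absolutely_continuous a b f ->
  absolutely_continuous a b g -> absolutely_continuous a b (fun t => f t + g t).
Proof.
move=> hf hg e e0; have e2 : 0 < e / 2 by rewrite divr_gt0.
have [d1 d10 H1] := hf _ e2; have [d2 d20 H2] := hg _ e2.
exists (Num.min d1 d2); first by rewrite lt_min d10.
move=> n u v uv tr; rewrite lt_min => /andP[s1 s2].
have h1 := H1 n u v uv tr s1; have h2 := H2 n u v uv tr s2.
apply: (@le_lt_trans _ _ (\sum_(i < n) `|f (v i) - f (u i)| + \sum_(i < n) `|g (v i) - g (u i)|)).
  rewrite -big_split; apply: ler_sum => i _ /=.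
  by rewrite opprD addrACA ler_normD.
lra.
Qed.

Lemma absolutely_continuousZ (a b k : R) (f : R -> R) : absolutely_continuous a b f ->
  absolutely_continuous a b (fun t => k * f t).
Proof.
move=> hf e e0; have k0 : 0 < `|k| + 1 by rewrite ltr_wpDl.
have [d d0 H] := hf _ (divr_gt0 e0 k0); exists d => // n u v uv tr s.
have := H n u v uv tr s; rewrite ltr_pdivlMr// => h; apply: le_lt_trans h.
rewrite mulr_suml; apply: ler_sum => i _.
by rewrite -mulrBr normrM mulrC ler_wpM2l// lerDl.
Qed.

Lemma der_absolutely_continuous (a b : R) (f f' : R -> R) : a <= b ->
  (forall t : R, der f t (f' t)) -> continuous f' -> absolutely_continuous a b f.
Proof.
move=> ab df cf' e e0.
have cn : continuous (fun t => `|f' t|) by move=> t; apply: cvg_norm; apply: cf'.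
have [c _ Hc] := EVT_max ab (continuous_subspaceT cn).
pose M := `|f' c| + 1; have M0 : 0 < M by rewrite ltr_wpDl.
exists (e / M); first by rewrite divr_gt0.
move=> n u v uv _; rewrite ltr_pdivlMr// => s; apply: le_lt_trans s.
rewrite mulr_suml; apply: ler_sum => i _; have [au uvi vb] := uv i.
rewrite mulrC; apply: (mvt_bound uvi (fun t _ => df t)) => t /andP[ut tv].
by rewrite ler_wpDr// Hc// in_itv /= (le_trans au ut) (le_trans tv vb).
Qed.

End AbsoluteContinuity.

(** * Nondegeneracy of the moments *)

Section Nondegenerate.
Context {R : realType}.
Local Notation mu := (@lebesgue_measure R).

(** Integration by parts over one period gives the moment; as [p w] is periodic,
    the period may start at any time. *)
Lemma moment_shift (p w w' : R -> R) (tau t0 : R) : 0 < tau -> 0 <= t0 ->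
  periodic p tau -> mu.-integrable `[0, tau] (EFin \o p) ->
  (forall t : R, der w t (w' t)) -> continuous w' ->
  (forall t : R, 0 <= t -> w (t + tau) = w t /\ w' (t + tau) = w' t) ->
  \int[mu]_(t in `[0, tau]) (p (t + t0) * w (t + t0)) = moment (primL p) tau w w'.
Proof.
move=> tau0 t00 per intp dw cw' perw.
have cPw : continuous (fun t => primL p t * w' t).
  by apply: contM => //; exact: primL_cont tau0 per intp.
pose K t := primL p t * w t - prim (fun t => primL p t * w' t) t.
have KE (T : R) : 0 <= T -> \int[mu]_(x in `[0, T]) (p x * w x) = K T.
  rewrite le_eqVlt => /predU1P[<-|T0]; last exact: (primL_by_parts tau0 per intp T0 dw cw').2.
  by rewrite set_itv1 Rintegral_set1 /K primL0 prim0// mul0r subr0.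
have tt0 : 0 < t0 + tau by rewrite ltr_wpDl.
have [ipw _] := primL_by_parts tau0 per intp tt0 dw cw'.
have i1 : mu.-integrable `[0 + t0, tau + t0] (EFin \o (fun x => p x * w x)).
  by apply: integrable_sub ipw; rewrite ?add0r// addrC.
have [_ ->] := integral_shift i1.
rewrite add0r -Rintegral_itv_obnd_cbnd; last first.
  by apply: integrable_oc; apply: integrable_sub ipw; rewrite // addrC.
rewrite -Rintegral_segmentB//; [|by rewrite lerDr ltW|by rewrite [tau + _]addrC].
rewrite !KE//; last by rewrite addrC ltW.
have d (t : R) : 0 <= t <= t0 -> der (fun t => primL p tau * w t -
    (prim (fun t => primL p t * w' t) (t + tau) - prim (fun t => primL p t * w' t) t)) t 0.
  move=> /andP[t1 _].
  have h := derB (derZ (primL p tau) (dw t))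
    (derB (der_shift (der_prim (t + tau) cPw)) (der_prim t cPw)).
  apply: der_eq h _; rewrite (primL_period tau0 per intp t1) (perw t t1).2; ring.
have := der0_const_on t00 d (t := t0); rewrite lexx t00 => /(_ isT).
rewrite add0r prim0// subr0 => H.
have w0 : w tau = w 0 by have := (perw 0 (lexx 0)).1; rewrite add0r.
rewrite /K [tau + t0]addrC (perw t0 t00).1 (primL_period tau0 per intp t00) /moment w0 -H.
by ring.
Qed.

Variables (alpha beta : R) (V p : R -> R) (r t0 : R) (x Q : R -> R) (L : R).
Local Notation tau := (2 * pi : R).
Hypothesis t00 : 0 <= t0.
Hypothesis hphi : forall t, phi alpha beta V r t = x (t + t0).
Hypothesis perx : forall t, x (t + tau) = x t.
Hypothesis hQ : forall t, Q (x t) = derive1n 2 V (x t).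
Hypothesis boundQ : forall y, `|Q y| <= L.
Hypothesis hp : L1_circle p.
Hypothesis hPhi : Phi alpha beta V p (- t0) r != 0.

Definition along (w w' : R -> R) : Prop :=
  forall t : R, der w t (w' t) /\ der w' t (- (Q (x t) * w t)).

Hypothesis along_periodic : forall w w', along w w' -> `|w 0| + `|w' 0| <= 1 ->
  w tau = w 0 /\ w' tau = w' 0.

Let tau0 : 0 < tau.
Proof. by rewrite mulr_gt0// pi_gt0. Qed.

(** Where [psi] were the default value 0 of the choice, [Phi] would vanish. *)
Lemma psi_solution : [/\ variational_solution V (phi alpha beta V r) (psi alpha beta V r),
  psi alpha beta V r 0 = 1 & cderive1 (psi alpha beta V r) 0 = 'i%C].
Proof.
rewrite /psi; case: xgetP => [w _ //|no]; exfalso; move/eqP: hPhi; apply.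
have psi0 : psi alpha beta V r = fun=> 0.
  by rewrite /psi; case: xgetP => // w _ /no.
rewrite /Phi psi0 (_ : cintegral _ _ = 0) ?mulr0//.
rewrite /cintegral; apply/eqP; rewrite eq_complex /=.
have e (k : R[i] -> R) : (fun t : R => k ((p (t - - t0))%:C%C * (0 : R[i]))) = fun=> k 0.
  by apply/funext => t; rewrite mulr0.
rewrite (e (@complex.Re R)) (e (@complex.Im R)) /=.
by rewrite Rintegral_cst// mul0r eqxx.
Qed.

Lemma along_lin (c d : R) (w w' v v' : R -> R) : along w w' -> along v v' ->
  along (fun t => c * w t + d * v t) (fun t => c * w' t + d * v' t).
Proof.
move=> hw hv t; have [w1 w2] := hw t; have [v1 v2] := hv t.
split; first exact: (derD (derZ c w1) (derZ d v1)).
by apply: der_eq (derD (derZ c w2) (derZ d v2)) _; ring.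
Qed.

Lemma along_periodic_all w w' : along w w' -> w tau = w 0 -> w' tau = w' 0 ->
  forall t : R, 0 <= t -> w (t + tau) = w t /\ w' (t + tau) = w' t.
Proof.
move=> hw w0 w'0 t tge.
have L0 : 0 <= L by apply: le_trans (boundQ 0).
have L1 : 0 <= L + 1 by rewrite addr_ge0.
pose f (t : R) := w (t + tau) - w t; pose g (t : R) := w' (t + tau) - w' t.
have df (s : R) : 0 <= s <= t -> der f s (g s).
  by move=> _; exact: (derB (der_shift (hw (s + tau)).1) (hw s).1).
have dg (s : R) : 0 <= s <= t -> der g s (- (Q (x s) * f s)).
  move=> _; apply: der_eq (derB (der_shift (hw (s + tau)).2) (hw s).2) _.
  by rewrite perx /f; ring.
have tt : 0 <= t <= t by rewrite tge lexx.
have H := gronwall L1 (lexx (0 : R)) df dg _ _ tt.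
have {}H : `|f t| + `|g t| <= 0.
  apply: (le_trans (H _ _)); last by rewrite /f /g !add0r w0 w'0 !subrr normr0 !addr0 mulr0.
    move=> s _; rewrite addr0 mulrDl mul1r; have := normr_ge0 (f s) => ?.
    have : 0 <= L * (`|f s| + `|g s|) by rewrite mulr_ge0// addr_ge0.
    lra.
  move=> s _; rewrite addr0 normrN normrM.
  apply: (@le_trans _ _ (L * `|f s|)); first by rewrite ler_wpM2r.
  by apply: ler_pM => //; [lra|rewrite lerDl].
have f0 := normr_ge0 (f t); have g0 := normr_ge0 (g t).
split; apply/eqP; rewrite -subr_eq0 -normr_le0; rewrite -/(f t) -/(g t); lra.
Qed.

(** The real and imaginary parts of [psi], shifted in time, are combinations of the
    two normalized variational solutions; hence if both moments vanished, so would
    [Phi] at the corresponding point. *)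
Lemma moment_nondegenerate : exists w w' v v' : R -> R,
  [/\ along w w', along v v', (w 0, w' 0) = (1, 0), (v 0, v' 0) = (0, 1) &
      (moment (primL p) tau w w', moment (primL p) tau v v') != 0].
Proof.
have [vs ps0 dps0] := psi_solution.
set ps := psi alpha beta V r in vs ps0 dps0.
pose a0 t := complex.Re (ps (t - t0)); pose a1 t := complex.Re (cderive1 ps (t - t0)).
pose b0 t := complex.Im (ps (t - t0)); pose b1 t := complex.Im (cderive1 ps (t - t0)).
have eqs (s : R) :
    derive1 (fun s => complex.Re (cderive1 ps s)) s = - (Q (x (s + t0)) * complex.Re (ps s)) /\
    derive1 (fun s => complex.Im (cderive1 ps s)) s = - (Q (x (s + t0)) * complex.Im (ps s)).
  have [_ _ /eqP] := vs s; rewrite hphi -hQ.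
  case: (ps s) => u v; rewrite eq_complex /= => /andP[/eqP e1 /eqP e2].
  split; apply/eqP; rewrite -addr_eq0; apply/eqP.
    by rewrite -[RHS]e1; ring.
  by rewrite -[RHS]e2; ring.
have ha : along a0 a1.
  move=> t; have [[d1 _] [d2 _] _] := vs (t - t0).
  split; first exact: (der_shift (derivable_der d1)).
  by apply: der_eq (der_shift (derivable_der d2)) _; rewrite (eqs (t - t0)).1 subrK.
have hb : along b0 b1.
  move=> t; have [[_ d1] [_ d2] _] := vs (t - t0).
  split; first exact: (der_shift (derivable_der d1)).
  by apply: der_eq (der_shift (derivable_der d2)) _; rewrite (eqs (t - t0)).2 subrK.
have wron : a0 0 * b1 0 - a1 0 * b0 0 = 1.
  have d (s : R) : der (fun s => a0 s * b1 s - a1 s * b0 s) s 0.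
    have [h1 h2] := ha s; have [h3 h4] := hb s.
    by apply: der_eq (derB (derM h1 h4) (derM h2 h3)) _; ring.
  rewrite (der0_const d 0 t0) /a0 /a1 /b0 /b1 subrr ps0 dps0 /=.
  by rewrite mulr1 mul0r subr0.
pose w t := b1 0 * a0 t + - a1 0 * b0 t; pose w' t := b1 0 * a1 t + - a1 0 * b1 t.
pose v t := - b0 0 * a0 t + a0 0 * b0 t; pose v' t := - b0 0 * a1 t + a0 0 * b1 t.
have hw : along w w' by exact: along_lin.
have hv : along v v' by exact: along_lin.
have w0 : w 0 = 1 by rewrite -wron /w; ring.
have w'0 : w' 0 = 0 by rewrite /w'; ring.
have v0 : v 0 = 0 by rewrite /v; ring.
have v'0 : v' 0 = 1 by rewrite -wron /v'; ring.
exists w, w', v, v'; split=> //; rewrite ?w0 ?w'0 ?v0 ?v'0//.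
have [per intp] := hp.
have part k k' (hk : along k k') := primL_by_parts tau0 per intp tau0
  (fun t => (hk t).1) (cont_der (fun t => (hk t).2)).
apply/eqP => -[Mw Mv].
have [wt w't] : w tau = w 0 /\ w' tau = w' 0.
  by apply: along_periodic => //; rewrite w0 w'0 normr1 normr0 addr0.
have [vt v't] : v tau = v 0 /\ v' tau = v' 0.
  by apply: along_periodic => //; rewrite v0 v'0 normr1 normr0 add0r.
(* the moment is linear, and every variational solution is a combination of the
   two normalized ones *)
have vanish (k k' : R -> R) (c d : R) : along k k' ->
    (forall t, k t = c * w t + d * v t) -> (forall t, k' t = c * w' t + d * v' t) ->
    \int[mu]_(t in `[0, tau]) (p (t + t0) * k (t + t0)) = 0.
  move=> hk e1 e2.
  have pk := along_periodic_all hk; rewrite !e1 !e2 wt w't vt v't in pk.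
  rewrite (moment_shift tau0 t00 per intp (fun t => (hk t).1) (cont_der (fun t => (hk t).2))
    (pk erefl erefl)).
  have [iw Ew] := part _ _ hw; have [iv Ev] := part _ _ hv.
  rewrite /moment -(part _ _ hk).2.
  have -> : \int[mu]_(t in `[0, tau]) (p t * k t) =
     \int[mu]_(t in `[0, tau]) (c * (p t * w t) + d * (p t * v t)).
    by apply: eq_Rintegral => t _; rewrite e1; ring.
  have scal (m : R) (f : R -> R) : mu.-integrable `[0, tau] (EFin \o f) ->
      mu.-integrable `[0, tau] (EFin \o (fun t => m * f t)).
    by move=> hf; apply: eq_integrable (integrableZl _ m hf) => // t _; rewrite /= EFinM.
  rewrite RintegralD//; [|exact: scal|exact: scal].
  rewrite !RintegralZl// Ew Ev; move: Mw Mv; rewrite /moment => -> ->.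
  by rewrite !mulr0 addr0.
have za : \int[mu]_(t in `[0, tau]) (p (t + t0) * a0 (t + t0)) = 0.
  apply: (vanish a0 a1 (a0 0) (a1 0)) => // t.
    by rewrite -[LHS]mul1r -wron /w /v; ring.
  by rewrite -[LHS]mul1r -wron /w' /v'; ring.
have zb : \int[mu]_(t in `[0, tau]) (p (t + t0) * b0 (t + t0)) = 0.
  apply: (vanish b0 b1 (b0 0) (b1 0)) => // t.
    by rewrite -[LHS]mul1r -wron /w /v; ring.
  by rewrite -[LHS]mul1r -wron /w' /v'; ring.
move/eqP: hPhi; apply; rewrite /Phi (_ : cintegral _ _ = 0) ?mulr0//.
rewrite /cintegral; apply/eqP; rewrite eq_complex /=; apply/andP; split; apply/eqP.
  rewrite -[RHS]za; apply: eq_Rintegral => t _; rewrite opprK /a0 addrK -/ps.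
  by case: (ps t) => u u' /=; ring.
rewrite -[RHS]zb; apply: eq_Rintegral => t _; rewrite opprK /b0 addrK -/ps.
by case: (ps t) => u u' /=; ring.
Qed.

End Nondegenerate.

(** * The period annulus *)

Section Heine.
Context {R : realType}.

Lemma heine_segment (f : R -> R) (a b e : R) : continuous f -> 0 < e ->
  exists2 d : R, 0 < d & forall x y, a <= x <= b -> `|y - x| <= d -> `|f y - f x| <= e.
Proof.
move=> cf e0.
pose Pr (d x : R) := forall y, `|y - x| <= d -> `|f y - f x| <= e.
have cov x : `[a, b]%classic x -> \forall x' \near x & d \near (0 : R)^'+, Pr d x'.
  move=> _; have e2 : 0 < e / 2 by rewrite divr_gt0.
  have /cvgrPdist_le/(_ _ e2)/nbhs_ballP[r /= r0 Hr] := cf x.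
  exists (ball x (r / 2), [set d : R | d < r / 2]).
    split; first by apply: nbhsx_ballx; rewrite divr_gt0.
    by apply: nbhs_right_lt; rewrite divr_gt0.
  move=> [x' d] [/= hx hd] y hy.
  have h1 : `|f x - f x'| <= e / 2.
    by apply: Hr; apply: le_ball hx; rewrite ler_pdivrMr// ler_pMr// ler1n.
  have h2 : `|f x - f y| <= e / 2.
    apply: Hr; rewrite /ball /= in hx *.
    have := ler_normB (x - x') (y - x'); rewrite opprB addrA subrK; lra.
  have := ler_normB (f x - f x') (f x - f y).
  by rewrite opprB [f x - f x' + _]addrC addrA subrK; lra.
have /compact_near_coveringP/(_ _ _ Pr _ cov) He := @segment_compact R a b.
have [d [/= d0 dP]] := filter_ex (filterI (nbhs_right_gt (0 : R)) He).
by exists d => // x y hx; apply: dP; rewrite /= in_itv.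
Qed.

End Heine.

Section Potential.
Context {R : realType}.
Variables (alpha beta Vbar : R) (V : R -> R).
Hypothesis halpha : alpha < 0.
Hypothesis hbeta : 0 < beta.
Hypothesis hV : C2_on alpha beta V.
Hypothesis hV0 : V 0 = 0.
Hypothesis hdV0 : derive1 V 0 = 0.
Hypothesis hxV : forall x, alpha < x < beta -> x != 0 -> 0 < x * derive1 V x.
Local Notation tau := (2 * pi : R).
Hypothesis hper : forall x : R -> R, newton_solution alpha beta V x ->
  period_annulus alpha beta Vbar V (x 0, derive1 x 0) -> periodic x tau.

Lemma V_der x : alpha < x < beta -> der V x (derive1 V x).
Proof. by move=> /hV[h _ _]; exact: derivable_der. Qed.

Lemma dV_der x : alpha < x < beta -> der (derive1 V) x (derive1n 2 V x).
Proof. by move=> /hV[_ h _]; exact: derivable_der. Qed.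

Lemma dV_neg x : alpha < x -> x < 0 -> derive1 V x < 0.
Proof.
move=> ax x0; have := @hxV x; rewrite ax (lt_trans x0 hbeta) lt_eqF// => /(_ isT isT).
by rewrite nmulr_rgt0.
Qed.

Lemma dV_pos x : 0 < x -> x < beta -> 0 < derive1 V x.
Proof.
move=> x0 xb; have := @hxV x; rewrite xb (lt_trans halpha x0) gt_eqF// => /(_ isT isT).
by rewrite pmulr_rgt0.
Qed.

Lemma V_decr x y : alpha < x -> x <= y -> y <= 0 -> V y <= V x.
Proof.
move=> ax xy y0; have [t /andP[t1 t2]|c /andP[c1 c2] E] := mvt_point xy (f := V) (f' := derive1 V).
  by apply: V_der; rewrite (lt_le_trans ax t1) (le_lt_trans (le_trans t2 y0) hbeta).
rewrite -subr_le0 E mulr_le0_ge0 ?subr_ge0//.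
have [->|cn] := eqVneq c 0; first by rewrite hdV0.
by apply: ltW; apply: dV_neg; [exact: lt_le_trans ax c1|rewrite lt_neqAle cn (le_trans c2)].
Qed.

Lemma V_incr x y : 0 <= x -> x <= y -> y < beta -> V x <= V y.
Proof.
move=> x0 xy yb; have [t /andP[t1 t2]|c /andP[c1 c2] E] := mvt_point xy (f := V) (f' := derive1 V).
  by apply: V_der; rewrite (lt_le_trans halpha (le_trans x0 t1)) (le_lt_trans t2).
rewrite -subr_ge0 E mulr_ge0 ?subr_ge0//.
have [->|cn] := eqVneq c 0; first by rewrite hdV0.
by apply: ltW; apply: dV_pos; [rewrite lt_def cn (le_trans x0)|exact: le_lt_trans c2 yb].
Qed.

(** The energies up to [Ebar] are confined to [(a, b)]; the force is made globally
    Lipschitz by freezing it outside the larger segment [[a2, b2]]. *)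
Variables (a b a2 b2 E Ebar : R).
Hypothesis ha2 : alpha < a2.
Hypothesis ha : a2 < a.
Hypothesis ha0 : a < 0.
Hypothesis hb0 : 0 < b.
Hypothesis hb : b < b2.
Hypothesis hb2 : b2 < beta.
Hypothesis hEE : E < Ebar.
Hypothesis hEV : Ebar < Vbar.
Hypothesis hEa : Ebar < V a.
Hypothesis hEb : Ebar < V b.

Local Ltac olra := generalize ha2 ha ha0 hb0 hb hb2 hEE hEV hEa hEb; intros; lra.

Definition force (x : R) : R := derive1 V (clamp a2 b2 x).
Definition stiffness (x : R) : R := derive1n 2 V (clamp a2 b2 x).
Definition potential : R -> R := prim force.
Definition energy (z : R * R) : R := z.2 ^+ 2 / 2 + potential z.1.

Let ab2 : a2 <= b2.
Proof. exact: ltW (lt_trans (lt_trans ha ha0) (lt_trans hb0 hb)). Qed.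

Let clampI x : alpha < clamp a2 b2 x < beta.
Proof.
have /andP[h1 h2] := clamp_in x ab2.
by rewrite (lt_le_trans ha2 h1) (le_lt_trans h2 hb2).
Qed.

Lemma force_cont : continuous force.
Proof.
move=> x; apply: continuous_comp; first exact: clamp_cont.
exact: der_cont (dV_der (clampI x)).
Qed.

Lemma stiffness_cont : continuous stiffness.
Proof.
move=> x; apply: continuous_comp; first exact: clamp_cont.
by have [_ _ h] := hV (clampI x).
Qed.

Lemma force_id x : a2 <= x <= b2 -> force x = derive1 V x.
Proof. by move=> h; rewrite /force clamp_id. Qed.

Lemma stiffness_id x : a2 <= x <= b2 -> stiffness x = derive1n 2 V x.
Proof. by move=> h; rewrite /stiffness clamp_id. Qed.

Lemma stiffness_bound : exists2 L : R, 0 < L & forall x, `|stiffness x| <= L.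
Proof.
have cn : continuous (fun x => `|stiffness x|) by move=> t; apply: cvg_norm; apply: stiffness_cont.
have [c _ Hc] := EVT_max ab2 (continuous_subspaceT cn).
exists (`|stiffness c| + 1); first by rewrite ltr_wpDl.
move=> x; apply: (@le_trans _ _ `|stiffness c|); last by rewrite lerDl.
have -> : stiffness x = stiffness (clamp a2 b2 x).
  by rewrite /stiffness (@clamp_id _ a2 b2 (clamp a2 b2 x)) ?clamp_in.
by apply: Hc; rewrite in_itv /= clamp_in.
Qed.

Lemma force_increment (k c x y : R) : a2 <= x -> x <= y -> y <= b2 ->
  (forall s, x <= s <= y -> `|stiffness s - k| <= c) ->
  `|force y - force x - k * (y - x)| <= c * (y - x).
Proof.
move=> ax xy yb hs.
have inx s : x <= s <= y -> a2 <= s <= b2.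
  by move=> /andP[xs sy]; rewrite (le_trans ax xs) (le_trans sy yb).
have df (s : R) : x <= s <= y -> der (fun s => derive1 V s - k * s) s (stiffness s - k).
  move=> hsx; have /andP[h1 h2] := inx s hsx.
  have hI : alpha < s < beta by rewrite (lt_le_trans ha2 h1) (le_lt_trans h2 hb2).
  rewrite stiffness_id ?inx//.
  by apply: der_eq (derB (dV_der hI) (derZ k (der_id s))) _; rewrite mulr1.
have := mvt_bound xy df hs.
rewrite !force_id ?inx ?lexx ?xy//.
by rewrite (_ : _ - _ - (_ - _) = derive1 V y - derive1 V x - k * (y - x))//; ring.
Qed.

Lemma force_lipschitz L : (forall x, `|stiffness x| <= L) ->
  forall x y, `|force x - force y| <= L * `|x - y|.
Proof.
move=> HL x y.
have L0 : 0 <= L by apply: le_trans (HL 0).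
have key u v : a2 <= u -> u <= v -> v <= b2 -> `|force v - force u| <= L * (v - u).
  move=> au uv vb; have := force_increment (k := 0) (c := L) au uv vb.
  by rewrite mul0r subr0; apply => s _; rewrite subr0.
have fc z : force z = force (clamp a2 b2 z).
  by rewrite /force (@clamp_id _ a2 b2 (clamp a2 b2 z)) ?clamp_in.
apply: (@le_trans _ _ (L * `|clamp a2 b2 x - clamp a2 b2 y|)); last first.
  by rewrite ler_wpM2l// clamp_lip.
rewrite fc (fc y).
have /andP[x1 x2] := clamp_in x ab2; have /andP[y1 y2] := clamp_in y ab2.
have [xy|yx] := leP (clamp a2 b2 x) (clamp a2 b2 y).
  by rewrite distrC [`|_ - clamp a2 b2 y|]distrC [`|clamp a2 b2 y - _|]ger0_norm ?subr_ge0// key.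
by rewrite [`|_ - clamp a2 b2 y|]ger0_norm ?subr_ge0 ?(ltW yx)// key// ltW.
Qed.

Lemma force_taylor (e : R) : 0 < e -> exists2 d : R, 0 < d &
  forall x y, a <= x <= b -> `|y - x| <= d ->
    `|force y - force x - stiffness x * (y - x)| <= e * `|y - x|.
Proof.
move=> e0; have [d d0 Hd] := heine_segment a2 b2 stiffness_cont e0.
exists (Num.min d (Num.min (a - a2) (b2 - b))); first by rewrite !lt_min d0 !subr_gt0 ha.
move=> x y /andP[ax xb]; rewrite !le_min => /and3P[h1 h2 h3].
have hx : a2 <= x <= b2 by rewrite (le_trans (ltW ha) ax) (le_trans xb (ltW hb)).
have [xy|yx] := leP x y.
  have yx0 : 0 <= y - x by rewrite subr_ge0.
  rewrite (ger0_norm yx0) in h1 h2 h3 *.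
  apply: force_increment => //; [by case/andP: hx|olra|].
  move=> s /andP[xs sy]; apply: Hd => //.
  by rewrite ger0_norm ?subr_ge0//; olra.
have yx0 : y - x < 0 by rewrite subr_lt0.
rewrite (ltr0_norm yx0) in h1 h2 h3 *.
have := @force_increment (stiffness x) e y x _ (ltW yx) _ _.
rewrite (_ : force x - force y - stiffness x * (x - y) =
  - (force y - force x - stiffness x * (y - x))); last by ring.
rewrite normrN opprB; apply; [olra|by case/andP: hx|].
move=> s /andP[ys sx]; apply: Hd => //.
by rewrite ler0_norm ?subr_le0//; olra.
Qed.

Lemma force_neg x : x < 0 -> force x < 0.
Proof.
move=> x0; apply: dV_neg; first by case/andP: (clampI x).
rewrite /clamp gt_min; apply/orP; left; rewrite gt_max x0 /=; olra.
Qed.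

Lemma force_pos x : 0 < x -> 0 < force x.
Proof.
move=> x0; apply: dV_pos; last by case/andP: (clampI x).
rewrite /clamp lt_min; apply/andP; split; [by rewrite lt_max x0|olra].
Qed.

Lemma potential_der (x : R) : der potential x (force x).
Proof. exact: der_prim force_cont. Qed.

Lemma potential0 : potential 0 = 0.
Proof. exact: prim0 force_cont. Qed.

Lemma potential_cont : continuous potential.
Proof. exact: cont_der potential_der. Qed.

Lemma potential_id x : a2 <= x <= b2 -> potential x = V x.
Proof.
have d (t : R) : a2 <= t <= b2 -> der (fun t => potential t - V t) t 0.
  move=> ht; have /andP[h1 h2] := ht.
  have hI : alpha < t < beta by rewrite (lt_le_trans ha2 h1) (le_lt_trans h2 hb2).
  by apply: der_eq (derB (potential_der t) (V_der hI)) _; rewrite force_id// subrr.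
move=> hx; have h0 : a2 <= (0 : R) <= b2 by apply/andP; split; olra.
have e1 := der0_const_on ab2 d hx; have e2 := der0_const_on ab2 d h0.
by apply/eqP; rewrite -subr_eq0 e1 -e2 potential0 hV0 subrr.
Qed.

Lemma potential_decr x y : x <= y -> y <= 0 -> potential y <= potential x.
Proof.
move=> xy y0; have [c /andP[c1 c2] Ec] := mvt_point xy (fun t _ => potential_der t).
rewrite -subr_le0 Ec mulr_le0_ge0 ?subr_ge0//.
have [cn|cn] := ltP c 0; first exact: ltW (force_neg cn).
have -> : c = 0 by apply/eqP; rewrite eq_le cn (le_trans c2).
by rewrite force_id ?hdV0//; apply/andP; split; olra.
Qed.

Lemma potential_incr x y : 0 <= x -> x <= y -> potential x <= potential y.
Proof.
move=> x0 xy; have [c /andP[c1 c2] Ec] := mvt_point xy (fun t _ => potential_der t).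
rewrite -subr_ge0 Ec mulr_ge0 ?subr_ge0//.
have [cn|cn] := ltP 0 c; first exact: ltW (force_pos cn).
have -> : c = 0 by apply/eqP; rewrite eq_le cn (le_trans x0).
by rewrite force_id ?hdV0//; apply/andP; split; olra.
Qed.

Lemma potential_ge0 x : 0 <= potential x.
Proof.
rewrite -potential0; have [x0|x0] := leP 0 x; first exact: potential_incr.
exact: potential_decr (ltW x0) (lexx 0).
Qed.

Lemma confined x : potential x < Ebar -> a < x < b.
Proof.
move=> h; have pa : potential a = V a by apply: potential_id; apply/andP; split; olra.
have pb : potential b = V b by apply: potential_id; apply/andP; split; olra.
apply/andP; split; rewrite ltNge; apply/negP => hx.
  by have := potential_decr hx (ltW ha0); rewrite pa; olra.
by have := potential_incr (ltW hb0) hx; rewrite pb; olra.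
Qed.

Lemma energy_cont : continuous energy.
Proof.
apply: contD; last exact: (cont_comp cont_fst potential_cont).
apply: contM; last exact: cont_cst.
by apply: (@contM _ _ (fun z : R * R => z.2) (fun z => z.2)); exact: cont_snd.
Qed.

Definition inner : set (R * R) := [set z | energy z <= E].
Definition outer : set (R * R) := [set z | energy z < Ebar].

Lemma inner_compact : compact inner.
Proof.
pose M : R := 2 * Ebar + 1.
apply: (@subclosed_compact _ _ (`[a, b]%classic `*` `[- M, M]%classic)).
- have -> : inner = energy @^-1` [set x | x <= E] by [].
  by apply: preimage_closed; [move=> z _; exact: energy_cont|exact: closed_le].
- by apply: compact_setX; exact: segment_compact.
- move=> z zE; have p0 := potential_ge0 z.1; have s0 := sqr_ge0 z.2.
  rewrite /inner /energy /= in zE.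
  have /andP[h1 h2] : a < z.1 < b by apply: confined; olra.
  split; rewrite /= in_itv /= ?(ltW h1) ?(ltW h2)//.
  have := sqr_ge0 (z.2 - 1); have := sqr_ge0 (z.2 + 1); rewrite sqrrB sqrrD mulr1 expr1n.
  by rewrite /M => ? ?; apply/andP; split; olra.
Qed.

Lemma inner_star z (s : R) : inner z -> 0 <= s <= 1 -> inner (s * z.1, s * z.2).
Proof.
move=> zE /andP[s0 s1]; apply: le_trans zE; rewrite /energy /=.
apply: lerD.
  rewrite ler_pM2r ?invr_gt0// exprMn ler_piMl ?sqr_ge0//.
  by rewrite expr2 mulr_ile1.
have [z0|z0] := leP 0 z.1.
  by apply: potential_incr; [rewrite mulr_ge0|rewrite ler_piMl].
by apply: potential_decr; [rewrite ler_niMl// ltW|rewrite mulr_ge0_le0// ltW].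
Qed.

Lemma inner_outer z : inner z -> exists2 d : R, 0 < d &
  forall v1 v2, `|v1| + `|v2| <= d -> outer (z.1 + v1, z.2 + v2).
Proof.
move=> zE; have : \forall w \near z, energy w < Ebar.
  have zE' : energy z < Ebar by exact: le_lt_trans zE hEE.
  exact: (cvgr_lt _ (@energy_cont z) _ zE').
move=> /nbhs_ballP[r /= r0 Hr]; exists (r / 2); first by rewrite divr_gt0.
move=> v1 v2 hv; apply: Hr; have n1 := normr_ge0 v1; have n2 := normr_ge0 v2.
split; rewrite /ball /= opprD addrA subrr sub0r normrN; olra.
Qed.

(** Position and velocity of the motion without perturbation. *)
Variables (X Y : R * R -> R -> R).
Hypothesis X0 : forall z, X z 0 = z.1.
Hypothesis Y0 : forall z, Y z 0 = z.2.
Hypothesis dX : forall z (t : R), der (X z) t (Y z t).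
Hypothesis dY : forall z (t : R), der (Y z) t (- force (X z t)).

Lemma energy_conserved z t : energy (X z t, Y z t) = energy z.
Proof.
have d (s : R) : der (fun s => energy (X z s, Y z s)) s 0.
  have h1 := derM (derM (dY z s) (dY z s)) (der_cst 2^-1 s).
  have h2 := @der_comp R potential (X z) s _ _ (dX z s) (potential_der (X z s)).
  by apply: der_eq (derD h1 h2) _; field.
by rewrite (der0_const d t 0) X0 Y0 -surjective_pairing.
Qed.

Lemma outer_confined z t : outer z -> a < X z t < b.
Proof.
move=> zE; apply: confined; have := energy_conserved z t.
rewrite /outer /= in zE; have := sqr_ge0 (Y z t); rewrite {1}/energy /=; olra.
Qed.

Lemma confined_in x : a < x < b -> a2 <= x <= b2.
Proof. by move=> /andP[h1 h2]; apply/andP; split; olra. Qed.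

Lemma free_newton z : outer z -> newton_solution alpha beta V (X z).
Proof.
move=> zO t; have hX s := outer_confined s zO.
have EX : derive1 (X z) = Y z by apply/funext => s; exact: der_derive1 (dX z s).
have EY : derive1 (Y z) = (fun s => - force (X z s)).
  by apply/funext => s; exact: der_derive1 (dY z s).
split.
- by have /andP[h1 h2] := hX t; apply/andP; split; olra.
- exact: der_derivable (dX z t).
- by rewrite EX; exact: der_derivable (dY z t).
- by rewrite /derive1n /= EX EY force_id ?addNr//; exact: confined_in.
Qed.

Lemma free_periodic z : outer z -> forall t, X z (t + tau) = X z t /\ Y z (t + tau) = Y z t.
Proof.
move=> zO; have nX := free_newton zO.
have pX : periodic (X z) tau.
  apply: hper => //; rewrite (der_derive1 (dX z 0)) X0 Y0; split => /=.
    by have := outer_confined 0 zO; rewrite X0 => /andP[h1 h2]; apply/andP; split; olra.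
  have h := outer_confined 0 zO; rewrite X0 in h.
  rewrite -potential_id; last exact: confined_in.
  by apply: lt_trans hEV; exact: zO.
move=> t; split; first exact: pX.
have h1 : der (fun s => X z (s + tau)) t (Y z (t + tau)) by exact: der_shift.
have h2 : der (fun s => X z (s + tau)) t (Y z t).
  have -> : (fun s => X z (s + tau)) = X z by apply/funext => s; exact: pX.
  exact: dX.
exact: der_unique h1 h2.
Qed.

(** Negative times are reduced to positive ones, where Gronwall's inequality
    applies, by reversing time; the sign [k] treats both directions at once. *)
Lemma free_unique z x y : x 0 = z.1 -> y 0 = z.2 ->
  (forall t : R, der x t (y t)) -> (forall t : R, der y t (- force (x t))) ->
  forall t, x t = X z t.
Proof.
move=> x0 y0 dx dy; have [L L0 HL] := stiffness_bound.
have lip := force_lipschitz HL.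
have fwd (u v u1 v1 : R -> R) (k : R) : k ^+ 2 = 1 -> u 0 = u1 0 -> v 0 = v1 0 ->
    (forall t : R, der u t (k * v t)) -> (forall t : R, der v t (k * - force (u t))) ->
    (forall t : R, der u1 t (k * v1 t)) -> (forall t : R, der v1 t (k * - force (u1 t))) ->
    forall t : R, 0 <= t -> u t = u1 t.
  move=> k2 e1 e2 d1 d2 d3 d4 t t0.
  have k1 : `|k| = 1 by apply/eqP; rewrite -sqrp_eq1// real_normK ?num_real// k2.
  have L1 : 0 <= L + 1 by rewrite addr_ge0// ltW.
  have H := @gronwall R (fun t => u t - u1 t) (fun t => v t - v1 t)
    (fun t => k * v t - k * v1 t) (fun t => k * - force (u t) - k * - force (u1 t)) t (L + 1) 0
    L1 (lexx _) (fun s _ => derB (d1 s) (d3 s)) (fun s _ => derB (d2 s) (d4 s)).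
  have tt : 0 <= t <= t by rewrite t0 lexx.
  have nn (A B : R) : 0 <= `|A| + `|B| by rewrite addr_ge0.
  have {}H : `|u t - u1 t| + `|v t - v1 t| <= 0.
    apply: (le_trans (H _ _ t tt)); last by rewrite e1 e2 !subrr normr0 !addr0 mulr0.
      move=> s _; rewrite addr0 -mulrBr normrM k1 mul1r.
      rewrite mulrDl mul1r; have := normr_ge0 (u s - u1 s) => ?.
      have : 0 <= L * (`|u s - u1 s| + `|v s - v1 s|) by rewrite mulr_ge0// ltW.
      olra.
    move=> s _; rewrite addr0 -mulrBr normrM k1 mul1r -opprD normrN.
    apply: (le_trans (lip _ _)).
    by apply: ler_pM => //; [exact: ltW|olra|rewrite lerDl].
  apply/eqP; rewrite -subr_eq0 -normr_le0.
  by apply: le_trans H; rewrite lerDl.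
move=> t; have [t0|t0] := leP 0 t.
  apply: (fwd x y (X z) (Y z) 1) => //; rewrite ?expr1n ?x0 ?y0 ?X0 ?Y0//.
  - by move=> s; rewrite mul1r.
  - by move=> s; rewrite mul1r.
  - by move=> s; rewrite mul1r.
  - by move=> s; rewrite mul1r.
have nt : 0 <= - t by olra.
have := fwd (fun s => x (- s)) (fun s => y (- s)) (fun s => X z (- s)) (fun s => Y z (- s)) (- 1)
  _ _ _ _ _ _ _ _ nt.
rewrite opprK; apply; rewrite ?sqrrN ?expr1n ?oppr0 ?x0 ?y0 ?X0 ?Y0//.
- by move=> s; rewrite mulN1r; exact: der_rev.
- by move=> s; rewrite mulN1r; exact: der_rev.
- by move=> s; rewrite mulN1r; exact: der_rev.
- by move=> s; rewrite mulN1r; exact: der_rev.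
Qed.

(** The position attains its maximum over a period, and there the velocity is zero.
    The maximum is not negative, as otherwise the force would have a constant sign
    and the velocity could not be periodic. *)
Lemma rightmost z : inner z -> exists t0 r, [/\ 0 <= t0, 0 <= r < b,
  X z t0 = r, Y z t0 = 0 & energy (r, 0) <= E].
Proof.
move=> zI; have tau0 : 0 < tau by rewrite mulr_gt0// pi_gt0.
have zO : outer z by exact: le_lt_trans zI hEE.
have per := free_periodic zO.
have [t1 ht1 Hmax] := EVT_max (ltW tau0) (continuous_subspaceT (cont_der (dX z))).
rewrite in_itv /= in ht1; case/andP: ht1 => t10 t1t.
have [t0 t0E] : exists t0, t0 = t1 + tau by exists (t1 + tau).
have Xt0 : X z t0 = X z t1 by rewrite t0E; exact: (per t1).1.
move: (tau) tau0 per Hmax t1t t0E => T tau0 per Hmax t1t t0E.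
have max3 (s : R) : 0 <= s -> s <= T + T + T -> X z s <= X z t0.
  move=> s0 s3; rewrite Xt0.
  have in1 (x : R) : 0 <= x -> x <= T -> X z x <= X z t1.
    by move=> h1 h2; apply: Hmax; rewrite in_itv /= h1 h2.
  have shift (x : R) : X z x = X z (x - T).
    by rewrite -(per (x - T)).1 subrK.
  have [h1|h1] := leP s T; first exact: in1.
  have [h2|h2] := leP s (T + T); first by rewrite shift; apply: in1; olra.
  by rewrite shift shift; apply: in1; olra.
have t0in : t0 \in `]0, T + T + T[%R by rewrite in_itv /= t0E; apply/andP; split; olra.
have Yt0 : Y z t0 = 0.
  have H := @derive1_at_max R (X z) 0 (T + T + T) t0 _ _ t0in _.
  apply: der_unique (dX z t0) (H _ _ _); first olra.
    by move=> s _; exact: der_derivable (dX z s).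
  by move=> s; rewrite in_itv /= => /andP[/ltW s0 /ltW s3]; exact: max3.
exists t0, (X z t0); split => //; first by rewrite t0E; olra.
  have /andP[_ ->] := outer_confined t0 zO; rewrite andbT leNgt; apply/negP => neg.
  have [c /andP[c1 c2]] := mvt_point (ltW tau0) (fun s _ => dY z s).
  have := (per 0).2; rewrite add0r => ->; rewrite subrr => /esym/eqP.
  rewrite mulf_eq0 subr0 (gt_eqF tau0) orbF oppr_eq0.
  have : X z c < 0 by apply: le_lt_trans neg; apply: max3; olra.
  by move=> /force_neg/lt_eqF ->.
by have := energy_conserved z t0; rewrite Yt0 => ->.
Qed.

(** Conservation of energy keeps the motion selected by [phi] where the truncated
    force is the true one; uniqueness then applies to it. *)
Lemma phi_free z t0 r : inner z -> 0 <= r < b -> X z t0 = r -> Y z t0 = 0 ->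
  energy (r, 0) <= E -> forall t, phi alpha beta V r t = X z (t + t0).
Proof.
move=> zI /andP[r0 rb] Xr Yr Er t.
have rO : outer (r, 0) by exact: le_lt_trans Er hEE.
have rin : a2 <= r <= b2 by apply/andP; split; olra.
set S := [set x : R -> R | [/\ newton_solution alpha beta V x, x 0 = r & derive1 x 0 = 0]].
have SX : S (X (r, 0)).
  split; [exact: free_newton|exact: X0|].
  by rewrite (der_derive1 (dX (r, 0) 0)) Y0.
have [nph ph0 dph0] : S (phi alpha beta V r).
  by apply: xgetPex; exists (X (r, 0)).
set ph := phi alpha beta V r in nph ph0 dph0 *.
have dph (s : R) : der ph s (derive1 ph s).
  by have [_ h _ _] := nph s; exact: derivable_der.
have ddph (s : R) : der (derive1 ph) s (- derive1 V (ph s)).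
  have [_ _ h e] := nph s; apply: der_eq (derivable_der h) _.
  by apply/eqP; rewrite -addr_eq0; apply/eqP.
have inI s : alpha < ph s < beta by have [] := nph s.
have cons (s : R) : derive1 ph s ^+ 2 / 2 + V (ph s) = V r.
  have d (t' : R) : der (fun s => derive1 ph s * derive1 ph s / 2 + V (ph s)) t' 0.
    have h1 := derM (derM (ddph t') (ddph t')) (der_cst 2^-1 t').
    have h2 := @der_comp R V ph t' _ _ (dph t') (V_der (inI t')).
    by apply: der_eq (derD h1 h2) _; field.
  by have := der0_const d s 0; rewrite dph0 ph0 mul0r mul0r add0r.
have Vr : V r < Ebar.
  move: rO; rewrite /outer /energy /= expr0n mul0r add0r potential_id//.
have Vlt s : V (ph s) < Ebar.
  have := cons s; have := sqr_ge0 (derive1 ph s); lra.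
have phin s : a < ph s < b.
  have /andP[i1 i2] := inI s; have lt := Vlt s.
  apply/andP; split; rewrite ltNge; apply/negP => hs.
    have := V_decr i1 hs (ltW ha0); olra.
  have := V_incr (ltW hb0) hs i2; olra.
have E1 : ph t = X (r, 0) t.
  apply: (free_unique (y := derive1 ph)) => // s.
  by rewrite force_id; [exact: ddph|exact: confined_in].
rewrite E1; apply/esym.
apply: (@free_unique (r, 0) (fun s => X z (s + t0)) (fun s => Y z (s + t0))).
- by rewrite add0r.
- by rewrite add0r.
- by move=> s; exact: der_shift.
- by move=> s; exact: (der_shift (dY z (s + t0))).
Qed.



(** * Escape from the period annulus *)

Variable p : R -> R.
Hypothesis hp : L1_circle p.
Hypothesis hPhi : forall t r, 0 <= r < beta -> Phi alpha beta V p t r != 0.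
Local Notation P := (primL p).

Let tau0 : 0 < tau.
Proof. by rewrite mulr_gt0// pi_gt0. Qed.

Let cP : continuous P.
Proof. exact: primL_cont tau0 hp.1 hp.2. Qed.

Let outer_closed z : outer z ->
  [/\ forall t : R, 0 <= t <= tau -> a <= X z t <= b, X z tau = z.1 & Y z tau = z.2].
Proof.
move=> zO; have per := free_periodic zO 0; rewrite add0r X0 Y0 in per.
split; [|exact: per.1|exact: per.2].
by move=> t _; have /andP[h1 h2] := outer_confined t zO; rewrite !ltW.
Qed.

(** The free motion from [z] reaches its rightmost point after some time [t0]; on
    the clock that shows 0 there it starts at [- t0], the first argument of [Phi]. *)
Lemma moment_nonzero z : inner z -> exists w w' v v' : R -> R,
  [/\ variational stiffness X z w w', variational stiffness X z v v',
      (w 0, w' 0) = (1, 0), (v 0, v' 0) = (0, 1) &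
      (moment P tau w w', moment P tau v v') != 0].
Proof.
move=> zI; have [t0 [r [t00 /andP[r0 rb] Xr Yr Er]]] := rightmost zI.
have zO : outer z by exact: le_lt_trans zI hEE.
have [L L0 HL] := stiffness_bound.
have rbeta : r < beta by olra.
refine (@moment_nondegenerate R alpha beta V p r t0 (X z) stiffness L t00 _ _ _ HL hp _ _).
- by apply: (phi_free zI _ Xr Yr Er); rewrite r0.
- by move=> t; exact: (free_periodic zO t).1.
- by move=> t; apply: stiffness_id; apply: confined_in; exact: outer_confined.
- by apply: hPhi; rewrite r0.
- move=> w w' hw w1.
  exact: (variational_periodic L0 tau0 (force_lipschitz HL) HL force_taylor cP X0 Y0 dX dY
    outer_closed inner_outer zI hw w1).
Qed.

Lemma motion_perturbed (k T : R) (x u : R -> R) : 0 <= T ->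
  (forall t : R, der x t (u t + k * P t) /\ der u t (- force (x t))) ->
  (forall t : R, 0 <= t <= T -> a2 <= x t <= b2) ->
  perturbed_solution alpha beta V p k T x (fun t => u t + k * P t).
Proof.
move=> T0 dxu xin.
have cx : continuous x := cont_der (fun t => (dxu t).1).
have cu : continuous u := cont_der (fun t => (dxu t).2).
split.
- apply: der_absolutely_continuous T0 (fun t => (dxu t).1) _.
  by apply: contD => //; apply: contM => //; exact: cont_cst.
- apply: absolutely_continuousD.
    apply: der_absolutely_continuous T0 (fun t => (dxu t).2) _.
    by move=> t; apply: cvgN; exact: (cont_comp cx force_cont).
  exact: absolutely_continuousZ (primL_absolutely_continuous tau0 hp.1 hp.2 T).
- move=> t /xin/andP[h1 h2]; apply/andP; split; olra.
- apply: filterS (primL_derive tau0 hp.1 hp.2 T); first exact: (ae_filter_ringOfSetsType (@lebesgue_measure R)).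
  move=> t dP /andP[t0 tT]; have dPt : der P t (p t) by apply: dP; rewrite t0.
  split; first exact: (dxu t).1.
  apply: der_eq (derD (dxu t).2 (derZ k dPt)) _.
  by rewrite force_id//; apply: xin; rewrite !ltW.
Qed.

(** While the states at the multiples of the period stay in [inner], the motion
    between these times stays close to a free motion, hence where the truncated
    force is the true one, and the states form a sequence of small Euler steps.
    Negative [k] are steps of size [- k] for the opposite field. *)
Lemma perturbed_escape : exists2 eps0 : R, 0 < eps0 &
  forall (k : R) (x u : R -> R), 0 < `|k| -> `|k| < eps0 ->
  (forall t : R, der x t (u t + k * P t) /\ der u t (- force (x t))) ->
  inner (x 0, u 0) ->
  exists2 n : nat, (forall t : R, 0 <= t <= n%:R * tau -> a2 <= x t <= b2) &
    ~ inner (x (n%:R * tau), u (n%:R * tau) + k * P (n%:R * tau)).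
Proof.
have [L L0 HL] := stiffness_bound; have lip := force_lipschitz HL.
have [h [F1 [F2 [ham nz expa]]]] := period_map_expansion L0 tau0 lip HL force_taylor cP
  X0 Y0 dX dY outer_closed inner_outer moment_nonzero.
have ham' : hamiltonian_on inner (fun z => - h z) (fun z => - F1 z) (fun z => - F2 z).
  move=> e e0; have [d d0 Hd] := ham e e0; exists d => // z zI v1 v2 hv.
  rewrite (_ : _ - _ - _ = - (h (z.1 + v1, z.2 + v2) - h z - (F2 z * v1 - F1 z * v2))).
    by rewrite normrN Hd.
  by ring.
have nz' z : inner z -> (- F1 z, - F2 z) != 0.
  move=> /nz; apply: contra => /eqP[/eqP e1 /eqP e2].
  by move: e1 e2; rewrite !oppr_eq0 => /eqP -> /eqP ->.
have [eta1 eta10 no1] := euler_steps_escape ham inner_compact inner_star nz.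
have [eta2 eta20 no2] := euler_steps_escape ham' inner_compact inner_star nz'.
have [d1 d10 H1] := expa _ eta10; have [d2 d20 H2] := expa _ eta20.
have [B B0 hB] := force_bound tau0 cP.
pose C : R := 2 * expR ((4 * (L + 1) + 2) * tau).
have C0 : 0 < C by rewrite mulr_gt0// expR_gt0.
pose m := Num.min (a - a2) (b2 - b).
have m0 : 0 < m by rewrite lt_min !subr_gt0 ha.
exists (Num.min (Num.min eta1 eta2) (Num.min (Num.min d1 d2) (m / (C * B)))).
  by rewrite !lt_min eta10 eta20 d10 d20 (divr_gt0 m0 (mulr_gt0 C0 B0)).
move=> k x u k0; rewrite !lt_min => /andP[/andP[ke1 ke2] /andP[/andP[kd1 kd2] km]] dxu z0I.
apply: contrapT => no.
pose z (n : nat) : R * R := (x (n%:R * tau), u (n%:R * tau) + k * P (n%:R * tau)).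
pose xs (n : nat) t := x (t + n%:R * tau).
(* restarting the motion after n periods leaves the form of the equation
   unchanged, once the total impulse is added to the velocity *)
pose us (n : nat) t := u (t + n%:R * tau) + k * P (n%:R * tau).
have shift n : motion force P tau k (xs n) (us n).
  move=> t /andP[t0 _]; have [h1 h2] := dxu (t + n%:R * tau); split.
    by apply: der_eq (der_shift h1) _; rewrite (primL_periods tau0 hp.1 hp.2)// /us; ring.
  by apply: der_eq (derD (der_shift h2) (der_cst (k * P (n%:R * tau)) t)) _; rewrite addr0.
have xs0 n : xs n 0 = (z n).1 by rewrite /xs add0r.
have us0 n : us n 0 = (z n).2 by rewrite /us add0r.
have zS n : z n.+1 = (xs n tau, us n tau + k * P tau).
  rewrite /z mulrS mulrDl mul1r (primL_periods tau0 hp.1 hp.2) ?(ltW tau0)// /xs /us.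
  by congr (_, _); ring.
have stay n : (forall t : R, 0 <= t <= n%:R * tau -> a2 <= x t <= b2) /\ inner (z n).
  elim: n => [|n [IH zI]].
    split; last by rewrite /z mul0r primL0 mulr0 addr0.
    move=> t; rewrite mul0r => /le_anti <-; apply: confined_in.
    have zO : outer (x 0, u 0) by exact: le_lt_trans z0I hEE.
    by have := outer_confined 0 zO; rewrite X0.
  have zO : outer (z n) by exact: le_lt_trans zI hEE.
  have st : forall t : R, 0 <= t <= n.+1%:R * tau -> a2 <= x t <= b2.
    move=> t /andP[t0]; rewrite mulrS mulrDl mul1r => tt.
    have [tn|tn] := leP t (n%:R * tau); first by apply: IH; rewrite t0.
    have hs : 0 <= t - n%:R * tau <= tau by rewrite subr_ge0 (ltW tn) lerBlDr.
    have := motion_near L0 lip X0 Y0 dX dY (z n) hB (ltW B0) (shift n) hs.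
    rewrite xs0 us0 !subrr !normr0 !add0r -/C /xs subrK => near.
    have {}near : `|x t - X (z n) (t - n%:R * tau)| <= m.
      apply: le_trans (le_trans _ near) _; first by rewrite lerDl.
      by move: km; rewrite ltr_pdivlMr ?(mulr_gt0 C0 B0)// mulrCA => /ltW.
    move: near; rewrite le_min => /andP[n1 n2].
    have /andP[i1 i2] := outer_confined (t - n%:R * tau) zO.
    move: n1 n2; rewrite !ler_norml => /andP[n1 _] /andP[_ n2].
    clear eta10 eta20 d10 d20 B0 C0 m0 k0 ke1 ke2 kd1 kd2 km tt tn hs.
    by apply/andP; split; olra.
  by split=> //; apply: contrapT => ni; apply: no; exists n.+1.
have [kp|kn] := ltP 0 k.
  have ek : `|k| = k by exact: gtr0_norm.
  rewrite ek in k0 ke1; apply: (no1 k z k0 ke1) => n.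
  have [e1 e2] := H1 (z n) k _ _ (stay n).2 (ltW kd1) (shift n) (xs0 n) (us0 n).
  by rewrite ek in e1 e2; rewrite zS; split; [exact: (stay n).2|exact: e1|exact: e2].
have ek : `|k| = - k by exact: ler0_norm.
have {}ek : k = - `|k| by rewrite ek opprK.
apply: (no2 `|k| z k0 ke2) => n.
have [e1 e2] := H2 (z n) k _ _ (stay n).2 (ltW kd2) (shift n) (xs0 n) (us0 n).
have eF (c : R) : k * c = `|k| * - c by rewrite {1}ek mulrN mulNr.
rewrite eF in e1; rewrite (eF (F2 _)) in e2.
by rewrite zS; split; [exact: (stay n).2|exact: e1|exact: e2].
Qed.

End Potential.

Theorem theorem2p1 (R : realType) (alpha beta Vbar : R) (V p : R -> R)
    (halpha : alpha < 0) (hbeta : 0 < beta)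
    (hV : C2_on alpha beta V)
    (hV0 : V 0 = 0) (hdV0 : derive1 V 0 = 0)
    (hxV : forall x, alpha < x < beta -> x != 0 -> 0 < x * derive1 V x)
    (hVa : V x @[x --> alpha^'+] --> Vbar)
    (hVb : V x @[x --> beta^'-] --> Vbar)
    (hdVa : derive1 V x @[x --> alpha^'+] --> -oo)
    (hper : forall x : R -> R, newton_solution alpha beta V x ->
      period_annulus alpha beta Vbar V (x 0, derive1 x 0) ->
      periodic x (2 * pi))
    (hp : L1_circle p)
    (hPhi : 0 < inf (Phi_moduli alpha beta V p))
    (K : set (R * R)) (hK : compact K)
    (hKP : K `<=` period_annulus alpha beta Vbar V)
    (hK0 : interior K !=set0)
    (d : R) (hd : 0 < d) :
  exists2 eps0 : R, 0 < eps0 &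
    forall eps : R, 0 < `|eps| -> `|eps| < eps0 ->
    forall c : R * R, open_disc c (d / 2) `<=` K ->
    exists2 t : R, 0 < t &
      ~ (flow_image alpha beta V p eps t (open_disc c (d / 2)) `<=` K).
Proof.
have nzPhi t r : 0 <= r < beta -> Phi alpha beta V p t r != 0.
  move=> hr; apply: contraTneq hPhi => Phi0; rewrite -leNgt.
  apply: ge_inf; first by exists 0 => _ [z _ <-]; case: (Phi _ _ _ _ _ _) => u v; exact: sqrtr_ge0.
  exists (t, r); last first.
    exact: etrans (congr1 (@ComplexField.Normc.normc R) Phi0) (ComplexField.Normc.normc0 R).
  by split=> //=; rewrite in_itv.
(* K lies below some energy level E < Vbar *)
pose H (z : R * R) := z.2 ^+ 2 / 2 + V z.1.
have cH : {within K, continuous H}.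
  apply: continuous_in_subspaceT => z; rewrite inE => /hKP[zI _].
  have cVz : {for z, continuous (fun z : R * R => V z.1)}.
    by apply: continuous_comp; [exact: cont_fst|exact: der_cont (V_der hV zI)].
  apply: cvgD; last exact: cVz.
  apply: cvgM; last exact: cvg_cst.
  by apply: cvgM; exact: cont_snd.
have [z0 Kz0] : K !=set0 by case: hK0 => z /interior_subset Kz; exists z.
have [zm Kzm Hmax] := compact_EVT_max (ex_intro _ z0 Kz0) hK cH.
rewrite inE in Kzm.
have EV : H zm < Vbar by have [_] := hKP _ Kzm.
pose E := H zm; pose Ebar := (E + Vbar) / 2.
have hEE : E < Ebar by rewrite /Ebar /E; lra.
have hEV : Ebar < Vbar by rewrite /Ebar /E; lra.
have [a [[ala ha0] hEa]] : exists a, (alpha < a /\ a < 0) /\ Ebar < V a.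
  exact: filter_ex (filterI (filterI (nbhs_right_gt alpha) (nbhs_right_lt halpha))
    (cvgr_gt _ hVa _ hEV)).
have [b [[bb hb0] hEb]] : exists b, (b < beta /\ 0 < b) /\ Ebar < V b.
  exact: filter_ex (filterI (filterI (nbhs_left_lt beta) (nbhs_left_gt hbeta))
    (cvgr_gt _ hVb _ hEV)).
pose a2 := (alpha + a) / 2; pose b2 := (b + beta) / 2.
have ha2 : alpha < a2 by rewrite /a2; lra.
have ha : a2 < a by rewrite /a2; lra.
have hb : b < b2 by rewrite /b2; lra.
have hb2 : b2 < beta by rewrite /b2; lra.
have KE z : K z -> inner V a2 b2 E z.
  move=> Kz; have [/andP[z1 z2] _] := hKP _ Kz.
  have Hz : H z <= E by apply: Hmax; rewrite inE.
  have Vz : V z.1 < Ebar.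
    by have := sqr_ge0 z.2; move: Hz; rewrite /H; lra.
  rewrite /inner /= /energy (potential_id hV hV0 ha2 ha ha0 hb0 hb hb2 hEE hEV hEa hEb)//.
  apply/andP; split; rewrite leNgt; apply/negP => hz.
    by have := V_decr hbeta hV hdV0 hxV z1 (ltW (lt_trans hz ha)) (ltW ha0); lra.
  by have := V_incr halpha hV hdV0 hxV (ltW hb0) (ltW (lt_trans hb hz)) z2; lra.
have [L L0 HL] := stiffness_bound hV ha2 ha ha0 hb0 hb hb2.
have lip := force_lipschitz hV ha2 ha ha0 hb0 hb hb2 HL.
have tau0 : 0 < 2 * pi :> R by rewrite mulr_gt0// pi_gt0.
have cP : continuous (primL p) := primL_cont tau0 hp.1 hp.2.
have free (z : R * R) : exists w : (R -> R) * (R -> R), [/\ w.1 0 = z.1, w.2 0 = z.2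
    & forall t : R, der w.1 t (w.2 t) /\ der w.2 t (- force V a2 b2 (w.1 t))].
  have c0 : continuous (fun _ : R => 0 : R) by exact: cont_cst.
  have [x [u [x0 u0 h]]] := global_cauchy z.1 z.2 c0 L0 lip.
  exists (x, u); split=> // t; have [h1 h2] := h t; split=> //.
  by apply: der_eq h1 _; rewrite addr0.
have [XY hXY] := choice free.
have X0 z : (XY z).1 0 = z.1 by have [] := hXY z.
have Y0 z : (XY z).2 0 = z.2 by have [] := hXY z.
have dX z (t : R) : der (XY z).1 t ((XY z).2 t) by have [_ _ h] := hXY z; exact: (h t).1.
have dY z (t : R) : der (XY z).2 t (- force V a2 b2 ((XY z).1 t)).
  by have [_ _ h] := hXY z; exact: (h t).2.
have [eps0 eps00 esc] := @perturbed_escape R alpha beta Vbar V halpha hbeta hV hV0 hdV0 hxV hper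
  a b a2 b2 E Ebar ha2 ha ha0 hb0 hb hb2 hEE hEV hEa hEb (fun z => (XY z).1)
  (fun z => (XY z).2) X0 Y0 dX dY p hp nzPhi.
exists eps0 => // eps e0 elt c cK.
have cc : open_disc c (d / 2) c.
  by rewrite /open_disc /= !subrr expr0n addr0 sqrtr0 divr_gt0.
have ceP : continuous (fun t => eps * primL p t).
  by apply: contM => //; exact: cont_cst.
have [x [u [x0 u0 dxu]]] := global_cauchy c.1 c.2 ceP L0 lip.
have cI : inner V a2 b2 E (x 0, u 0).
  by rewrite x0 u0 -surjective_pairing; apply: KE; exact: cK.
have [n xin nI] := esc eps x u e0 elt dxu cI.
exists (n%:R * (2 * pi)).
  case: n xin nI => [_ []|n _ _]; last by rewrite mulr_gt0.
  by rewrite mul0r primL0 mulr0 addr0.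
move=> sub; apply/nI/KE/sub; exists x, (fun t => u t + eps * primL p t).
split=> //; last by rewrite primL0 mulr0 addr0 x0 u0 -surjective_pairing.
have T0 : 0 <= n%:R * (2 * pi) :> R by rewrite mulr_ge0// ltW.
exact: (motion_perturbed hV ha2 ha ha0 hb0 hb hb2 hEE hEV hEa hEb hp T0 dxu xin).
Qed.
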